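(* Let $\Omega\subset\mathbb{R}^n$ be a bounded domain satisfying the uniform exterior cone condition with constants $\alpha\in(0,\frac{\pi}{2})$ and $r>0$. Choose $\gamma$ such that $$0<\gamma<\frac{8(\sin\alpha)^{n-2}}{n(13\pi^2+4\pi)}.$$ Then for each $\xi\in\partial\Omega$ there exists a function $w_\xi\in C(\overline\Omega)$ such that $w_\xi(\xi)=0$, $w_\xi>0$ in $\overline\Omega\setminus\{\xi\}$, $$w_\xi(x)\ge\frac{1}{|B(x,\varrho)|}\int_{B(x,\varrho)}w_\xi(y)\,dy\qquad\text{and}\qquad w_\xi(x)\ge\frac12\sup_{B(x,\varrho)}w_\xi+\frac12\inf_{B(x,\varrho)}w_\xi$$ for every ball $B(x,\varrho)\subset\Omega$, and $$\mathcal{L}(|x-\xi|)\le w_\xi(x)\le\gamma^{-2}|x-\xi|^\gamma$$ for every $x\in\overline\Omega$, where $\mathcal{L}(t):=\alpha^{2-n}\min\{t,r\}^\gamma$. In particular, for each $p\in[2,\infty]$ and any admissible radius function $\rho$ in $\Omega$, $w_\xi$ is, simultaneously, a $\mathcal{T}_{\rho,p}$-barrier and a barrier for the $p$-laplacian at $\xi$ in $\Omega$.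
   Context: Uniform exterior cone condition: for $\alpha\in(0,\frac{\pi}{2})$ and $r>0$ let $K_{\alpha,r}=\{x\in\mathbb{R}^n: x_1\le-|x|\cos\alpha\text{ and }|x|\le r\}$. A domain $\Omega\subset\mathbb{R}^n$ satisfies the uniform exterior cone condition with constants $\alpha,r$ if for every $\xi\in\partial\Omega$ there is a rotation $R\in SO(n)$ with $\xi+R(K_{\alpha,r})\subset\mathbb{R}^n\setminus\Omega$. Admissible radius function: a function $\rho:\overline\Omega\to[0,\infty)$ with $0<\rho(x)\le\mathrm{dist}(x,\partial\Omega)$ for every $x\in\Omega$, and $\rho(x)=0$ if and only if $x\in\partial\Omega$. Write $B_\rho(x)=B(x,\rho(x))$. Operators: for $u\in C(\overline\Omega)$ put, for $x\in\Omega$, $\mathcal{S}_\rho u(x)=\frac12\sup_{B_\rho(x)}u+\frac12\inf_{B_\rho(x)}u$ and $\mathcal{M}_\rho u(x)=\frac{1}{|B_\rho(x)|}\int_{B_\rho(x)}u(y)\,dy$, and for $x\in\partial\Omega$, $\mathcal{S}_\rho u(x)=\mathcal{M}_\rho u(x)=u(x)$. For $p\in[2,\infty)$, $\mathcal{T}_{\rho,p}=\frac{p-2}{n+p}\mathcal{S}_\rho+\frac{n+2}{n+p}\mathcal{M}_\rho$, and $\mathcal{T}_{\rho,\infty}=\mathcal{S}_\rho$. $\mathcal{T}_{\rho,p}$-barrier at $\xi\in\partial\Omega$: a function $w\in C(\overline\Omega)$ with $w>0$ in $\overline\Omega\setminus\{\xi\}$, $w(\xi)=0$, and $w\ge\mathcal{T}_{\rho,p}w$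 in $\Omega$. Barrier for the $p$-laplacian at $\xi$ in $\Omega$: a function $w\in C(\overline\Omega)$ with $w>0$ in $\overline\Omega\setminus\{\xi\}$, $w(\xi)=0$, and $w$ $p$-superharmonic in $\Omega$. Here a lower semicontinuous function $u\not\equiv\infty$ in $\Omega$ is $p$-superharmonic if for every $x\in\Omega$ and every $\phi\in C^2(\Omega)$ with $\nabla\phi(x)\ne0$ and $u-\phi>u(x)-\phi(x)=0$ in $\Omega\setminus\{x\}$, one has $\Delta_p\phi(x)\le0$, where $\Delta_p\phi=\mathrm{div}(|\nabla\phi|^{p-2}\nabla\phi)$ for $p<\infty$ and $\Delta_\infty\phi=\sum_{i,j=1}^n\phi_{x_i}\phi_{x_j}\phi_{x_ix_j}$. *)

(* Defs.v *)
From HB Require Import structures.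
From mathcomp Require Import all_boot all_order all_algebra.
From mathcomp Require Import all_classical all_reals all_analysis.
From mathcomp Require Import measurable_realfun.

(* The topology of 'rV[R]_n in the library comes from
   the sup norm; open, closed, bounded sets and continuity do not depend on the
   choice of norm, but balls and distances below are Euclidean. *)

Set Implicit Arguments.
Unset Strict Implicit.
Unset Printing Implicit Defensive.
Import Order.TTheory GRing.Theory Num.Theory numFieldNormedType.Exports.
Local Open Scope classical_set_scope.
Local Open Scope ring_scope.

Definition matrix_borel_display : measure_display.
Proof. exact: default_measure_display. Qed.

Section matrix_borel.
Context {R : realType} {m n : nat}.
Let borel : set (set 'M[R]_(m, n)) := <<s [set A | open A] >>.
Let borel0 : borel set0.
Proof. exact: sigma_algebra0. Qed.
Let borelC A : borel A -> borel (~` A).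
Proof. exact: sigma_algebraC. Qed.
Let borel_bigcup (F : (set _)^nat) :
  (forall i, borel (F i)) -> borel (\bigcup_i F i).
Proof. exact: sigma_algebra_bigcup. Qed.
HB.instance Definition _ := @isMeasurable.Build matrix_borel_display
  'M[R]_(m, n) borel borel0 borelC borel_bigcup.
End matrix_borel.

Section lebesgue_rV.
Context {R : realType}.

Let ratball n (q : 'rV[rat]_n * nat) : set 'rV[R]_n :=
  ball (map_mx ratr q.1 : 'rV[R]_n) q.2.+1%:R^-1.

Let open_rV_bigcup n (A : set 'rV[R]_n) : open A ->
  A = \bigcup_(q in [set q | ratball q `<=` A]) ratball q.
Proof.
move=> oA; apply/seteqP; split => [x Ax|x [q /= qA]]; last exact: qA.
have /nbhs_ballP[e /= e0 eA] : nbhs x A by exact: open_nbhs_nbhs.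
have [k] : exists k : nat, 0 + k.+1%:R^-1 < e / 2.
  by apply: ltr_add_invr; rewrite divr_gt0.
rewrite add0r => ke.
have d0 : 0 < k.+1%:R^-1 :> R by rewrite invr_gt0.
have /choice[q qE] (i : 'I_n) : exists q : rat,
    ball (x ord0 i) k.+1%:R^-1 (ratr q : R).
  have [|q] := @rat_in_itvoo R (x ord0 i - k.+1%:R^-1) (x ord0 i + k.+1%:R^-1).
    by rewrite ltrD2l gtrN.
  rewrite in_itv/= => qx; exists q.
  by rewrite /ball/= distrC ltr_distl.
have qx : ball (map_mx ratr (\row_i q i) : 'rV[R]_n) k.+1%:R^-1 x.
  by split=> // i j; rewrite (ord1 i) !mxE; apply: ball_sym; exact: qE.
exists (\row_i q i, k) => //= y qy; apply: eA.
apply: (@le_ball _ _ _ (k.+1%:R^-1 + k.+1%:R^-1)).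
  by rewrite [leRHS]splitr lerD// ltW.
by apply: ball_triangle qy; exact: ball_sym.
Qed.

Definition consr n (p : R * 'rV[R]_n) : 'rV[R]_n.+1 :=
  \row_j if unlift ord0 j is Some i then p.2 0 i else p.1.

Definition tailr n (v : 'rV[R]_n.+1) : 'rV[R]_n := \row_j v 0 (lift ord0 j).

Lemma consr_head n x (v : 'rV[R]_n) : consr (x, v) 0 ord0 = x.
Proof. by rewrite mxE unlift_none. Qed.

Lemma consrK n x (v : 'rV[R]_n) : tailr (consr (x, v)) = v.
Proof. by apply/rowP => j; rewrite !mxE liftK. Qed.

Let measurable_open_rV n (A : set 'rV[R]_n) : open A -> measurable A.
Proof. exact: sub_sigma_algebra. Qed.

Lemma measurable_consr n : measurable_fun [set: R * 'rV[R]_n] (@consr n).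
Proof.
refine (@measurability _ _ (R * 'rV[R]_n)%type 'rV[R]_n.+1 setT (@consr n)
  [set A | open A] erefl _).
move=> _ [A oA <-]; rewrite setTI (open_rV_bigcup oA) bigcup_mkcond.
rewrite preimage_bigcup; apply: countable_bigcupT_measurable => // -[q k].
case: ifPn => _; last by rewrite preimage_set0.
rewrite (_ : _ @^-1` _ = ball (ratr (q 0 ord0) : R) k.+1%:R^-1 `*`
    ball (\row_j ratr (q 0 (lift ord0 j)) : 'rV[R]_n) k.+1%:R^-1).
  apply: measurableX; first exact: measurable_ball.
  by apply: measurable_open_rV; exact: ball_open.
apply/seteqP; split=> [[x v] /= [k0 bxv]|[x v] /= [bx [k0 bv]]].
- split=> /=; first by have := bxv 0 ord0; rewrite consr_head mxE.
  by split=> // i j; have := bxv 0 (lift ord0 j); rewrite !mxE liftK ord1.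
- split=> // i j; rewrite (ord1 i) !mxE.
  by case: unliftP => [l|] -> //=; have := bv 0 l; rewrite !mxE.
Qed.

Definition lebesgue_cons n (mu : {sigma_finite_measure set 'rV[R]_n -> \bar R})
  : set 'rV[R]_n.+1 -> \bar R :=
  pushforward (lebesgue_measure \x mu)%E (@consr n).

Section lebesgue_cons.
Context {n} (mu : {sigma_finite_measure set 'rV[R]_n -> \bar R}).

Let lebesgue_cons0 : lebesgue_cons mu set0 = 0%E.
Proof. by rewrite /lebesgue_cons /pushforward preimage_set0 measure0. Qed.

Let lebesgue_cons_ge0 A : (0 <= lebesgue_cons mu A)%E.
Proof. by rewrite /lebesgue_cons /pushforward. Qed.

Let lebesgue_cons_sigma_additive : semi_sigma_additive (lebesgue_cons mu).
Proof.
move=> F mF tF mUF; rewrite /lebesgue_cons /pushforward preimage_bigcup.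
apply: measure_semi_sigma_additive.
- by move=> k; rewrite -[X in measurable X]setTI; exact: measurable_consr.
- apply/trivIsetP => /= i j _ _ ij; rewrite -preimage_setI.
  by move/trivIsetP : tF => /(_ _ _ _ _ ij) ->//; rewrite preimage_set0.
- rewrite -preimage_bigcup -[X in measurable X]setTI.
  exact: measurable_consr.
Qed.

HB.instance Definition _ := isMeasure.Build _ _ _ (lebesgue_cons mu)
  lebesgue_cons0 lebesgue_cons_ge0 lebesgue_cons_sigma_additive.

Let lebesgue_cons_sigma_finite : sigma_finite setT (lebesgue_cons mu).
Proof.
have /sigma_finiteP[F [FT ndF mF]] := sigma_finiteT (@lebesgue_measure R).
have /sigma_finiteP[G [GT ndG mG]] := sigma_finiteT mu.
have chead : continuous (fun v : 'rV[R]_n.+1 => v 0 ord0).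
  exact: coord_continuous.
have ctail : continuous (@tailr n).
  move=> v A /nbhs_ballP[e /= e0 eA]; apply/nbhs_ballP; exists e => //= w.
  move=> [_ vw]; apply: eA; split=> // i j; rewrite !mxE; exact: vw.
have mhead A : measurable A ->
    measurable ((fun v : 'rV[R]_n.+1 => v 0 ord0) @^-1` A).
  move=> mA; rewrite -[X in measurable X]setTI.
  have : measurable_fun [set: 'rV[R]_n.+1] (fun v : 'rV[R]_n.+1 => v 0 ord0).
    apply: (measurability _ (RGenOpens.measurableE R)).
    move=> _ [_ [a [b ->]] <-]; rewrite setTI; apply: measurable_open_rV.
    exact: open_comp.
  exact.
have mtail A : measurable A -> measurable (@tailr n @^-1` A).
  move=> mA; rewrite -[X in measurable X]setTI.
  have : measurable_fun [set: 'rV[R]_n.+1] (@tailr n).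
    refine (@measurability _ _ 'rV[R]_n.+1 'rV[R]_n setT (@tailr n)
      [set A | open A] erefl _).
    move=> _ [B oB <-]; rewrite setTI; apply: measurable_open_rV.
    exact: open_comp.
  exact.
exists (fun k =>
  (fun v : 'rV[R]_n.+1 => v 0 ord0) @^-1` F k `&` @tailr n @^-1` G k).
  apply/esym/seteqP; split=> // v _.
  have [i _ Fi] : (\bigcup_i F i) (v 0 ord0) by rewrite -FT.
  have [j _ Gj] : (\bigcup_i G i) (tailr v) by rewrite -GT.
  exists (maxn i j) => //; split.
  - by have /subsetPset := ndF _ _ (leq_maxl i j); exact.
  - by have /subsetPset := ndG _ _ (leq_maxr i j); exact.
move=> k; have [mFk Fk] := mF k; have [mGk Gk] := mG k; split.
  by apply: measurableI; [exact: mhead|exact: mtail].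
rewrite /lebesgue_cons /pushforward (_ : _ @^-1` _ = F k `*` G k).
  by rewrite product_measure1E//= lte_mul_pinfty// ge0_fin_numE.
by apply/seteqP; split=> [[x v]|[x v]] /=; rewrite consr_head consrK.
Qed.

HB.instance Definition _ := Measure_isSigmaFinite.Build _ _ _
  (lebesgue_cons mu) lebesgue_cons_sigma_finite.

End lebesgue_cons.

(* n-dimensional Lebesgue measure on the Borel sets: the push-forward of the
   product of n copies of the one-dimensional measure. *)
Fixpoint lebesgue_rV n : {sigma_finite_measure set 'rV[R]_n -> \bar R} :=
  match n with
  | 0 => \d_ (0 : 'rV[R]_0)
  | n.+1 => lebesgue_cons (lebesgue_rV n)
  end.
End lebesgue_rV.

Section euclidean.
Context {R : realType} {n : nat}.
Implicit Types (x v : 'rV[R]_n) (A : set 'rV[R]_n) (u : 'rV[R]_n -> R).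

Definition enorm v : R := Num.sqrt (\sum_i v 0 i ^+ 2).

Definition eball x (r : R) : set 'rV[R]_n := [set y | enorm (y - x) < r].

Definition edistance x A : R := inf [set enorm (x - y) | y in A].

Definition boundary A : set 'rV[R]_n := closure A `\` A°.

Definition domain A := [/\ open A, connected A & A !=set0].

Definition ball_mean u x (r : R) : R :=
  (fine (lebesgue_rV n (eball x r)))^-1 *
  \int[lebesgue_rV n]_(y in eball x r) u y.

Definition ball_midrange u x (r : R) : R :=
  2^-1 * sup (u @` eball x r) + 2^-1 * inf (u @` eball x r).

(* SO(n); matrices act on row vectors on the right, x |-> x *m Q, which ranges
   over the same rotations since SO(n) is closed under transposition. *)
Definition rotation (Q : 'M[R]_n) := Q *m Q^T = 1%:M /\ \det Q = 1.

End euclidean.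

Section exterior_cone.
Context {R : realType} {n : nat}.

(* The ambient dimension is n.+1, so that a first coordinate exists. *)
Definition cone (alpha r : R) : set 'rV[R]_n.+1 :=
  [set x : 'rV[R]_n.+1 | x 0 ord0 <= - (enorm x * cos alpha) /\ enorm x <= r].

Definition uniform_exterior_cone (Omega : set 'rV[R]_n.+1) (alpha r : R) :=
  forall xi, boundary Omega xi -> exists2 Q : 'M[R]_n.+1, rotation Q &
    [set xi + y *m Q | y in cone alpha r] `<=` ~` Omega.

End exterior_cone.

(* Functions on Omega or on closure Omega are represented by total functions
   whose values elsewhere are irrelevant. *)
Section mean_value_operators.
Context {R : realType} {n : nat} (Omega : set 'rV[R]_n).
Implicit Types (rho u w : 'rV[R]_n -> R) (xi x : 'rV[R]_n) (p : \bar R).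

Definition admissible_radius rho :=
  [/\ forall x, closure Omega x -> 0 <= rho x,
      forall x, Omega x -> 0 < rho x <= edistance x (boundary Omega) &
      forall x, closure Omega x -> rho x = 0 <-> boundary Omega x].

Definition Sop rho u x : R :=
  if x \in Omega then ball_midrange u x (rho x) else u x.

Definition Mop rho u x : R :=
  if x \in Omega then ball_mean u x (rho x) else u x.

(* p ranges over [2, +oo] in \bar R; the value at -oo is junk. *)
Definition Top rho p u x : R :=
  match p with
  | q%:E => (q - 2) / (n%:R + q) * Sop rho u x +
            (n%:R + 2) / (n%:R + q) * Mop rho u x
  | _ => Sop rho u x
  end.

Definition barrier_function xi w :=
  [/\ {within closure Omega, continuous w},
      forall x, closure Omega x -> x != xi -> 0 < w x &
      w xi = 0].

Definition T_barrier rho p xi w :=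
  barrier_function xi w /\ forall x, Omega x -> Top rho p w x <= w x.

End mean_value_operators.

Section p_laplacian.
Context {R : realType} {n : nat}.
Implicit Types (Omega : set 'rV[R]_n) (phi w : 'rV[R]_n -> R)
  (u : 'rV[R]_n -> \bar R) (xi x : 'rV[R]_n) (p : \bar R).

Definition partial (i : 'I_n) phi : 'rV[R]_n -> R := 'D_(delta_mx 0 i) phi.

Definition grad phi x : 'rV[R]_n := \row_i partial i phi x.

Definition C1_on Omega phi := forall i x, Omega x ->
  derivable phi x (delta_mx 0 i) /\ {for x, continuous (partial i phi)}.

Definition C2_on Omega phi :=
  C1_on Omega phi /\ forall i, C1_on Omega (partial i phi).

Definition p_laplace p phi x : R :=
  match p with
  | q%:E =>
    \sum_i partial i
      (fun y => enorm (grad phi y) `^ (q - 2) * partial i phi y) x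
  | _ =>
    \sum_i \sum_j partial i phi x * partial j phi x *
                  partial j (partial i phi) x
  end.

(* Lower semicontinuity in Omega is taken in the relative topology; the value
   -oo is excluded. *)
Definition p_superharmonic Omega p u :=
  [/\ forall x, Omega x -> (-oo < u x)%E,
      lower_semicontinuous (u : subspace Omega -> \bar R),
      exists2 x, Omega x & u x != +oo%E &
      forall x phi, Omega x -> C2_on Omega phi -> grad phi x != 0 ->
        u x = (phi x)%:E ->
        (forall y, Omega y -> y != x -> ((phi y)%:E < u y)%E) ->
        p_laplace p phi x <= 0].

Definition p_barrier Omega p xi w :=
  barrier_function Omega xi w /\ p_superharmonic Omega p (EFin \o w).

End p_laplacian.

(* Main.v *)
From HB Require Import structures.
Require Import Defs.
From mathcomp Require Import all_boot all_order all_algebra.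
From mathcomp Require Import all_classical all_reals all_analysis.
From mathcomp Require Import measurable_realfun ring lra.

(* Put q = |y - xi|, let c be the cosine of the angle between y - xi and the
   direction e opposite to the axis of the exterior cone at xi, and let k + 2 be the
   dimension (in dimension one no bounded domain satisfies the cone condition,
   since SO(1) is trivial).  The barrier is w = min(W, alpha^-k r^gamma) with
   W = q^gamma F(c), where F is a C^2 profile on [-cos alpha, 1] bounded by
   gamma^-2 and below by alpha^-k.  Because of the truncation only points x with
   q <= r matter, and a ball around such an x contained in Omega stays off the
   whole infinite cone c <= -cos alpha (retract radially to the sphere of
   radius r), so that W is smooth on it.

   - Mean values: W is superharmonic by the choice of F.  Instead of the
     divergence theorem, u(x + t (y - x)) is differentiated in t, and the
     y-integral of each (y_i - x_i) d_i u is integrated by parts along chords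
     against the weight (s^2 - |y - x|^2) / 2, which vanishes on the sphere.
   - Midranges: a point y of the ball with polar coordinates
     (rho, theta_x + psi), in a plane through xi, x and e, is paired with
     z = (2 |x - xi| cos psi - rho, theta_x - psi).  Then |z - x| <= |y - x|, and
     the strong concavity of t^gamma pays for the asymmetry of F.
   - Viscosity: at a touching point the Hessian of phi is below that of W; it
     suffices that the trace of D^2 W and D^2 W (grad W, grad W) are <= 0. *)

(** The two mean inequalities make opposite demands on [F]. Superharmonicity asks for [(1 - c^2) F''
    - (k + 1) c F' <= - gamma (gamma + k) F], so [F] cannot be flat; the midrange pairing loses, to
    first order, the angular slope of [F] times the radial displacement, so [F] has to be nearly
    flat. Both hold because [F] is the large constant [gamma^-2] minus a correction whose size
    relative to that constant is a multiple of [gamma (gamma + k) (sin alpha)^-k]. The bound on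
    [gamma] keeps the angular slope below [3/8] of a lower bound [m] of [F], and [3/8] is what the
    concavity of [t^gamma] can pay for. The sign of [D^2 W (grad W, grad W)] settles the viscosity
    inequality but says nothing about balls of finite radius; hence the explicit partner [z] for the
    midranges. *)

Set Implicit Arguments.
Unset Strict Implicit.
Unset Printing Implicit Defensive.
Import Order.TTheory GRing.Theory Num.Theory numFieldNormedType.Exports.
Local Open Scope classical_set_scope.
Local Open Scope ring_scope.

(** * One-variable calculus *)

Section one_variable.
Context {R : realType}.
Implicit Types f g df ddf : R -> R.

Lemma is_derive1_continuous f (x d : R) : is_derive x 1 f d -> {for x, continuous f}.
Proof.
by move=> [df _]; apply: differentiable_continuous; apply/derivable1_diffP.
Qed.

Lemma mean_value f df (a b : R) : a <= b ->
  (forall x, a <= x <= b -> is_derive x 1 f (df x)) ->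
  exists2 c, a <= c <= b & f b - f a = df c * (b - a).
Proof.
move=> ab fdf.
have [x xab||c] := @MVT_segment _ f df a b ab.
- by apply: fdf; move: xab; rewrite in_itv/= => /andP[/ltW -> /ltW ->].
- apply: derivable_within_continuous => x; rewrite in_itv/= => xab.
  by have [] := fdf _ xab.
- by rewrite in_itv/=; exists c.
Qed.

Lemma is_derive_ge0_le f df (a b : R) : a <= b ->
  (forall x, a <= x <= b -> is_derive x 1 f (df x)) ->
  (forall x, a <= x <= b -> 0 <= df x) -> f a <= f b.
Proof.
move=> ab fdf df0; have [c cab E] := mean_value ab fdf.
by rewrite -subr_ge0 E mulr_ge0 ?df0// subr_ge0.
Qed.

Lemma concave_midpoint f df ddf (a b : R) : a <= b ->
  (forall x, a <= x <= b -> is_derive x 1 f (df x)) ->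
  (forall x, a <= x <= b -> is_derive x 1 df (ddf x)) ->
  (forall x, a <= x <= b -> ddf x <= 0) -> f a + f b <= 2 * f ((a + b) / 2).
Proof.
move=> ab fdf dfddf ddf0; set m := (a + b) / 2.
have [am mb] : a <= m /\ m <= b by split; rewrite /m; lra.
have [x /andP[ax xm] Ex] := @mean_value f df a m am
  (fun x xam => fdf x ltac:(lra)).
have [y /andP[my yb] Ey] := @mean_value f df m b mb
  (fun x xmb => fdf x ltac:(lra)).
have xy : x <= y by lra.
have [z /andP[xz zy] Ez] := @mean_value df ddf x y xy
  (fun z zxy => dfddf z ltac:(lra)).
have zab : a <= z <= b by lra.
have dyx : df y <= df x.
  by rewrite -subr_le0 Ez mulr_le0_ge0 ?ddf0 ?subr_ge0.
suff : f b - f m <= f m - f a by lra.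
have -> : f m - f a = df x * (b - m) by rewrite Ex /m; congr (_ * _); lra.
by rewrite Ey ler_wpM2r// subr_ge0.
Qed.

(** A negative [ddf] would make [df] negative just to the right of [a], and [f] would drop below its
    minimum there. *)
Lemma second_derivative_min f df (a e : R) (ddf : R) : 0 < e ->
  (forall x, `|x - a| < e -> is_derive x 1 f (df x)) ->
  is_derive a 1 df ddf ->
  (forall x, `|x - a| < e -> f a <= f x) -> df a = 0 /\ 0 <= ddf.
Proof.
move=> e0 fdf dfddf fmin.
have dfa0 : df a = 0.
  have ain : a \in `]a - e, a + e[ by rewrite in_itv/=; lra.
  have D : is_derive a (1 : R) f 0.
    apply: (@derive1_at_min _ f (a - e) (a + e) a _ _ ain).
    - lra.
    - move=> t; rewrite in_itv/= => tb.
      by have [|] := fdf t => //; rewrite ltr_norml; lra.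
    - by move=> t; rewrite in_itv/= => tb; apply: fmin; rewrite ltr_norml; lra.
  have D' : is_derive a (1 : R) f (df a) by apply: fdf; rewrite subrr normr0.
  by rewrite -(@derive_val _ _ _ _ _ _ _ D') (@derive_val _ _ _ _ _ _ _ D).
split=> //; rewrite leNgt; apply/negP => dd0.
have dcvg : h^-1 *: (df (h + a) - df a) @[h --> 0^'] --> ddf.
  have [dd <-] := dfddf.
  have -> : (fun h : R => h^-1 *: (df (h + a) - df a)) =
      (fun h : R => h^-1 *: ((df \o shift a) (h *: 1) - df a)).
    by apply/funext => h /=; rewrite /GRing.scale/= mulr1.
  exact: dd.
have : \forall h \near 0^', h^-1 *: (df (h + a) - df a) < 0.
  by apply: (@cvgr_lt _ _ _ _ _ ddf).
rewrite near_withinE => /nbhs_ballP[d /= d0 dP].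
have dneg h : 0 < h < d -> df (a + h) < 0.
  move=> /andP[h0 hd]; have := dP h.
  rewrite /ball/= sub0r normrN gtr0_norm// => /(_ hd (lt0r_neq0 h0)).
  by rewrite dfa0 subr0 addrC /GRing.scale/= pmulr_rlt0 ?invr_gt0.
pose h := Num.min d e / 2.
have [h0 hd he] : [/\ 0 < h, h < d & h < e].
  rewrite /h; have : 0 < Num.min d e by rewrite lt_min d0.
  have : Num.min d e <= d by rewrite ge_min lexx.
  have : Num.min d e <= e by rewrite ge_min lexx orbT.
  by split; lra.
have [|x||c] := @MVT _ f df a (a + h); first by rewrite ltrDl.
- by rewrite in_itv/= => xb; apply: fdf; rewrite ltr_norml; lra.
- apply: derivable_within_continuous => x; rewrite in_itv/= => xab.
  by have [] := fdf x => //; rewrite ltr_norml; lra.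
rewrite in_itv/= => /andP[ac ch] E.
have := fmin (a + h); rewrite addrAC subrr add0r gtr0_norm// => /(_ he).
rewrite -subr_ge0 E addrAC subrr add0r pmulr_lge0//.
have := dneg (c - a); rewrite addrCA subrr addr0 => /(_ ltac:(lra)); lra.
Qed.

Lemma is_derive_glue f g (a d : R) : f a = g a ->
  is_derive a 1 f d -> is_derive a 1 g d ->
  is_derive a 1 (fun x => if x <= a then f x else g x) d.
Proof.
move=> fga [df fd] [dg gd]; set k := fun x => _.
have cv : (fun h => h^-1 *: ((k \o shift a) (h *: 1) - k a)) @ 0^' --> d.
  have cf : (fun h => h^-1 *: ((f \o shift a) (h *: 1) - f a)) @ 0^' --> d.
    by rewrite -fd; exact: df.
  have cg : (fun h => h^-1 *: ((g \o shift a) (h *: 1) - g a)) @ 0^' --> d.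
    by rewrite -gd; exact: dg.
  apply/cvgrPdist_lt => e e0.
  move/cvgrPdist_lt : cf => /(_ e e0) cf; move/cvgrPdist_lt : cg => /(_ e e0) cg.
  near=> h.
  have : `|d - h^-1 *: ((f \o shift a) (h *: 1) - f a)| < e by near: h.
  have : `|d - h^-1 *: ((g \o shift a) (h *: 1) - g a)| < e by near: h.
  by rewrite /k/= lexx; case: ifP => // _; rewrite fga.
by apply: DeriveDef; [apply/cvg_ex; exists d|apply: cvg_lim].
Unshelve. all: by end_near. Qed.

Lemma sin_le_id (x : R) : 0 <= x -> sin x <= x.
Proof.
move=> x0; rewrite -subr_ge0.
have := @is_derive_ge0_le (fun t => t - sin t) (fun t => 1 - cos t) 0 x x0.
rewrite sin0 subr0; apply=> t _.
by rewrite subr_ge0 cos_le1.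
Qed.

Lemma cos_ge_quadratic (x : R) : 0 <= x -> 1 - x ^+ 2 / 2 <= cos x.
Proof.
move=> x0; rewrite -subr_ge0.
have := @is_derive_ge0_le (fun t => cos t - (1 - t ^+ 2 / 2)) (fun t => t - sin t) 0 x x0.
rewrite cos0 expr0n/= mul0r subr0 subrr; apply=> t /andP[t0 _].
- apply: is_derive_eq; rewrite /GRing.scale/=; lra.
- by rewrite subr_ge0 sin_le_id.
Qed.

Lemma sin_ge_cubic (x : R) : 0 <= x -> x - x ^+ 3 / 6 <= sin x.
Proof.
move=> x0; rewrite -subr_ge0.
have := @is_derive_ge0_le (fun t => sin t - (t - t ^+ 3 / 6))
  (fun t => cos t - (1 - t ^+ 2 / 2)) 0 x x0.
rewrite sin0 expr0n/= mul0r !subr0; apply=> t /andP[t0 _].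
- apply: is_derive_eq; rewrite /GRing.scale/=; lra.
- by rewrite subr_ge0 cos_ge_quadratic.
Qed.

(** This is [sin y <= y] at [y = pi / 6]. The comparisons with [13 * pi ^+ 2 + 4 * pi] rest on
    it. *)
Lemma pi_ge3 : 3 <= pi :> R.
Proof.
have p0 := @pi_gt0 R.
set y := pi / 6 : R.
have s3 : 3 * sin y - 4 * sin y ^+ 3 = 1.
  transitivity (sin (pi / 2 : R)); last exact: sin_pihalf.
  have -> : pi / 2 = y + (y + y) :> R by rewrite /y; lra.
  rewrite sinD cosD sinD; have := cos2Dsin2 y; set s := sin y; set c := cos y => E.
  have E2 : c ^+ 2 = 1 - s ^+ 2 by rewrite -E addrK.
  transitivity (3 * s * c ^+ 2 - s ^+ 3); last by ring.
  by rewrite E2; ring.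
have sy0 : 0 < sin y by rewrite sin_gt0_pi// /y; apply/andP; split; lra.
(* The triple-angle formula gives a cubic for [sin y] with double root [1/2]; its other root [-1] is
   negative. *)
have /eqP : (sin y + 1) * (2 * sin y - 1) ^+ 2 = 0 by transitivity (1 - (3 * sin y - 4 * sin y ^+ 3)); [ring|rewrite s3 subrr].
rewrite mulf_eq0 sqrf_eq0 => /orP[] /eqP; first lra.
have := @sin_le_id y; rewrite /y => /(_ ltac:(lra)); lra.
Qed.

(** By [1 - cos x = 2 sin^2 (x/2)] and [sin y >= 5/6 y] on [[0, 1]]; the constant is
    [2 (5/12)^2]. *)
Lemma one_sub_cos_ge (x : R) : 0 <= x <= 2 -> 25 / 72 * x ^+ 2 <= 1 - cos x.
Proof.
move=> /andP[x0 x2]; set y := x / 2.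
have -> : x = y + y by rewrite /y; lra.
have y01 : 0 <= y <= 1 by rewrite /y; lra.
have /andP[y0 y1] := y01.
rewrite cosD; have := cos2Dsin2 y; have := sin_ge_cubic y0.
set s := sin y; set c := cos y => sy E.
have -> : 1 - (c * c - s * s) = 2 * s ^+ 2 by nra.
have s1 : 5 / 6 * y <= s by nra.
have : (5 / 6 * y) ^+ 2 <= s ^+ 2 by rewrite ler_sqr// nnegrE; lra.
nra.
Qed.

(** Convexity of [expR] between [ln t] and [0]. *)
Lemma powR_bernoulli (t a : R) : 0 < t -> 0 <= a <= 1 ->
  t `^ a <= 1 + a * (t - 1).
Proof.
move=> t0 /andP[a0 a1].
have := @convex_expR R (Itv01 a0 a1) (ln t) 0.
rewrite !convRE/= expR0 mulr0 addr0 lnK ?posrE// /powR gt_eqF//.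
by move=> /le_trans; apply; rewrite /unstable.onem; lra.
Qed.

(** Strong concavity of the power with an explicit constant. For [t >= 0] Bernoulli's inequality
    reduces the sign of [df t] to [gamma <= (3 - 2 t) / 5], which on [[0, 1]] amounts to
    [gamma <= 1/5]; both constants [1/5] come from here. *)
Lemma powR_le_quadratic (gamma h : R) : 0 < gamma <= 1 / 5 -> -1 < h <= 1 ->
  (1 + h) `^ gamma <= 1 + gamma * h - gamma / 5 * h ^+ 2.
Proof.
move=> /andP[g0 g5] /andP[hN1 h1].
have bern := powR_bernoulli.
pose f (t : R) := 1 + gamma * t - gamma / 5 * t ^+ 2 - (1 + t) `^ gamma.
pose df (t : R) := gamma * (1 - 2 / 5 * t - (1 + t) `^ (gamma - 1)).
have fdf (t : R) : -1 < t -> is_derive t 1 f (df t).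
  move=> t0; have t1 : 0 < 1 + t by lra.
  have D : is_derive t (1 : R) (fun x : R => (1 + x) `^ gamma) (gamma * (1 + t) `^ (gamma - 1)).
    have Dp := is_derive1_powR gamma t1.
    have D1 : is_derive t (1 : R) (fun x : R => 1 + x) 1.
      by apply: is_derive_eq; rewrite add0r mulr1.
    have := @is_derive1_comp _ (fun z => z `^ gamma) (fun x => 1 + x) t _ _ Dp D1.
    by rewrite mulr1.
  rewrite /f; apply: is_derive_eq; rewrite /df /GRing.scale/=; lra.
have f0 : f 0 = 0 by rewrite /f addr0 powR1; lra.
have powE (t : R) : -1 < t -> (1 + t) `^ (gamma - 1) = (1 + t) `^ gamma / (1 + t).
  move=> t1; rewrite powRD; last by apply/implyP => _; rewrite gt_eqF//; lra.
  by rewrite powR_inv1//; lra.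
suff : 0 <= f h by rewrite /f; lra.
have [h0|h0] := leP 0 h.
- rewrite -f0; apply: (is_derive_ge0_le h0 (df := df)) => t /andP[t0 th].
    by apply: fdf; lra.
  rewrite /df mulr_ge0 ?(ltW g0)// subr_ge0 powE ?ler_pdivrMr; try lra.
  have := bern (1 + t) gamma ltac:(lra) ltac:(lra).
  rewrite addrAC subrr add0r => /le_trans; apply; nra.
- have E := @is_derive_ge0_le (\- f) (fun t => - df t) h 0 (ltW h0).
  have : (\- f) h <= (\- f) 0.
    apply: E => t /andP[ht t0]; first by apply: is_deriveN; apply: fdf; lra.
    rewrite /df -mulrN mulr_ge0 ?(ltW g0)// oppr_ge0 subr_le0.
    have t1 : 0 < 1 + t by lra.
    (* A lower bound for a negative power is wanted, whereas Bernoulli bounds positive powers from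
       above: multiply by the inverse power. *)
    rewrite -(ler_pM2r (powR_gt0 (1 - gamma) t1)).
    have -> : (1 + t) `^ (gamma - 1) * (1 + t) `^ (1 - gamma) = 1.
      rewrite -powRD; last by apply/implyP => _; rewrite gt_eqF.
      by rewrite addrA subrK subrr powRr0.
    have := bern (1 + t) (1 - gamma) t1 ltac:(lra).
    rewrite addrAC subrr add0r => B.
    have : (1 - 2 / 5 * t) * (1 + t) `^ (1 - gamma) <= (1 - 2 / 5 * t) * (1 + (1 - gamma) * t).
      by rewrite ler_wpM2l//; lra.
    nra.
  by rewrite /= f0; lra.
Qed.
End one_variable.

(** * The angular profile *)

Section glue.
Context {R : realType}.
Implicit Types f g : R -> R.

Definition glue (a : R) f g x := if x <= a then f x else g x.

Lemma is_derive_glueT f g (a x d : R) : f a = g a ->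
  (x <= a -> is_derive x 1 f d) -> (a <= x -> is_derive x 1 g d) ->
  is_derive x 1 (glue a f g) d.
Proof.
move=> fga df dg; have [xa|ax|xa] := ltgtP x a.
- apply: near_eq_is_derive (df (ltW xa)).
  near=> y; have ya : y < a by near: y; exact: lt_nbhsl.
  by rewrite /glue (ltW ya).
- apply: near_eq_is_derive (dg (ltW ax)).
  near=> y; have ay : a < y by near: y; exact: lt_nbhsr.
  by rewrite /glue leNgt ay.
- by rewrite xa; apply: is_derive_glue => //; rewrite -xa; [apply: df|apply: dg]; rewrite xa.
Unshelve. all: by end_near. Qed.

Lemma continuous_glue f g (a x : R) : f a = g a ->
  (x <= a -> {for x, continuous f}) -> (a <= x -> {for x, continuous g}) ->
  {for x, continuous (glue a f g)}.
Proof.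
move=> fga cf cg; apply/cvgrPdist_lt => e e0.
have [xa|ax|xa] := ltgtP x a.
- have /cvgrPdist_lt/(_ _ e0) := cf (ltW xa).
  rewrite /glue (ltW xa) => fe; near=> y.
  have ya : y < a by near: y; exact: lt_nbhsl.
  by rewrite (ltW ya); near: y.
- have /cvgrPdist_lt/(_ _ e0) := cg (ltW ax).
  rewrite /glue [x <= a]leNgt ax/= => ge; near=> y.
  have ay : a < y by near: y; exact: lt_nbhsr.
  by rewrite leNgt ay/=; near: y.
- have xa' : x <= a by rewrite xa. have ax' : a <= x by rewrite xa.
  have /cvgrPdist_lt/(_ _ e0) fe := cf xa'.
  have /cvgrPdist_lt/(_ _ e0) ge := cg ax'.
  near=> y; rewrite /glue xa'.
  case: ifP => _; first by near: y.
  by rewrite xa fga -xa; near: y.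
Unshelve. all: by end_near. Qed.
End glue.

(** With [c = cos theta], the left-hand side of [profile_concave] is the second derivative of
    [F (cos theta)] in [theta], that of [profile_laplace] is [q^(2 - gamma)] times the Laplacian of
    [W] in dimension [k + 2], and [profile_lip] bounds the derivative in [theta]. The interval []a,
    2[] exceeds [[- cos alpha, 1]] on both sides, so that all derivatives are two-sided. *)
Record profile (R : realType) (k : nat) (alpha gamma a m : R)
    (F F1 F2 : R -> R) : Prop := Profile {
  profile_a : -1 < a < - cos alpha ;
  profile_F : forall c, a < c < 2 -> is_derive c 1 F (F1 c) ;
  profile_F1 : forall c, a < c < 2 -> is_derive c 1 F1 (F2 c) ;
  profile_F2 : forall c, a < c < 2 -> {for c, continuous F2} ;
  profile_incr : forall c, - cos alpha <= c <= 1 -> 0 <= F1 c ;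
  profile_concave : forall c, - cos alpha <= c <= 1 ->
    (1 - c ^+ 2) * F2 c - c * F1 c <= 0 ;
  profile_laplace : forall c, - cos alpha <= c <= 1 ->
    (1 - c ^+ 2) * F2 c - k.+1%:R * c * F1 c + gamma * (gamma + k%:R) * F c <= 0 ;
  profile_bound : forall c, - cos alpha <= c <= 1 -> m <= F c <= gamma ^- 2 ;
  profile_lip : forall c, - cos alpha <= c <= 1 ->
    Num.sqrt (1 - c ^+ 2) * F1 c <= 3 / 8 * m ;
  profile_m : alpha ^- k <= m }.

Section profile.
Context {R : realType} (k : nat) (alpha gamma : R).
Hypothesis alpha_itv : 0 < alpha < pi / 2.
Hypothesis gamma_gt0 : 0 < gamma.
Hypothesis gamma_lt :
  gamma * (k.+2%:R * (13 * pi ^+ 2 + 4 * pi)) < 8 * sin alpha ^+ k.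

(* The profile is [C - lam * \int_c^1 H], so [H] has to satisfy
   [(1 - c^2) H' - (k + 1) c H <= -1].  On [c <= 0] the left-hand side is
   [- sigma^-k], [sigma^(k + 1)] being an integrating factor; on [c >= 0] the
   linear function matching [Hl] to first order at [0] is enough. *)
Let sigma (c : R) : R := Num.sqrt (1 - c ^+ 2).
Let Hl (c : R) : R := (2 - asin c) * (sigma c)^-1 ^+ k.+1.
Let hl (c : R) : R := - (sigma c)^-1 ^+ k.+2 +
  (2 - asin c) * (k.+1%:R * c * (sigma c)^-1 ^+ k.+3).
Let Hr (c : R) : R := 2 - c.
Let H := glue 0 Hl Hr.
Let h := glue 0 hl (cst (-1)).

Let asin0 : asin 0 = 0 :> R.
Proof. by rewrite -[in LHS]sin0 sinK// in_itv/= oppr_le0 divr_ge0 ?pi_ge0. Qed.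

Let sigma0 : sigma 0 = 1. Proof. by rewrite /sigma expr0n/= subr0 sqrtr1. Qed.

Let sqr1 (c : R) : -1 < c <= 0 -> 0 < 1 - c ^+ 2.
Proof. by move=> /andP[c1 c0]; nra. Qed.

Let sigma_gt0 (c : R) : -1 < c <= 0 -> 0 < sigma c.
Proof. by move=> c1; rewrite sqrtr_gt0 sqr1. Qed.

Let sigma_le1 (c : R) : sigma c <= 1.
Proof. by rewrite -sqrtr1 ler_wsqrtr// gerBl sqr_ge0. Qed.

Let sqr_sigma (c : R) : -1 <= c <= 1 -> sigma c ^+ 2 = 1 - c ^+ 2.
Proof. by move=> c1; rewrite sqr_sqrtr//; nra. Qed.

Let is_derive_sigma (c : R) : -1 < c <= 0 -> is_derive c 1 sigma (- c / sigma c).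
Proof.
move=> c1; have D := is_derive1_sqrt (sqr1 c1).
have D1 : is_derive c (1 : R) (fun x : R => 1 - x ^+ 2) (- (2 * c)).
  by apply: is_derive_eq; rewrite /GRing.scale/=; ring.
have := @is_derive1_comp _ Num.sqrt (fun x : R => 1 - x ^+ 2) c _ _ D D1.
rewrite (_ : _ * _ = - c / sigma c)// /sigma.
by have := sigma_gt0 c1; rewrite /sigma => /lt0r_neq0 s0; field.
Qed.

Let is_derive_sigmaVX n (c : R) : -1 < c <= 0 ->
  is_derive c 1 (fun x => (sigma x)^-1 ^+ n.+1)
    (n.+1%:R * (sigma c)^-1 ^+ n * (c * (sigma c)^-1 ^+ 3)).
Proof.
move=> c1; have Ds := is_derive_sigma c1; have s0 := lt0r_neq0 (sigma_gt0 c1).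
have DV := @is_deriveV _ sigma c _ 1 s0 Ds.
have := @is_deriveX _ _ _ n.+1 _ _ _ DV; rewrite exprfctE => /is_derive_eq; apply.
by rewrite /GRing.scale/=; move: ((sigma c)^-1 ^+ n) => X; field.
Qed.

Let is_derive_Hl (c : R) : -1 < c <= 0 -> is_derive c 1 Hl (hl c).
Proof.
move=> c1; have Ds := is_derive_sigma c1.
have s0 := lt0r_neq0 (sigma_gt0 c1).
have Da : is_derive c (1 : R) (@asin R) (sigma c)^-1 by apply: is_derive1_asin; lra.
have DX := is_derive_sigmaVX k c1.
rewrite /Hl; apply: is_derive_eq; rewrite /hl/GRing.scale/= !exprS.
move: ((sigma c)^-1 ^+ k) => X; move: (asin c) => A; by field.
Qed.

Let continuous_hl (c : R) : -1 < c <= 0 -> {for c, continuous hl}.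
Proof.
move=> c1; have Da : is_derive c (1 : R) (@asin R) (sigma c)^-1.
  by apply: is_derive1_asin; lra.
have D2 := is_derive_sigmaVX k.+1 c1; have D3 := is_derive_sigmaVX k.+2 c1.
apply: is_derive1_continuous; rewrite /hl; apply: is_derive_eq; reflexivity.
Qed.

Let is_derive_H (c : R) : -1 < c < 2 -> is_derive c 1 H (h c).
Proof.
move=> c1; apply: is_derive_glueT => [|c0|c0].
- by rewrite /Hl /Hr asin0 sigma0 invr1 expr1n mulr1.
- by rewrite /h /glue c0; apply: is_derive_Hl; rewrite c0 andbT; lra.
- rewrite (_ : h c = -1); first by rewrite /Hr; apply: is_derive_eq; ring.
  rewrite /h /glue; case: ifP => // c0'.
  have -> : c = 0 by lra.
  by rewrite /hl sigma0 asin0 invr1 !expr1n mulr0 mul0r mulr0 addr0.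
Qed.

Let continuous_h (c : R) : -1 < c < 2 -> {for c, continuous h}.
Proof.
move=> c1; apply: continuous_glue => [|c0|c0].
- by rewrite /hl sigma0 asin0 invr1 !expr1n mulr0 mul0r mulr0 addr0.
- by apply: continuous_hl; rewrite c0 andbT; lra.
- exact: cst_continuous.
Qed.

(** The midpoint of [-1] and [- cos alpha]: it leaves room to the left of [- cos alpha] and stays
    away from the singularity of [Hl] at [-1]. *)
Let a := - (1 + cos alpha) / 2.

Let cos_itv : 0 < cos alpha < 1.
Proof.
have /andP[a0 a1] := alpha_itv; have p0 := @pi_gt0 R.
rewrite cos_gt0_pihalf ?(lt_trans _ a0) ?oppr_lt0 ?divr_gt0//=.
by rewrite -cos0 ltr_cos// in_itv/=; lra.
Qed.

(** Based at the left end, as the fundamental theorem wants it; the integral from [c] to [1] is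
    [F0 1 - F0 c]. *)
Let F0 x := (\int[lebesgue_measure]_(t in `[a, x]) H t)%R.

Let is_derive_F0 (c : R) : a < c < 2 -> is_derive c 1 F0 (H c).
Proof.
have /andP[c0 c1] := cos_itv.
move=> /andP[ac c2].
(* The right end of integration is the midpoint of [c] and [2]. *)
have cu : c < 1 + c / 2 by lra.
have aE : a = - (1 + cos alpha) / 2 by [].
have iH : lebesgue_measure.-integrable `[a, 1 + c / 2] (EFin \o H).
  apply: continuous_compact_integrable; first exact: segment_compact.
  apply: derivable_within_continuous => x; rewrite in_itv/= => /andP[ax x2].
  by have [|//] := @is_derive_H x; lra.
have cH : {for c, continuous H}.
  by apply: is_derive1_continuous; apply: is_derive_H; lra.
have [dF EF] := continuous_FTC1_closed cu iH ac cH.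
by apply: DeriveDef; [exact: dF|rewrite -derive1E; exact: EF].
Qed.

Let s := (sin alpha ^+ k)^-1.

Let sin_itv : 0 < sin alpha < 1.
Proof.
have /andP[a0 a1] := alpha_itv; have p0 := @pi_gt0 R.
rewrite sin_gt0_pihalf//=; have /andP[c0 c1] := cos_itv.
have := cos2Dsin2 alpha; nra.
Qed.

Let s_ge1 : 1 <= s.
Proof.
have /andP[s0 s1] := sin_itv.
by rewrite /s invf_ge1 ?exprn_gt0// exprn_ile1 ?ltW.
Qed.

Let sin_le_sigma (c : R) : - cos alpha <= c <= 0 -> sin alpha <= sigma c.
Proof.
move=> cc; have /andP[s0 s1] := sin_itv; have /andP[c0 c1] := cos_itv.
rewrite -(ger0_norm (ltW s0)) -sqrtr_sqr ler_wsqrtr//.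
by have := cos2Dsin2 alpha; nra.
Qed.

Let asin_itv (c : R) : -1 < c <= 0 -> - (pi / 2) <= asin c <= 0.
Proof.
move=> c1; have p0 := @pi_gt0 R.
have c11 : -1 <= c <= 1 by lra.
rewrite asin_geNpi2//= leNgt; apply/negP => a0.
have : sin 0 < sin (asin c).
  by rewrite ltr_sin// in_itv/= ?asin_lepi2 ?asin_geNpi2//; lra.
by rewrite asinK ?in_itv//= sin0; lra.
Qed.

Let H_ge0 (c : R) : -1 < c <= 1 -> 0 <= H c.
Proof.
move=> c1; rewrite /H /glue; case: ifP => c0; last by rewrite /Hr; lra.
have cc : -1 < c <= 0 by lra.
rewrite /Hl mulr_ge0//; first by have := asin_itv cc; lra.
by rewrite exprn_ge0// invr_ge0 ltW// sigma_gt0.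
Qed.

(** The factor [sigma c] cancels one of the [k + 1] negative powers in [Hl]; the others are bounded
    through [sin alpha <= sigma c]. This controls the slope in the angle, where
    [dc = - sigma dtheta]. *)
Let sigma_H_le (c : R) : - cos alpha <= c <= 1 -> sigma c * H c <= (2 + pi / 2) * s.
Proof.
move=> cc; have /andP[c0 c1] := cos_itv; have p0 := @pi_gt0 R.
rewrite /H /glue; case: ifPn => [cle0|]; last first.
  rewrite -ltNge => cgt0; have : sigma c * Hr c <= 1 * Hr c.
    by rewrite ler_wpM2r// /Hr; lra.
  by move=> /le_trans; apply; rewrite /Hr; have := s_ge1; nra.
have c' : -1 < c <= 0 by lra.
have s0 := sigma_gt0 c'; rewrite /Hl exprS mulrCA (mulrA (sigma c)) mulfV ?gt_eqF// mul1r.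
apply: ler_pM.
- by have := asin_itv c'; lra.
- by rewrite exprn_ge0// invr_ge0 ltW.
- by have := asin_itv c'; lra.
- rewrite /s exprVn lef_pV2 ?posrE ?exprn_gt0//; last by have /andP[] := sin_itv.
  have /andP[sa _] := sin_itv.
  by rewrite lerXn2r ?nnegrE ?(ltW sa) ?(ltW s0)//; apply: sin_le_sigma; lra.
Qed.

(** The part over [[0, 1]] is the integral [3/2] of [2 - t]. On [c < 0] the substitution
    [t = sin phi] turns the integrand into [sigma H], bounded by [sigma_H_le], over a [phi]-interval
    of length at most [pi / 2]; estimating [H] itself would cost one more power of
    [1 / sin alpha]. *)
Let F0_range (c : R) : - cos alpha <= c <= 1 ->
  0 <= F0 1 - F0 c <= 3 / 2 + (2 + pi / 2) * s * (pi / 2).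
Proof.
move=> cc; have /andP[c0 c1] := cos_itv; have p0 := @pi_gt0 R.
have aE : a = - (1 + cos alpha) / 2 by [].
have F0_le (x y : R) : - cos alpha <= x -> x <= y -> y <= 1 -> F0 x <= F0 y.
  move=> ax xy y1; apply: (is_derive_ge0_le xy (df := H)) => t txy.
    by apply: is_derive_F0; lra.
  by apply: H_ge0; lra.
have range_r (x : R) : 0 <= x <= 1 -> F0 1 - F0 x <= 3 / 2.
  move=> /andP[x0 x1].
  have := @is_derive_ge0_le R (fun t => 2 * t - t ^+ 2 / 2 - F0 t) (fun=> 0) x 1 x1.
  rewrite expr1n => L; have {}L := L _ (fun _ _ => lexx _).
  suff : 2 * x - x ^+ 2 / 2 - F0 x <= 2 * 1 - 1 / 2 - F0 1 by nra.
  apply: L => t tx; have D : is_derive t (1 : R) F0 (2 - t).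
    rewrite (_ : 2 - t = H t); first by apply: is_derive_F0; lra.
    rewrite /H /glue; case: ifP => // t0; have -> : t = 0 by lra.
    by rewrite /Hl /Hr sigma0 asin0 invr1 expr1n mulr1.
  by apply: is_derive_eq; rewrite /GRing.scale/=; field.
have K0 : 0 <= (2 + pi / 2) * s * (pi / 2) by have := s_ge1; nra.
rewrite subr_ge0 F0_le//=; try lra.
have [c_ge0|c_lt0] := leP 0 c; first by have := range_r c; lra.
suff : F0 0 - F0 c <= (2 + pi / 2) * s * (pi / 2) by have := range_r 0; lra.
have cin : -1 < c <= 0 by lra.
have /andP[ph0 ph1] := asin_itv cin.
have sinph : sin (asin c) = c by rewrite asinK// in_itv/=; lra.
have sin_in (t : R) : asin c <= t <= 0 -> c <= sin t <= 0.
  move=> /andP[t0 t1].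
  have sin_le (x y : R) : asin c <= x -> x <= y -> y <= 0 -> sin x <= sin y.
    rewrite [x <= y]le_eqVlt => xc /orP[/eqP <-//|xy] y0.
    by rewrite ltW// ltr_sin// in_itv/=; lra.
  have := sin_le _ _ (lexx _) t0 t1; have := sin_le _ _ t0 t1 (lexx _).
  by rewrite sinph sin0 => -> ->.
have D (t : R) : asin c <= t <= 0 ->
   is_derive t (1 : R) (F0 \o sin) (H (sin t) * cos t).
  move=> ht; apply: is_derive1_comp; apply: is_derive_F0.
  by have := sin_in _ ht; lra.
have [t ht] := mean_value ph1 D.
rewrite /= sin0 sinph sub0r => ->; have sint := sin_in _ ht.
have -> : cos t = sigma (sin t).
  by rewrite /sigma -cos2sin2 sqrtr_sqr ger0_norm// cos_ge0_pihalf//; lra.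
rewrite [H _ * _]mulrC; apply: ler_pM.
- by rewrite mulr_ge0 ?sqrtr_ge0 ?H_ge0//; lra.
- lra.
- by apply: sigma_H_le; lra.
- lra.
Qed.

(** The size of the correction in the profile relative to its maximum [C], since
    [lam * s = C * G]. *)
Let G := gamma * (gamma + k%:R) * s.

Let gamma_s_le : gamma * s <= 1 / 30.
Proof.
have p3 := @pi_ge3 R; have g0 := gamma_gt0.
have /andP[s0 _] := sin_itv; have S0 := exprn_gt0 k s0.
have k0 : 0 <= k%:R :> R by rewrite ler0n.
have kE : k.+2%:R = k%:R + 2 :> R by rewrite -addn2 natrD.
have : gamma * (k.+2%:R * (13 * pi ^+ 2 + 4 * pi)) * s <= 8.
  by rewrite /s ler_pdivrMr// ltW.
(* For [k = 0] and [pi = 3] the right-hand side is 258; [240] is taken because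
   [8 / 240 = 1 / 30]. *)
have K : 240 <= k.+2%:R * (13 * pi ^+ 2 + 4 * pi) :> R.
  by rewrite kE; nra.
have gs : 0 <= gamma * s by rewrite mulr_ge0//; have := s_ge1; lra.
rewrite mulrAC; nra.
Qed.

Let G_bound : 0 <= G /\ G * (13 * pi ^+ 2 + 4 * pi) <= 8.
Proof.
have p3 := @pi_ge3 R; have g0 := gamma_gt0.
have /andP[s0 _] := sin_itv; have S0 := exprn_gt0 k s0.
have k0 : 0 <= k%:R :> R by rewrite ler0n.
have kE : k.+2%:R = k%:R + 2 :> R by rewrite -addn2 natrD.
have : gamma * k.+2%:R * (13 * pi ^+ 2 + 4 * pi) * s <= 8.
  by rewrite /s ler_pdivrMr// ltW// -mulrA.
rewrite kE /G; have := s_ge1; set P := 13 * pi ^+ 2 + 4 * pi => s1 B.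
have P0 : 2 <= P by rewrite /P; nra.
have g2 : gamma <= 2 by have := gamma_s_le; nra.
split; first by rewrite !mulr_ge0//; lra.
apply: le_trans B; rewrite -[leLHS]mulrA -[leRHS]mulrA (mulrC P) ler_wpM2r//.
  by rewrite mulr_ge0//; lra.
by rewrite ler_wpM2l//; lra.
Qed.

(** [C] is the value of the profile at [c = 1], its maximum. As the operator applied to the integral
    of [H] gains only a unit, [lam] has to match the zero-order term [gamma (gamma + k) C]. [m]
    subtracts from [C] the largest drop allowed by [F0_range]. *)
Let C := gamma ^- 2.
Let lam := gamma * (gamma + k%:R) * C.
Let m := C - lam * (3 / 2 + (2 + pi / 2) * s * (pi / 2)).

Let lam_ge0 : 0 <= lam.
Proof.
by rewrite /lam !mulr_ge0 ?addr_ge0 ?invr_ge0 ?sqr_ge0 ?ler0n ?(ltW gamma_gt0).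
Qed.

Let C_gt0 : 0 < C.
Proof. by rewrite /C invr_gt0 exprn_gt0. Qed.

Let m_ge : C * (1 - G * (3 / 2 + (2 + pi / 2) * (pi / 2))) <= m.
Proof.
have : lam * (3 / 2) <= lam * (3 / 2 * s) by rewrite ler_wpM2l//; have := s_ge1; lra.
rewrite /m /G => L.
rewrite (_ : C * _ = C - lam * (3 / 2 * s) - lam * ((2 + pi / 2) * s * (pi / 2))).
  lra.
by rewrite /lam; ring.
Qed.

(** After division by [C] it suffices that [G (164/3 + 56 pi/3 + 2 pi^2) <= 8]. For [pi >= 3] the
    bracket is at most [13 pi^2 + 4 pi], with little to spare: [386/3] against [129] at [pi = 3].
    Here the constants in the hypothesis on [gamma] are spent. *)
Let lip_le : lam * ((2 + pi / 2) * s) <= 3 / 8 * m.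
Proof.
have [G0 G8] := G_bound; have p3 := @pi_ge3 R.
have -> : lam * ((2 + pi / 2) * s) = C * (G * (2 + pi / 2)) by rewrite /lam /G; ring.
apply: (@le_trans _ _ (3 / 8 * (C * (1 - G * (3 / 2 + (2 + pi / 2) * (pi / 2)))))).
  by rewrite [leRHS]mulrCA ler_wpM2l ?(ltW C_gt0)//; nra.
by rewrite ler_wpM2l.
Qed.

(** The chain is [alpha^-k <= s <= C / 2 <= m]: by [sin alpha <= alpha], by the smallness of [gamma]
    and [gamma s], and because the profile drops by at most half of its maximum. *)
Let alpha_le_m : alpha ^- k <= m.
Proof.
have g0 := gamma_gt0; have p3 := @pi_ge3 R; have s1 := s_ge1.
have /andP[a0 a1] := alpha_itv; have /andP[sa0 sa1] := sin_itv.
have as_ : alpha ^- k <= s.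
  rewrite /s lef_pV2 ?posrE ?exprn_gt0// lerXn2r ?nnegrE ?(ltW a0) ?(ltW sa0)//.
  exact: sin_le_id (ltW a0).
apply: le_trans as_ _.
have Cs : s <= C / 2.
  have := gamma_s_le; have g1 : gamma <= 1 / 30 by have := gamma_s_le; nra.
  move=> gs; have g2 : 0 < gamma ^+ 2 by rewrite exprn_gt0.
  rewrite -(ler_pM2l g2) mulrA [_ * C]mulfV ?gt_eqF//; nra.
apply: le_trans Cs _; apply: le_trans m_ge.
have [G0 G8] := G_bound; rewrite ler_wpM2l ?(ltW C_gt0)//; nra.
Qed.

Lemma profile_exists : exists a m F F1 F2, profile k alpha gamma a m F F1 F2.
Proof.
pose F c := C - lam * (F0 1 - F0 c).
pose F1 c := lam * H c.
pose F2 c := lam * h c.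
have /andP[c0 c1] := cos_itv; have aE : a = - (1 + cos alpha) / 2 by [].
have p0 := @pi_gt0 R.
have Hl_eq c : -1 < c <= 0 -> (1 - c ^+ 2) * hl c =
    - (sigma c)^-1 ^+ k + k.+1%:R * c * Hl c.
  move=> cc; have s0 := lt0r_neq0 (sigma_gt0 cc).
  rewrite -sqr_sigma; last lra.
  by rewrite /hl /Hl !exprS; move: (_ ^+ k) (asin c) => X A; field.
have V1 c : -1 < c <= 0 -> 1 <= (sigma c)^-1 ^+ k.
  by move=> cc; rewrite exprn_ege1// invf_ge1 ?sigma_gt0.
have H_lip c : - cos alpha <= c <= 1 ->
    (1 - c ^+ 2) * h c - k.+1%:R * c * H c <= -1.
  move=> cc; rewrite /H /h /glue; case: ifPn => [cle0|].
    have cc' : -1 < c <= 0 by lra.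
    by rewrite Hl_eq// addrK lerN2 V1.
  (* For [k = 0] this is [2 c (1 - c) >= 0]. A constant term smaller than [2] in [Hr] would fail at
     [c = 1]. *)
  rewrite -ltNge /Hr /= -natr1 => cgt0.
  have : 0 <= k%:R * (c * (2 - c)) by rewrite !mulr_ge0 ?ler0n//; lra.
  nra.
have H_conc c : - cos alpha <= c <= 1 -> (1 - c ^+ 2) * h c - c * H c <= 0.
  move=> cc; rewrite /H /h /glue; case: ifPn => [cle0|].
    have cc' : -1 < c <= 0 by lra.
    rewrite Hl_eq// -natr1 2!mulrDl !mul1r addrA addrK.
    have Hl0 : 0 <= Hl c by have := @H_ge0 c; rewrite /H /glue cle0; apply; lra.
    have : k%:R * c * Hl c <= 0 by rewrite mulr_le0_ge0// mulr_ge0_le0.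
    by have := V1 _ cc'; lra.
  by rewrite -ltNge /Hr /= => cgt0; nra.
exists a, m, F, F1, F2; split.
- by lra.
- move=> c cc; have D := is_derive_F0 cc.
  by rewrite /F; apply: is_derive_eq; rewrite /F1 /GRing.scale/=; ring.
- move=> c cc; have D : is_derive c (1 : R) H (h c) by apply: is_derive_H; lra.
  by rewrite /F1; apply: is_derive_eq; rewrite /F2 /GRing.scale/=; ring.
- move=> c cc; apply: continuousM; first exact: cst_continuous.
  by apply: continuous_h; lra.
- by move=> c cc; rewrite /F1 mulr_ge0// H_ge0//; lra.
- move=> c cc; rewrite /F1 /F2.
  rewrite (_ : _ - _ = lam * ((1 - c ^+ 2) * h c - c * H c)); last by ring.
  by rewrite mulr_ge0_le0// H_conc.
- move=> c cc; rewrite /F1 /F2.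
  have /andP[R0 R1] := F0_range cc.
  (* The [+ 1] is the zero-order term at the maximum, [gamma (gamma + k) C = lam]; the subtracted
     part comes from the drop of the profile below [C]. *)
  rewrite (_ : _ + _ = lam * ((1 - c ^+ 2) * h c - k.+1%:R * c * H c + 1) -
     gamma * (gamma + k%:R) * (lam * (F0 1 - F0 c))); last by rewrite /F /lam; ring.
  rewrite subr_le0 (@le_trans _ _ 0)//.
    by apply: mulr_ge0_le0 => //; have := H_lip _ cc; lra.
  have g0 := ltW gamma_gt0.
  by rewrite mulr_ge0// mulr_ge0// ?addr_ge0 ?ler0n.
- move=> c cc; have /andP[R0 R1] := F0_range cc.
  by rewrite /F /m lerD2l lerN2 ler_wpM2l//= gerBl mulr_ge0.
- move=> c cc; rewrite /F1 mulrCA; apply: le_trans lip_le.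
  by rewrite ler_wpM2l//; apply: sigma_H_le.
- exact: alpha_le_m.
Qed.
Lemma gamma_small : gamma <= 1 / 30.
Proof. have := gamma_s_le; have := s_ge1; have := gamma_gt0; nra. Qed.

End profile.

(** * The radial-angular function and its derivatives *)

Section euclidean_geometry.
Context {R : realType} {n : nat}.
Implicit Types (u v x y : 'rV[R]_n) (a : R).

Definition dot u v : R := \sum_i u 0 i * v 0 i.

Lemma dotC u v : dot u v = dot v u.
Proof. by apply: eq_bigr => i _; rewrite mulrC. Qed.

Lemma dotDl u v x : dot (u + v) x = dot u x + dot v x.
Proof. by rewrite -big_split; apply: eq_bigr => i _; rewrite mxE mulrDl. Qed.

Lemma dotZl a u v : dot (a *: u) v = a * dot u v.
Proof. by rewrite mulr_sumr; apply: eq_bigr => i _; rewrite mxE mulrA. Qed.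

Lemma dotNl u v : dot (- u) v = - dot u v.
Proof. by rewrite -scaleN1r dotZl mulN1r. Qed.

Lemma dotDr u v x : dot x (u + v) = dot x u + dot x v.
Proof. by rewrite dotC dotDl !(dotC x). Qed.

Lemma dotZr a u v : dot u (a *: v) = a * dot u v.
Proof. by rewrite dotC dotZl dotC. Qed.

Lemma dotNr u v : dot u (- v) = - dot u v.
Proof. by rewrite dotC dotNl dotC. Qed.

Definition dotE := (dotDl, dotDr, dotNl, dotNr, dotZl, dotZr).

Lemma dot_ge0 u : 0 <= dot u u.
Proof. by apply: sumr_ge0 => i _; rewrite -expr2 sqr_ge0. Qed.

Lemma dot_eq0 u : (dot u u == 0) = (u == 0).
Proof.
apply/idP/eqP => [|->]; last by rewrite /dot big1// => i _; rewrite mxE mul0r.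
rewrite psumr_eq0 => [/allP u0|i _]; last by rewrite -expr2 sqr_ge0.
apply/rowP => i; have := u0 i (mem_index_enum i).
by rewrite -expr2 sqrf_eq0 mxE => /eqP.
Qed.

Lemma enormE u : enorm u = Num.sqrt (dot u u).
Proof. by congr Num.sqrt; apply: eq_bigr => i _; rewrite expr2. Qed.

Lemma enorm_ge0 u : 0 <= enorm u.
Proof. exact: sqrtr_ge0. Qed.

Lemma sqr_enorm u : enorm u ^+ 2 = dot u u.
Proof. by rewrite enormE sqr_sqrtr// dot_ge0. Qed.

Lemma enorm_eq0 u : (enorm u == 0) = (u == 0).
Proof. by rewrite -sqrf_eq0 sqr_enorm dot_eq0. Qed.

Lemma enorm_gt0 u : (0 < enorm u) = (u != 0).
Proof. by rewrite lt0r enorm_ge0 andbT enorm_eq0. Qed.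

Lemma enorm0 : enorm (0 : 'rV[R]_n) = 0.
Proof. by apply/eqP; rewrite enorm_eq0. Qed.

Lemma enormZ a u : enorm (a *: u) = `|a| * enorm u.
Proof. by rewrite !enormE dotZl dotZr mulrA -expr2 sqrtrM ?sqr_ge0// sqrtr_sqr. Qed.

Lemma enormN u : enorm (- u) = enorm u.
Proof. by rewrite !enormE dotNl dotNr opprK. Qed.

Lemma cauchy_schwarz u v : dot u v <= enorm u * enorm v.
Proof.
have [->|v0] := eqVneq v 0; first by rewrite enorm0 mulr0 -(scale0r u) dotZr mul0r.
have V0 : 0 < enorm v by rewrite enorm_gt0.
have := dot_ge0 (enorm v ^+ 2 *: u - dot u v *: v).
rewrite !dotE -!sqr_enorm (dotC v u); set p := enorm u; set q := enorm v in V0 *.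
set d := dot u v => H.
have {}H : d ^+ 2 <= (p * q) ^+ 2.
  have q2 : 0 < q ^+ 2 by rewrite exprn_gt0.
  rewrite -subr_ge0 -(pmulr_rge0 _ q2); apply: le_trans H _; rewrite le_eqVlt; apply/orP; left.
  by apply/eqP; ring.
have pq : 0 <= p * q by rewrite mulr_ge0 ?enorm_ge0.
have [d0|/ltW d0] := leP d 0; first exact: le_trans d0 pq.
by rewrite -ler_sqr ?nnegrE.
Qed.

Lemma enormD u v : enorm (u + v) <= enorm u + enorm v.
Proof.
rewrite -ler_sqr ?nnegrE ?addr_ge0 ?enorm_ge0// sqr_enorm !dotE sqrrD !sqr_enorm (dotC v u).
have := cauchy_schwarz u v; lra.
Qed.

Lemma enormB u v : enorm (u - v) = enorm (v - u).
Proof. by rewrite -enormN opprB. Qed.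

Lemma coord_le_enorm u i : `|u 0 i| <= enorm u.
Proof.
rewrite -ler_sqr ?nnegrE ?enorm_ge0// real_normK ?num_real// sqr_enorm expr2.
by rewrite /dot (bigD1 i)//= lerDl sumr_ge0// => j _; rewrite -expr2 sqr_ge0.
Qed.

Lemma dot_delta u i : dot u (delta_mx 0 i) = u 0 i.
Proof.
rewrite /dot (bigD1 i)//= mxE !eqxx mulr1 big1 ?addr0// => j ji.
by rewrite mxE eqxx (negbTE ji) mulr0.
Qed.

End euclidean_geometry.

Section directional_derivatives.
Context {R : realType} {V : normedModType R}.

Lemma is_derive_affine (f : V -> R) (y v : V) (d : R) :
  (forall h, f (h *: v + y) = f y + h * d) -> is_derive y v f d.
Proof.
move=> fE; have cv : (fun h => h^-1 *: ((f \o shift y) (h *: v) - f y)) @ 0^' --> d.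
  apply: (@cvg_trans _ (cst d @ 0^')); last exact: cvg_cst.
  apply: near_eq_cvg.
  near=> h; rewrite /= fE addrAC subrr add0r /GRing.scale/= mulKf//.
  by near: h; exact: nbhs_dnbhs_neq.
by apply: DeriveDef; [apply/cvg_ex; exists d|apply: cvg_lim].
Unshelve. all: by end_near. Qed.

(** Through it every directional derivative becomes a derivative in one variable. *)
Lemma is_derive_line (f : V -> R) (y v : V) (d : R) :
  is_derive y v f d <-> is_derive (0 : R) 1 (fun h : R => f (h *: v + y)) d.
Proof.
have E : 'D_v f y = 'D_1 (fun h : R => f (h *: v + y)) 0.
  rewrite /derive; set g1 := fun h => h^-1 *: _; set g2 := fun h => h^-1 *: _.
  suff -> : g1 = g2 by [].
  apply/funext => h; rewrite /g1 /g2 /=.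
  by rewrite addr0 scale0r add0r [_%:A]mulr1.
have P := derivable1P f y v.
by split=> -[df <-]; (split; [exact/P|rewrite E]).
Qed.

Lemma is_derive_chain (g : V -> R) (f : R -> R) (y v : V) (dg df : R) :
  is_derive (g y) 1 f df -> is_derive y v g dg ->
  is_derive y v (f \o g) (df * dg).
Proof.
move=> Df /is_derive_line Dg; apply/is_derive_line.
apply: (@is_derive1_comp _ f (fun h : R => g (h *: v + y))) => //.
by rewrite scale0r add0r.
Qed.
End directional_derivatives.

Section euclidean_topology.
Context {R : realType} {n : nat}.
Implicit Types (u v x y : 'rV[R]_n).

Lemma is_derive_dot u v x y : is_derive y v (fun z => dot (z - x) u) (dot v u).
Proof. by apply: is_derive_affine => h; rewrite -addrA !dotE addrC. Qed.

Lemma is_derive_dot_sqr v x y :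
  is_derive y v (fun z => dot (z - x) (z - x)) (2 * dot (y - x) v).
Proof.
apply/is_derive_line.
have -> : (fun h : R => dot (h *: v + y - x) (h *: v + y - x)) =
    (fun h : R => dot (y - x) (y - x) + (h * (2 * dot (y - x) v) + h ^+ 2 * dot v v)).
  apply/funext => h; rewrite -addrA; move: (y - x) => w.
  by rewrite !(dotDl, dotDr, dotZl, dotZr) (dotC v w); ring.
by apply: is_derive_eq; rewrite /GRing.scale/=; ring.
Qed.

Lemma is_derive_enorm v x y : y != x ->
  is_derive y v (fun z => enorm (z - x)) (dot (y - x) v / enorm (y - x)).
Proof.
move=> yx; have q0 : 0 < enorm (y - x) by rewrite enorm_gt0 subr_eq0.
have Q0 : 0 < dot (y - x) (y - x) by rewrite -sqr_enorm exprn_gt0.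
have D := is_derive_chain (g := fun z => dot (z - x) (z - x))
  (is_derive1_sqrt Q0) (is_derive_dot_sqr v x y).
have -> : (fun z => enorm (z - x)) = Num.sqrt \o (fun z => dot (z - x) (z - x)).
  by apply/funext => z; rewrite /= enormE.
by apply: is_derive_eq D _; rewrite -enormE; move/lt0r_neq0: q0 => q0; field.
Qed.

Lemma continuous_subcoord x i : continuous (fun y : 'rV[R]_n => (y - x) 0 i).
Proof.
move=> y; apply: (@continuous_comp _ _ _ (fun z : 'rV[R]_n => z - x) (fun z : 'rV[R]_n => z 0 i)).
  by apply: (@continuousB _ _ _ id (cst x)); [exact: cvg_id|exact: cst_continuous].
exact: coord_continuous.
Qed.

Lemma continuous_dot u x : continuous (fun y => dot (y - x) u).
Proof.
apply: (@continuous_big _ _ +%R) => [|i _ y]; first exact: add_continuous.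
apply: continuousM; last exact: cst_continuous.
exact: continuous_subcoord.
Qed.

Lemma continuous_enorm x : continuous (fun y => enorm (y - x)).
Proof.
move=> y; rewrite /enorm; apply: (@continuous_comp _ _ _ _ Num.sqrt); last exact: sqrt_continuous.
apply: (@continuous_big _ _ +%R) => [|i _ z]; first exact: add_continuous.
apply: (@continuous_comp _ _ _ (fun w : 'rV[R]_n => (w - x) 0 i) (fun t : R => t ^+ 2)); last exact: exprn_continuous.
exact: continuous_subcoord.
Qed.

Lemma open_eball x (s : R) : open (eball x s).
Proof.
rewrite (_ : eball x s = (fun y => enorm (y - x)) @^-1` [set t | t < s]).
  by apply: open_comp; [move=> y _; exact: continuous_enorm|exact: open_lt].
by [].
Qed.
End euclidean_topology.

(** * First and second derivatives of [q^gamma F(c)] *)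

Section radial_function.
Context {R : realType} {n : nat}.
Variables (xi e : 'rV[R]_n) (gamma : R) (F F1 F2 : R -> R).
Implicit Types (v y : 'rV[R]_n).
Local Notation q y := (enorm (y - xi)).

Definition cosang y := dot (y - xi) e / q y.

Definition W y := q y `^ gamma * F (cosang y).

Definition W1 y v : R :=
  q y `^ gamma * (q y ^- 2 * (gamma * F (cosang y) - cosang y * F1 (cosang y)) * dot (y - xi) v
  + (q y)^-1 * F1 (cosang y) * dot v e).

(** The Hessian form is kept as a polynomial in [dot (y - xi) v], [dot v v] and [dot v e], so that
    both its trace and its value at the gradient follow from these three numbers. *)
Definition W2 y v : R :=
  q y `^ gamma *
  (q y ^- 4 * ((gamma ^+ 2 - 2 * gamma) * F (cosang y) +
      (3 - 2 * gamma) * cosang y * F1 (cosang y) +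
      cosang y ^+ 2 * F2 (cosang y)) * dot (y - xi) v ^+ 2
  + q y ^- 2 * (gamma * F (cosang y) - cosang y * F1 (cosang y)) * dot v v
  + q y ^- 3 * (2 * (gamma - 1) * F1 (cosang y) - 2 * cosang y * F2 (cosang y)) *
     dot (y - xi) v * dot v e
  + q y ^- 2 * F2 (cosang y) * dot v e ^+ 2).

Lemma is_derive_invq v y : y != xi ->
  is_derive y v (fun z => (q z)^-1) (- (q y ^- 3 * dot (y - xi) v)).
Proof.
move=> yx; have q0 : q y != 0 by rewrite enorm_eq0 subr_eq0.
have D := is_derive_enorm v yx.
have DV := @is_deriveV _ id (q y) 1 1 q0 (is_derive_id _ _).
have := is_derive_chain (g := fun z => q z) DV D => /is_derive_eq; apply.
by rewrite /GRing.scale/=; field.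
Qed.

Lemma is_derive_cosang v y : y != xi -> is_derive y v cosang
  ((q y)^-1 * dot v e - q y ^- 2 * cosang y * dot (y - xi) v).
Proof.
move=> yx; have q0 : q y != 0 by rewrite enorm_eq0 subr_eq0.
have D := is_derive_invq v yx; have Da := is_derive_dot e v xi y.
rewrite /cosang; apply: is_derive_eq; rewrite /GRing.scale/=; by field.
Qed.

Lemma is_derive_qpow v y : y != xi ->
  is_derive y v (fun z => q z `^ gamma) (q y `^ gamma * (gamma * q y ^- 2 * dot (y - xi) v)).
Proof.
move=> yx; have q0 : 0 < q y by rewrite enorm_gt0 subr_eq0.
have D := is_derive_chain (g := fun z => q z) (is_derive1_powR gamma q0) (is_derive_enorm v yx).
apply: is_derive_eq D _.
rewrite powRD; last by apply/implyP => _; rewrite gt_eqF.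
by rewrite powR_inv1 ?ltW//; move/lt0r_neq0: q0 => q0; field.
Qed.

Lemma is_derive_W v y : y != xi -> is_derive (cosang y) 1 F (F1 (cosang y)) ->
  is_derive y v W (W1 y v).
Proof.
move=> yx DF; have q0 : q y != 0 by rewrite enorm_eq0 subr_eq0.
have DFc := is_derive_chain (g := cosang) DF (is_derive_cosang v yx); have DP := is_derive_qpow v yx.
rewrite /W; apply: is_derive_eq; rewrite /W1/GRing.scale/=; by field.
Qed.

Lemma is_derive_W1 v y : y != xi -> is_derive (cosang y) 1 F (F1 (cosang y)) ->
  is_derive (cosang y) 1 F1 (F2 (cosang y)) ->
  is_derive y v (W1 ^~ v) (W2 y v).
Proof.
move=> yx DF DF1; have q0 : q y != 0 by rewrite enorm_eq0 subr_eq0.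
have Dc := is_derive_cosang v yx.
have DFc := is_derive_chain (g := cosang) DF Dc; have DP := is_derive_qpow v yx.
have DF1c := is_derive_chain (g := cosang) DF1 Dc; have Db := is_derive_dot v v xi y.
have Dq := is_derive_invq v yx.
(* The negative square becomes a product of inverses, whose derivative is [Dq]. *)
rewrite /W1 [X in is_derive _ _ X](_ : _ = (fun z => q z `^ gamma *
  ((q z)^-1 * (q z)^-1 * (gamma * F (cosang z) - cosang z * F1 (cosang z)) * dot (z - xi) v
  + (q z)^-1 * F1 (cosang z) * dot v e))); last first.
  by apply/funext => z; rewrite -[(q z)^-1 * (q z)^-1]expr2 exprVn.
apply: is_derive_eq; rewrite /W2/GRing.scale/=; by field.
Qed.

Lemma continuous_cosang y : y != xi -> {for y, continuous cosang}.
Proof.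
move=> yx; have q0 : q y != 0 by rewrite enorm_eq0 subr_eq0.
apply: continuousM; first exact: continuous_dot.
by apply: continuousV => //; exact: continuous_enorm.
Qed.

Lemma continuous_qpow y : y != xi -> {for y, continuous (fun z : 'rV[R]_n => q z `^ gamma)}.
Proof.
move=> yx; have q0 : 0 < q y by rewrite enorm_gt0 subr_eq0.
apply: (@continuous_comp _ _ _ (fun z : 'rV[R]_n => q z) (fun t : R => t `^ gamma)).
  exact: continuous_enorm.
exact: is_derive1_continuous (is_derive1_powR gamma q0).
Qed.

Lemma continuous_W12 v y : y != xi -> is_derive (cosang y) 1 F (F1 (cosang y)) ->
  is_derive (cosang y) 1 F1 (F2 (cosang y)) -> {for (cosang y), continuous F2} ->
  {for y, continuous (W1 ^~ v)} /\ {for y, continuous (W2 ^~ v)}.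
Proof.
move=> yx DF DF1 CF2; have q0 : q y != 0 by rewrite enorm_eq0 subr_eq0.
have cc := continuous_cosang yx; have cP := continuous_qpow yx.
have cq : {for y, continuous (fun z : 'rV[R]_n => q z)} by exact: continuous_enorm.
have cqn k : {for y, continuous (fun z : 'rV[R]_n => q z ^- k)}.
  apply: continuousV; first by rewrite expf_neq0.
  by apply: (@continuous_comp _ _ _ (fun z : 'rV[R]_n => q z) (fun t : R => t ^+ k)) => //; exact: exprn_continuous.
have cq1 : {for y, continuous (fun z : 'rV[R]_n => (q z)^-1)} by apply: continuousV.
have cF : {for y, continuous (F \o cosang)}.
  by apply: continuous_comp => //; exact: is_derive1_continuous DF.
have cF1 : {for y, continuous (F1 \o cosang)}.
  by apply: continuous_comp => //; exact: is_derive1_continuous DF1.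
have cF2 : {for y, continuous (F2 \o cosang)} by exact: continuous_comp.
have ccst (r : R) : {for y, continuous (fun=> r : R)} by exact: cst_continuous.
have cb : {for y, continuous (fun z : 'rV[R]_n => dot (z - xi) v)} by exact: continuous_dot.
split; rewrite /W1 /W2.
  apply: continuousM => //; apply: continuousD.
    apply: continuousM => //; apply: continuousM => //.
    by apply: continuousB; apply: continuousM.
  by do 2!apply: continuousM => //.
apply: continuousM => //; apply: continuousD; [apply: continuousD; [apply: continuousD|]|].
- apply: continuousM; [apply: continuousM => //|exact: continuousM].
  apply: continuousD; [apply: continuousD|].
  + exact: continuousM.
  + by do 2!apply: continuousM => //.
  + by apply: continuousM => //; exact: continuousM.
- do 2!apply: continuousM => //.
  by apply: continuousB; apply: continuousM.
- do 3!apply: continuousM => //.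
  by apply: continuousB; do 2!apply: continuousM => //.
- by do 2!apply: continuousM => //.
Qed.

Lemma cosangE y : y != xi -> dot (y - xi) e = cosang y * q y.
Proof. by move=> yx; rewrite /cosang divfK// enorm_eq0 subr_eq0. Qed.

(** Each quadratic expression in [W2] has a known sum over the standard basis. For [n = k + 2] the
    bracket is that of [profile_laplace]. *)
Lemma sum_W2 y : y != xi -> dot e e = 1 ->
  let c := cosang y in
  \sum_i W2 y (delta_mx 0 i) = q y `^ gamma * q y ^- 2 *
    ((1 - c ^+ 2) * F2 c - (n%:R - 1) * c * F1 c + gamma * (gamma + n%:R - 2) * F c).
Proof.
move=> yx e1 c; have q0 : q y != 0 by rewrite enorm_eq0 subr_eq0.
have S1 : \sum_i dot (y - xi) (delta_mx 0 i) ^+ 2 = q y ^+ 2.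
  by rewrite sqr_enorm; apply: eq_bigr => i _; rewrite dot_delta expr2.
have S2 : \sum_i dot (delta_mx 0 i : 'rV[R]_n) (delta_mx 0 i) = n%:R.
  transitivity (\sum_(i < n) (1 : R)); last by rewrite sumr_const card_ord.
  by apply: eq_bigr => i _; rewrite dot_delta mxE !eqxx.
have S3 : \sum_i dot (y - xi) (delta_mx 0 i) * dot (delta_mx 0 i) e = c * q y.
  by rewrite -cosangE//; apply: eq_bigr => i _; rewrite dot_delta (dotC _ e) dot_delta.
have S4 : \sum_i dot (delta_mx 0 i) e ^+ 2 = 1.
  by rewrite -e1; apply: eq_bigr => i _; rewrite (dotC _ e) dot_delta expr2.
rewrite /W2 -mulr_sumr !big_split/= -!mulr_sumr S1 S2 S4.
under eq_bigr do rewrite -mulrA.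
by rewrite -mulr_sumr S3 -/c; field.
Qed.

(** The gradient lies in the span of [y - xi] and [e], so only [c] remains. The three terms are
    arranged to be nonpositive one by one as soon as [0 < gamma <= 1/2], [F >= 0] and the profile is
    concave in the angle. *)
Lemma W2_grad y v : y != xi -> dot e e = 1 ->
  (forall i, v 0 i = W1 y (delta_mx 0 i)) ->
  let c := cosang y in let D := (1 - c ^+ 2) * F1 c ^+ 2 in
  W2 y v = q y `^ gamma ^+ 3 * q y ^- 4 *
  (gamma ^+ 3 * (gamma - 1) * F c ^+ 3 + gamma * (2 * gamma - 1) * F c * D
   + D * ((1 - c ^+ 2) * F2 c - c * F1 c)).
Proof.
move=> yx e1 vE c D; have q0 : q y != 0 by rewrite enorm_eq0 subr_eq0.
have -> : v = (q y `^ gamma * (q y ^- 2 * (gamma * F c - c * F1 c))) *: (y - xi) +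
    (q y `^ gamma * ((q y)^-1 * F1 c)) *: e.
  apply/rowP => i; rewrite vE /W1 dot_delta (dotC _ e) dot_delta !mxE -/c; ring.
have := cosangE yx; have := sqr_enorm (y - xi); rewrite /W2 -/c /D.
move: (q y) (y - xi) q0 => r w q0 rw cw.
by rewrite !(dotDl, dotDr, dotZl, dotZr) e1 (dotC e) !cw -rw; field.
Qed.

End radial_function.

(** * The midrange inequality *)

Section plane_midrange.
Context {R : realType}.
Implicit Types (gamma psi tau theta : R).

(* The weights lose [3/4 gamma psi tau] at first order, which is absorbed by the
   gains in [1 - cos psi] and [tau ^+ 2] through AM-GM. *)
Lemma weighted_powR_sum_le gamma psi tau : 0 < gamma <= 1 / 5 ->
  0 <= psi <= 2 -> 0 <= tau -> tau < cos psi ->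
  (cos psi + tau) `^ gamma * (1 + 3 / 8 * psi) +
  (cos psi - tau) `^ gamma * (1 - 3 / 8 * psi) <= 2.
Proof.
move=> hg hpsi tau0 tauc; have /andP[p0 p2] := hpsi; have /andP[g0 g5] := hg.
have c1 := cos_le1 psi; have E := one_sub_cos_ge hpsi.
set e := 1 - cos psi; have eE : cos psi = 1 - e by rewrite /e; lra.
rewrite eE in tauc c1 *; rewrite -/e in E.
have A := @powR_le_quadratic R gamma (tau - e) hg ltac:(lra).
have B := @powR_le_quadratic R gamma (- tau - e) hg ltac:(lra).
have -> : 1 - e + tau = 1 + (tau - e) by ring.
have -> : 1 - e - tau = 1 + (- tau - e) by ring.
have A' := ler_wpM2r (ltac:(lra) : 0 <= 1 + 3 / 8 * psi) A.
have B' := ler_wpM2r (ltac:(lra) : 0 <= 1 - 3 / 8 * psi) B.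
apply: (le_trans (lerD A' B')).
have -> : (1 + gamma * (tau - e) - gamma / 5 * (tau - e) ^+ 2) * (1 + 3 / 8 * psi) +
  (1 + gamma * (- tau - e) - gamma / 5 * (- tau - e) ^+ 2) * (1 - 3 / 8 * psi) =
  2 - 2 * gamma * (e + (e ^+ 2 + tau ^+ 2) / 5 - 3 / 8 * psi * tau * (1 + 2 / 5 * e)) by field.
have e0 : 0 <= e by lra.
have pt : 0 <= psi * tau by rewrite mulr_ge0.
have K : psi * tau * e <= psi * tau by rewrite ler_piMr//; lra.
rewrite gerBl !mulr_ge0 ?(ltW g0)//.
(* As [e <= 1], the cross term is at most [21/40 psi tau], and [e >= 25/72 psi^2]. The number
   [189/250] satisfies [25/72 * 2 * 189/250 = 21/40], while [25/72 (189/250)^2 < 1/5]; a slope much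
   above [3/8] would break the second relation. *)
have : 0 <= (psi - 189 / 250 * tau) ^+ 2 by rewrite sqr_ge0.
have : 0 <= e ^+ 2 by rewrite sqr_ge0.
have : 0 <= tau ^+ 2 by rewrite sqr_ge0.
by rewrite (_ : (psi - _) ^+ 2 = psi ^+ 2 + (189 / 250) ^+ 2 * tau ^+ 2 - 189 / 125 * (psi * tau));
  [lra|field].
Qed.

Lemma powR_sum_le gamma psi tau : 0 < gamma <= 1 / 5 ->
  - cos psi < tau < cos psi ->
  (cos psi + tau) `^ gamma + (cos psi - tau) `^ gamma <= 2.
Proof.
move=> /andP[g0 g5] ht; have c1 := cos_le1 psi.
have A := @powR_bernoulli R (cos psi + tau) gamma ltac:(lra) ltac:(lra).
have B := @powR_bernoulli R (cos psi - tau) gamma ltac:(lra) ltac:(lra).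
have : gamma * (1 - cos psi) >= 0 by rewrite mulr_ge0 ?subr_ge0// ltW.
lra.
Qed.

Context (k : nat) (alpha gamma a m : R) (F F1 F2 : R -> R).
Hypothesis prof : profile k alpha gamma a m F F1 F2.
Hypothesis alpha_itv : 0 < alpha < pi / 2.
Hypothesis gamma_itv : 0 < gamma <= 1 / 5.
Hypothesis m_gt0 : 0 < m.
(** The polar angle at which the exterior cone begins. *)
Let beta : R := pi - alpha.

Let cos_beta : cos beta = - cos alpha.
Proof. by rewrite /beta addrC cosDpi cosN. Qed.

Let cos_ge (t : R) : - beta <= t <= beta -> - cos alpha <= cos t <= 1.
Proof.
move=> /andP[t0 t1]; rewrite cos_le1 andbT -cos_beta.
have p0 := @pi_gt0 R; have bE : beta = pi - alpha by [].
have /andP[al0 al1] := alpha_itv.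
have -> : cos t = cos `|t|.
  by have [h|h] := leP 0 t; [rewrite ger0_norm|rewrite ltr0_norm// cosN].
have [->//|tb] := eqVneq `|t| beta.
have tb' : `|t| < beta by rewrite lt_neqAle tb ler_norml; lra.
by rewrite ltW// ltr_cos// in_itv/= ?normr_ge0/=; lra.
Qed.

Let f t := F (cos t).
Let f1 t := - sin t * F1 (cos t).
Let f2 t := sin t ^+ 2 * F2 (cos t) - cos t * F1 (cos t).

Let cos_a (t : R) : - beta <= t <= beta -> a < cos t < 2.
Proof. by move=> /cos_ge; have /andP[_ ?] := profile_a prof; lra. Qed.

Let is_derive_f (t : R) : - beta <= t <= beta -> is_derive t 1 f (f1 t).
Proof.
move=> tb; have D := profile_F prof (cos_a tb).
have := @is_derive1_comp _ F cos t _ _ D (is_derive_cos t).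
by move=> /is_derive_eq; apply; rewrite mulrC.
Qed.

Let is_derive_f1 (t : R) : - beta <= t <= beta -> is_derive t 1 f1 (f2 t).
Proof.
move=> tb; have D := profile_F1 prof (cos_a tb).
have Dc : is_derive t (1 : R) (fun x => F1 (cos x)) (F2 (cos t) * - sin t).
  exact: (@is_derive1_comp _ F1 cos t _ _ D (is_derive_cos t)).
rewrite /f1; apply: is_derive_eq; rewrite /f2 /GRing.scale/=; ring.
Qed.

Lemma profile_midpoint theta psi : 0 <= psi -> - beta <= theta - psi -> theta + psi <= beta ->
  F (cos (theta - psi)) + F (cos (theta + psi)) <= 2 * F (cos theta).
Proof.
move=> p0 t1 t2.
have := @concave_midpoint R f f1 f2 (theta - psi) (theta + psi) ltac:(lra).
have -> : (theta - psi + (theta + psi)) / 2 = theta by field.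
apply=> t ht; [apply: is_derive_f; lra|apply: is_derive_f1; lra|].
have /cos_ge/(profile_concave prof) : - beta <= t <= beta by lra.
by rewrite /f2 sin2cos2.
Qed.

Lemma profile_lipschitz theta psi : 0 <= psi -> - beta <= theta - psi -> theta + psi <= beta ->
  F (cos (theta - psi)) - F (cos (theta + psi)) <= 2 * psi * (3 / 8 * m).
Proof.
move=> p0 t1 t2; have tt : theta - psi <= theta + psi by lra.
have D (x : R) : theta - psi <= x <= theta + psi -> is_derive x 1 f (f1 x).
  by move=> hx; apply: is_derive_f; lra.
have [t ht E] := mean_value tt D.
have E' : F (cos (theta + psi)) - F (cos (theta - psi)) =
  - sin t * F1 (cos t) * (theta + psi - (theta - psi)) by exact: E.
have -> : F (cos (theta - psi)) - F (cos (theta + psi)) = 2 * psi * (sin t * F1 (cos t)).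
  by rewrite -[LHS]opprB E'; ring.
have ht' : - beta <= t <= beta by lra.
rewrite ler_wpM2l ?mulr_ge0//; apply: le_trans (profile_lip prof (cos_ge ht')).
rewrite ler_wpM2r ?(profile_incr prof) ?cos_ge//.
by rewrite -sin2cos2 sqrtr_sqr ler_norm.
Qed.

(** Lengths are divided by [|x - xi|]. With weights [p], [q] and values [A >= B] one has [2 (p A + q
    B) = (p + q) (A + B) + (p - q) (A - B)]. For [tau <= 0] the last product is nonpositive.
    Otherwise [A - B <= 3/8 psi (A + B)], both values being at least [m], and the weights
    [1 + 3/8 psi] and [1 - 3/8 psi] appear. In both cases [A + B <= 2 F (cos theta)] concludes. *)
Lemma plane_midrange_half theta psi tau : 0 <= theta -> 0 <= psi < pi / 2 ->
  - cos psi < tau < cos psi -> theta + psi <= beta ->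
  (cos psi + tau) `^ gamma * F (cos (theta - psi)) +
  (cos psi - tau) `^ gamma * F (cos (theta + psi)) <= 2 * F (cos theta).
Proof.
move=> t0 hp ht tb; have /andP[p0 pp] := hp.
have /andP[al0 al1] := alpha_itv.
have bE : beta = pi - alpha by []; have p_gt0 := @pi_gt0 R; have p2 := @pihalf_lt2 R.
have tb' : - beta <= theta - psi by lra.
have mid := profile_midpoint p0 tb' tb; have lip := profile_lipschitz p0 tb' tb.
have cA : - cos alpha <= cos (theta - psi) <= 1 by apply: cos_ge; lra.
have cB : - cos alpha <= cos (theta + psi) <= 1 by apply: cos_ge; lra.
have /andP[mA _] := profile_bound prof cA; have /andP[mB _] := profile_bound prof cB.
have AB : F (cos (theta + psi)) <= F (cos (theta - psi)).
  have st : 0 <= sin theta by rewrite sin_ge0_pi//; lra.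
  have sp : 0 <= sin psi by rewrite sin_ge0_pi//; lra.
  have cc : cos (theta + psi) <= cos (theta - psi).
    by rewrite cosD cosB; have := mulr_ge0 st sp; lra.
  apply: (is_derive_ge0_le cc (df := F1)) => c hc.
    by apply: (profile_F prof); have /andP[_ ?] := profile_a prof; lra.
  by apply: (profile_incr prof); lra.
have sum2 := powR_sum_le gamma_itv ht.
have w2 := @weighted_powR_sum_le gamma psi tau gamma_itv ltac:(lra).
have /andP[g0 _] := gamma_itv; have m0 := m_gt0.
set A := F (cos (theta - psi)) in mid lip mA AB *.
set B := F (cos (theta + psi)) in mid lip mB AB *.
have A0 := powR_ge0 (cos psi + tau) gamma; have B0 := powR_ge0 (cos psi - tau) gamma.
have mono (x y : R) : 0 <= x -> x <= y -> x `^ gamma <= y `^ gamma.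
  by move=> x0 xy; apply: ge0_ler_powR; rewrite ?nnegrE ?(ltW g0)// (le_trans x0).
have [tau0|tau0] := leP tau 0.
  have := mono (cos psi + tau) (cos psi - tau) ltac:(lra) ltac:(lra).
  move: sum2 A0 B0; set p := _ `^ _; set q := _ `^ _ => sum2 A0 B0 pq.
  have : (q - p) * (A - B) >= 0 by rewrite mulr_ge0 ?subr_ge0.
  have : (2 - (p + q)) * (A + B) >= 0 by rewrite mulr_ge0 ?subr_ge0//; lra.
  lra.
have {}w2 := w2 (ltW tau0) ltac:(lra).
have := mono (cos psi - tau) (cos psi + tau) ltac:(lra) ltac:(lra).
move: w2 A0 B0; set p := (cos psi + _) `^ _; set q := _ `^ _ => w2 A0 B0 pq.
have L : (p - q) * (A - B) <= (p - q) * (3 / 8 * psi * (A + B)).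
  rewrite ler_wpM2l ?subr_ge0//; apply: le_trans lip _.
  have : psi * (A + B - 2 * m) >= 0 by rewrite mulr_ge0//; lra.
  lra.
have : (2 - (p * (1 + 3 / 8 * psi) + q * (1 - 3 / 8 * psi))) * (A + B) >= 0.
  by rewrite mulr_ge0 ?subr_ge0//; lra.
lra.
Qed.

Lemma plane_midrange theta psi tau : 0 <= theta -> - (pi / 2) < psi < pi / 2 ->
  - cos psi < tau < cos psi -> theta + `|psi| <= beta ->
  (cos psi + tau) `^ gamma * F (cos (theta + psi)) +
  (cos psi - tau) `^ gamma * F (cos (theta - psi)) <= 2 * F (cos theta).
Proof.
move=> t0 hp ht; have [p0|p0] := leP 0 psi.
  rewrite ger0_norm// => tb.
  have := @plane_midrange_half theta psi (- tau) t0 ltac:(lra) ltac:(lra) tb.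
  by rewrite opprK addrC.
rewrite ltr0_norm// => tb.
have := @plane_midrange_half theta (- psi) tau t0 ltac:(lra).
by rewrite cosN opprK; apply; lra.
Qed.
End plane_midrange.

(** * Reduction of the midrange inequality to a plane *)

Section space_midrange.
Context {R : realType} {n : nat}.
Variables (k : nat) (alpha gamma a m : R) (F F1 F2 : R -> R) (xi e : 'rV[R]_n).
Hypothesis prof : profile k alpha gamma a m F F1 F2.
Hypothesis alpha_itv : 0 < alpha < pi / 2.
Hypothesis gamma_itv : 0 < gamma <= 1 / 5.
Hypothesis m_gt0 : 0 < m.
Hypothesis e1 : dot e e = 1.
Implicit Types (x y z : 'rV[R]_n).
Local Notation q y := (enorm (y - xi)).

Definition outside_cone y := y != xi /\ - cos alpha < cosang xi e y.

Lemma cosang_itv y : -1 <= cosang xi e y <= 1.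
Proof.
rewrite /cosang; have [->|yx] := eqVneq y xi.
  by rewrite subrr enorm0 invr0 mulr0; lra.
have q0 : 0 < q y by rewrite enorm_gt0 subr_eq0.
have e1' : enorm e = 1 by rewrite enormE e1 sqrtr1.
rewrite ler_pdivlMr// ler_pdivrMr//.
have := cauchy_schwarz (y - xi) e; have := cauchy_schwarz (- (y - xi)) e.
by rewrite dotNl enormN e1'; lra.
Qed.

Let theta y : R := acos (cosang xi e y).

Let cos_theta y : cos (theta y) = cosang xi e y.
Proof. by rewrite acosK// in_itv/= cosang_itv. Qed.

Let theta_itv y : 0 <= theta y <= pi.
Proof. by rewrite acos_ge0 ?acos_lepi ?cosang_itv. Qed.

Let perp y := (y - xi) - (q y * cos (theta y)) *: e.

Let dot_e y : dot (y - xi) e = q y * cos (theta y).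
Proof.
rewrite cos_theta; have [->|yx] := eqVneq y xi.
  by rewrite subrr enorm0 mul0r -(scale0r e) dotZl mul0r.
by rewrite mulrC -cosangE.
Qed.

Let dot_perp x y : dot (perp x) (perp y) =
  dot (x - xi) (y - xi) - q x * q y * (cos (theta x) * cos (theta y)).
Proof.
rewrite /perp; have := dot_e x; have := dot_e y.
move: (x - xi) (y - xi) => u v hv hu.
by rewrite !(dotDl, dotDr, dotZl, dotZr, dotNl, dotNr) e1 (dotC e) hu hv; ring.
Qed.

Let dot_perp_e x : dot (perp x) e = 0.
Proof. by rewrite /perp dotDl dotNl dotZl e1 dot_e mulr1 subrr. Qed.

Let enorm_perp x : enorm (perp x) = q x * sin (theta x).
Proof.
have s0 : 0 <= sin (theta x) by rewrite sin_ge0_pi// theta_itv.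
rewrite enormE dot_perp -sqr_enorm -[RHS]ger0_norm ?mulr_ge0 ?enorm_ge0//.
by rewrite -sqrtr_sqr exprMn sin2cos2; congr Num.sqrt; ring.
Qed.

(** Cauchy-Schwarz orthogonally to [e]: the angle between two vectors is at least the difference of
    their polar angles. *)
Let dot_le x y : dot (x - xi) (y - xi) <= q x * q y * cos (theta y - theta x).
Proof.
have := cauchy_schwarz (perp x) (perp y).
by rewrite dot_perp !enorm_perp cosB; lra.
Qed.

(* A common meridian plane for the mirror image of [y] with respect to [x];
   when both points lie on the axis the plane does not matter. *)
Let meridian x y : x != xi -> y != xi -> exists nu : 'rV[R]_n, [/\ dot nu e = 0,
   x - xi = (q x * cos (theta x)) *: e + (q x * sin (theta x)) *: nu &
   dot nu nu = 1 \/ [/\ nu = 0, sin (theta x) = 0 & sin (theta y) = 0]].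
Proof.
move=> xxi yxi.
have xE : x - xi = (q x * cos (theta x)) *: e + perp x by rewrite /perp [RHS]addrC subrK.
have unit z : perp z != 0 -> dot ((enorm (perp z))^-1 *: perp z) ((enorm (perp z))^-1 *: perp z) = 1.
  move=> z0; have z1 : enorm (perp z) != 0 by rewrite enorm_eq0.
  by rewrite !(dotZl, dotZr) -sqr_enorm; field.
have sin0 z : z != xi -> perp z = 0 -> sin (theta z) = 0.
  move=> zxi pz; have : q z * sin (theta z) = 0 by rewrite -enorm_perp pz enorm0.
  by move=> /eqP; rewrite mulf_eq0 enorm_eq0 subr_eq0 (negbTE zxi) => /eqP.
have [px|px] := eqVneq (perp x) 0; last first.
  exists ((enorm (perp x))^-1 *: perp x); split; last by left; exact: unit.
    by rewrite dotZl dot_perp_e mulr0.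
  by rewrite {1}xE -enorm_perp scalerA mulfV ?scale1r// enorm_eq0.
have px' : q x * sin (theta x) = 0 by rewrite -enorm_perp px enorm0.
have [py|py] := eqVneq (perp y) 0.
  exists 0; split; first by rewrite -(scale0r e) dotZl mul0r.
    by rewrite scaler0 {1}xE px.
  by right; split => //; exact: sin0.
exists ((enorm (perp y))^-1 *: perp y); split; last by left; exact: unit.
  by rewrite dotZl dot_perp_e mulr0.
by rewrite {1}xE px px' scale0r.
Qed.

Lemma midrange_pair x (s : R) y :
  (forall z, enorm (z - x) < s -> outside_cone z) -> enorm (y - x) < s ->
  exists2 z, enorm (z - x) < s &
    W xi e gamma F y + W xi e gamma F z <= 2 * W xi e gamma F x.
Proof.
move=> ball yx; have p0 := @pi_gt0 R; have /andP[al0 al1] := alpha_itv.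
have xx : enorm (x - x) < s by rewrite subrr enorm0 (le_lt_trans _ yx)// enorm_ge0.
have [xxi cx] := ball _ xx; have [yxi cy] := ball _ yx.
have X0 : 0 < q x by rewrite enorm_gt0 subr_eq0.
have rho0 : 0 < q y by rewrite enorm_gt0 subr_eq0.
(* The vertex [xi] does not satisfy [outside_cone], so it is not in the ball. *)
have sX : s <= q x.
  by rewrite leNgt enormB; apply/negP => /ball[]; rewrite eqxx.
have dist2 z : enorm (z - x) ^+ 2 = q z ^+ 2 + q x ^+ 2 - 2 * dot (z - xi) (x - xi).
  rewrite !sqr_enorm; have -> : z - x = (z - xi) - (x - xi) by rewrite opprB addrA subrK.
  move: (z - xi) (x - xi) => u v.
  by rewrite !(dotDl, dotDr, dotNl, dotNr) (dotC v u); ring.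
set psi : R := theta y - theta x.
have dxy := dot_le x y; rewrite -/psi in dxy.
have yE : q y ^+ 2 + q x ^+ 2 - 2 * (q x * q y * cos psi) <= enorm (y - x) ^+ 2.
  by rewrite dist2 (dotC (y - xi)); lra.
have s2 : enorm (y - x) ^+ 2 < s ^+ 2.
  by rewrite ltr_sqr ?nnegrE ?enorm_ge0// (le_trans _ (ltW yx)) ?enorm_ge0.
have s0 : 0 <= s by rewrite (le_trans _ (ltW yx)) ?enorm_ge0.
have sX2 : s ^+ 2 <= q x ^+ 2 by rewrite ler_sqr ?nnegrE// enorm_ge0.
(* From [q y^2 - 2 q x q y cos psi < s^2 - q x^2 <= 0]. It makes the radius of the partner
   positive. *)
have rho_lt : q y < 2 * q x * cos psi.
  by rewrite -(ltr_pM2l rho0); lra.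
have cpsi : 0 < cos psi.
  have : 0 < (2 * q x) * cos psi by lra.
  by rewrite pmulr_rgt0// mulr_gt0.
have psi_pi : - pi <= psi <= pi.
  by have := theta_itv x; have := theta_itv y; rewrite /psi; lra.
have cosE (t : R) : cos t = cos `|t|.
  by have [h|h] := leP 0 t; [rewrite ger0_norm|rewrite ltr0_norm// cosN].
have psi_itv : - (pi / 2) < psi < pi / 2.
  rewrite -ltr_norml ltNge; apply/negP => h.
  suff : cos psi <= 0 by lra.
  rewrite cosE -[`|psi|](subrK (pi / 2)) cosDpihalf oppr_le0 sin_ge0_pi//.
  have : `|psi| <= pi by rewrite ler_norml.
  lra.
have cos_mono (t : R) : `|t| <= `|psi| -> cos psi <= cos t.
  rewrite (cosE t) (cosE psi) le_eqVlt => /orP[/eqP -> //|tp].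
  have : `|psi| <= pi by rewrite ler_norml.
  by move=> pp; rewrite ltW// ltr_cos// in_itv/= normr_ge0//=; lra.
have lt_theta z : - cos alpha < cosang xi e z -> theta z < pi - alpha.
  move=> cz; rewrite ltNge; apply/negP => h.
  have : cos (theta z) <= cos (pi - alpha).
    have := theta_itv z; move: h; rewrite le_eqVlt => /orP[/eqP -> //|h] hz.
    by rewrite ltW// ltr_cos// in_itv/=; lra.
  by rewrite cos_theta addrC cosDpi cosN; lra.
have [nu [nue xE nu1]] := meridian xxi yxi.
(* The point with polar coordinates [(r, theta x + t)] in the meridian plane; negative angles fall
   on the other side of the axis. *)
pose p (r t : R) := xi + ((r * cos (theta x + t)) *: e + (r * sin (theta x + t)) *: nu).
have sin0_eq0 z : z != xi -> - cos alpha < cosang xi e z -> sin (theta z) = 0 -> theta z = 0.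
  move=> zxi cz sz; have /andP[t0 _] := theta_itv z; have := lt_theta _ cz.
  move: t0; rewrite le_eqVlt => /orP[/eqP <-//|t0 tp].
  have := @sin_gt0_pi R (theta z); rewrite sz ltxx => h; suff : false by [].
  by apply: h; lra.
(* When both points are on the axis, they are on its half outside the cone, so both angles are [0]
   and only [t = 0] occurs. *)
have nunu (t : R) : `|t| <= `|psi| -> dot nu nu = 1 \/ nu = 0 /\ theta x = 0 /\ t = 0.
  case: nu1 => [|[nu0 sx sy]] tp; [by left|right]; split=> //.
  have tx := sin0_eq0 _ xxi cx sx; have ty := sin0_eq0 _ yxi cy sy.
  split=> //; apply/eqP; move: tp; rewrite /psi tx ty subrr normr0.
  by rewrite normr_le0.
have hx v : dot v (x - xi) = q x * cos (theta x) * dot v e + q x * sin (theta x) * dot v nu.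
  by rewrite {1}xE dotDr !dotZr.
have p_dots (r t : R) : `|t| <= `|psi| -> [/\ dot (p r t - xi) (p r t - xi) = r ^+ 2,
    dot (p r t - xi) e = r * cos (theta x + t) &
    dot (p r t - xi) (x - xi) = r * q x * cos t].
  move=> tp; rewrite hx /p [xi + _]addrC addrK !(dotDl, dotDr, dotZl, dotZr).
  rewrite (dotC e nu) nue e1 !mulr0 !addr0 !mulr1 !add0r.
  have [-> | [nu0 [-> ->]]] := nunu t tp.
    split => //.
    - have E := cos2Dsin2 (theta x + t).
      transitivity (r ^+ 2 * (cos (theta x + t) ^+ 2 + sin (theta x + t) ^+ 2)).
        by ring.
      by rewrite E mulr1.
    - have -> : cos t = cos ((theta x + t) - theta x) by rewrite addrAC subrr add0r.
      by rewrite [in RHS]cosB; ring.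
  by rewrite !addr0 sin0 cos0; split; ring.
(* Decreasing [|t|] decreases the distance to [x]. The quadratic in [r] is symmetric about
   [q x cos psi], so [q y] and [2 q x cos psi - q y] give it the same value. *)
have p_ball (r t : R) : 0 < r -> `|t| <= `|psi| ->
    r ^+ 2 - 2 * (q x * r * cos psi) <= q y ^+ 2 - 2 * (q x * q y * cos psi) ->
    [/\ enorm (p r t - x) < s, cosang xi e (p r t) = cos (theta x + t) & q (p r t) = r].
  move=> r0 tp hr; have [pp pe px] := p_dots r t tp.
  have qp : q (p r t) = r by rewrite enormE pp sqrtr_sqr gtr0_norm.
  split=> //; last by rewrite /cosang pe qp mulrC mulKf// gt_eqF.
  have := cos_mono _ tp => ct.
  have : (r * q x) * cos psi <= (r * q x) * cos t.
    by rewrite ler_wpM2l// mulr_ge0// ltW.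
  rewrite -ltr_sqr ?nnegrE ?enorm_ge0// dist2 qp px; lra.
(* Otherwise the point of radius [q y] and polar angle [pi - alpha] would be in the ball and on the
   cone. For [psi < 0] this is the bound on the angle of the partner. *)
have thp : theta x + `|psi| <= pi - alpha.
  rewrite leNgt; apply/negP => h; pose t := pi - alpha - theta x.
  have t0 : 0 < t by have := lt_theta _ cx; rewrite /t; lra.
  have tp : `|t| <= `|psi| by rewrite gtr0_norm// /t; lra.
  have [/ball[_ +] E _] := p_ball (q y) t rho0 tp (lexx _).
  by rewrite E /t addrC subrK addrC cosDpi cosN ltxx.
pose tau : R := q y / q x - cos psi.
pose sg : R := 2 * q x * cos psi - q y.
have sg0 : 0 < sg by rewrite /sg; lra.
have tauE : q x * (cos psi + tau) = q y.
  by rewrite /tau; move/lt0r_neq0: X0 => X0; field.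
have tauE' : q x * (cos psi - tau) = sg.
  by rewrite /tau /sg; move/lt0r_neq0: X0 => X0; field.
have [||zx cz qz] := p_ball sg (- psi) sg0.
- by rewrite normrN.
- by rewrite /sg; lra.
exists (p sg (- psi)) => //.
have taup : 0 < cos psi + tau by rewrite -(pmulr_rgt0 _ X0) tauE.
have taun : 0 < cos psi - tau by rewrite -(pmulr_rgt0 _ X0) tauE'.
have /andP[tx0 _] := theta_itv x.
have tau_itv : - cos psi < tau < cos psi by lra.
have := plane_midrange prof alpha_itv gamma_itv m_gt0 tx0 psi_itv tau_itv thp.
rewrite /W cz qz -!cos_theta -tauE -tauE' !powRM ?(ltW X0) ?(ltW taup) ?(ltW taun)//.
have -> : theta x + psi = theta y by rewrite /psi addrC subrK.
have := powR_ge0 (q x) gamma; set P := q x `^ gamma => P0 /(ler_wpM2l P0).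
by rewrite -!mulrA mulrDr (mulrCA 2).
Qed.
End space_midrange.

(** * The mean value inequality *)

Section tame_functions.
Context {R : realType}.
Local Notation leb := (@lebesgue_measure R).

Lemma measurable_open_rV n (A : set 'rV[R]_n) : open A -> measurable A.
Proof. exact: sub_sigma_algebra. Qed.

Lemma measurable_fun_open_rV n (D : set 'rV[R]_n) (g : 'rV[R]_n -> R) :
  open D -> (forall y, D y -> {for y, continuous g}) -> measurable_fun D g.
Proof.
move=> oD cg; apply: (measurability _ (RGenOpens.measurableE R)).
move=> _ [_ [a [b ->]] <-]; apply: measurable_open_rV.
rewrite openE => y [Dy gy] /=; rewrite /interior.
have Dn : nbhs y D by exact: open_nbhs_nbhs.
have gn : nbhs y (g @^-1` `]a, b[).
  by apply: (cg _ Dy); apply: open_nbhs_nbhs; split => //; exact: itv_open.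
by apply: filterS2 Dn gn => z Dz gz; split.
Qed.

Definition box n (b : R) : set 'rV[R]_n := [set y | forall i, `|y 0 i| <= b].

Lemma measurable_box n b : measurable (@box n b : set 'rV[R]_n).
Proof.
rewrite -[box b]setCK; apply: measurableC; apply: measurable_open_rV.
rewrite openE => y /= /existsNP[i /negP]; rewrite -ltNge => yi.
have hc : {for y, continuous (fun z : 'rV[R]_n => `|z 0 i|)}.
  apply: (@continuous_comp _ _ _ (fun z : 'rV[R]_n => z 0 i) (fun t : R => `|t|)).
    exact: coord_continuous.
  exact: norm_continuous.
rewrite /interior; apply: filterS (cvgr_gt _ hc _ yi).
by move=> z bz /= /(_ i); rewrite leNgt bz.
Qed.

Lemma box_consr n b t (v : 'rV[R]_n) : box b (consr (t, v)) <-> `|t| <= b /\ box b v.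
Proof.
split=> [h|[h1 h2] i].
  split; first by have := h ord0; rewrite consr_head.
  by move=> i; have := h (lift ord0 i); rewrite mxE liftK.
by rewrite mxE; case: unliftP => [j _|_] /=; [exact: h2|exact: h1].
Qed.

Lemma lebesgue_box n b : (lebesgue_rV n (@box n b) < +oo)%E.
Proof.
elim: n => [|n IH] /=; first by rewrite diracE; case: (_ \in _); exact: ltry.
rewrite /lebesgue_cons /pushforward.
have -> : @consr R n @^-1` @box n.+1 b = `[- b, b] `*` @box n b.
  by apply/seteqP; split=> [[t v] /box_consr[]|[t v] []] /=; rewrite in_itv/= -ler_norml => h1 h2 //; apply/box_consr.
rewrite product_measure1E//; last exact: measurable_box.
have h : (leb [set` `[(- b)%R, b]%R] < +oo)%E.
  by rewrite lebesgue_measure_itv/=; case: ifP => _; rewrite ?ltry// -EFinB ltry.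
by rewrite lte_mul_pinfty// ge0_fin_numE.
Qed.

(** A class stable under sections on which integrability, hence Fubini, is automatic. *)
Definition tame n (b K : R) (g : 'rV[R]_n -> R) :=
  [/\ measurable_fun setT g, forall y, `|g y| <= K & forall y, ~ box b y -> g y = 0].

Lemma tame_integrable n b K (g : 'rV[R]_n -> R) : tame b K g ->
  (lebesgue_rV n).-integrable setT (EFin \o g).
Proof.
move=> [mg gK g0].
have -> : EFin \o g = (EFin \o g) \_ (box b).
  apply/funext => y; rewrite patchE; case: ifPn => //; rewrite notin_setE => yb /=.
  by rewrite g0.
apply/(integrable_mkcond _ (measurable_box b)).
apply: measurable_bounded_integrable.
- exact: measurable_box.
- exact: lebesgue_box.
- exact: measurable_funTS.
- by exists K; split; [exact: num_real|move=> M KM y _; exact: le_trans (ltW KM)].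
Qed.

Lemma tame_section n b K (g : 'rV[R]_n.+1 -> R) t : tame b K g ->
  tame b K (fun v => g (consr (t, v))).
Proof.
move=> [mg gK g0]; split=> //; last first.
  by move=> v hv; apply: g0 => /box_consr[].
apply: measurableT_comp => //.
exact: (measurableT_comp (@measurable_consr R n) (pair1_measurable t)).
Qed.

Lemma integral_consr n (g : 'rV[R]_n.+1 -> R) b K : tame b K g ->
  (\int[lebesgue_rV n.+1]_y (g y)%:E = \int[leb]_t \int[lebesgue_rV n]_v (g (consr (t, v)))%:E)%E /\
  (\int[lebesgue_rV n.+1]_y (g y)%:E = \int[lebesgue_rV n]_v \int[leb]_t (g (consr (t, v)))%:E)%E.
Proof.
move=> tg; have [mg _ _] := tg; have ig := tame_integrable tg.
have mEg : measurable_fun setT (EFin \o g) by exact/measurable_EFinP.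
have ic : (leb \x lebesgue_rV n)%E.-integrable setT ((EFin \o g) \o @consr R n).
  have mc := @measurable_consr R n.
  have mB : measurable (@consr R n @^-1` @box n.+1 b).
    by rewrite -[X in measurable X]setTI; apply: mc => //; exact: measurable_box.
  have -> : (EFin \o g) \o @consr R n = (EFin \o (g \o @consr R n)) \_ (@consr R n @^-1` @box n.+1 b).
    apply/funext => y; rewrite patchE; case: ifPn => //; rewrite notin_setE => yb /=.
    by have [_ _ ->] := tg.
  apply (@integrable_mkcond _ _ _ (leb \x lebesgue_rV n)%E _ (EFin \o (g \o @consr R n)) mB).
  apply: measurable_bounded_integrable => //.
  - exact: (lebesgue_box n.+1).
  - by apply: measurable_funTS; exact: measurableT_comp.
  - have [_ gK _] := tg.
    by exists K; split; [exact: num_real|move=> M KM y _; exact: le_trans (gK _) (ltW KM)].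
have -> : (\int[lebesgue_rV n.+1]_y (g y)%:E =
    \int[leb \x lebesgue_rV n]_p (g (consr p))%:E)%E.
  have := @integral_pushforward _ _ (measurableTypeR R * 'rV[R]_n)%type 'rV[R]_n.+1 R
    (@consr R n) (@measurable_consr R n)
    (leb \x lebesgue_rV n)%E setT (EFin \o g) mEg.
  by rewrite preimage_setT => /(_ ic measurableT).
by split; [rewrite -(integral12_prod_meas1 ic)|rewrite -(integral21_prod_meas1 ic)].
Qed.

Definition setc n (y : 'rV[R]_n) (i : 'I_n) (t : R) : 'rV[R]_n :=
  \row_j if j == i then t else y 0 j.

(** Fubini with the [i]-th coordinate innermost. As the measure is built by adding a first
    coordinate, [i = 0] uses one order of integration, and any other [i] passes to sections by
    induction. *)
Lemma tame_integral_eq0 n b K (g : 'rV[R]_n -> R) i : tame b K g ->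
  (forall y, \int[leb]_t (g (setc y i t))%:E = 0)%E ->
  (\int[lebesgue_rV n]_y (g y)%:E = 0)%E.
Proof.
elim: n => [|n IH] in g i *; first by case: i => -[].
move=> tg g0; have [E1 E2] := integral_consr tg.
case: (unliftP ord0 i) => [j|] iE.
  rewrite E1; under eq_integral => t _.
    rewrite (IH _ j (tame_section t tg)); last first.
      move=> v; rewrite -(g0 (consr (t, v))); apply: eq_integral => r _.
      congr (g _)%:E; apply/rowP => l; rewrite iE !mxE.
      case: (unliftP ord0 l) => [l'|] ->; last by [].
      by rewrite /= !mxE (inj_eq (@lift_inj _ _)) ?liftK.
    over.
  by rewrite integral0.
rewrite E2; under eq_integral => v _.
  have -> : (\int[leb]_t (g (consr (t, v)))%:E = 0)%E.
    rewrite -(g0 (consr (0, v))); apply: eq_integral => r _.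
    congr (g _)%:E; apply/rowP => l; rewrite iE !mxE.
    case: (unliftP ord0 l) => [l'|] ->; last by rewrite eqxx.
    by rewrite eq_sym (negbTE (neq_lift _ _)).
  over.
by rewrite integral0.
Qed.
End tame_functions.

Section interval_integrals.
Context {R : realType}.
Local Notation leb := (@lebesgue_measure R).

Lemma integral_is_derive (f df : R -> R) (l h : R) : l < h ->
  (forall t, l <= t <= h -> is_derive t 1 f (df t)) ->
  (forall t, l <= t <= h -> {for t, continuous df}) ->
  (\int[leb]_(t in `]l, h[) (df t)%:E = (f h - f l)%:E)%E.
Proof.
move=> lh fdf cdf.
have cf t : l <= t <= h -> {for t, continuous f}.
  by move=> ht; exact: is_derive1_continuous (fdf _ ht).
have cW : {within `[l, h], continuous df}.
  by apply: continuous_in_subspaceT => t; rewrite inE/= in_itv/= => /cdf.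
rewrite -(@integral_itv_bndoo _ l h _ true false).
  rewrite EFinB; apply: continuous_FTC2 => //.
  - split.
    + move=> t; rewrite in_itv/= => ht; have [] // := fdf t; lra.
    + by apply: cvg_at_right_filter; apply: cf; lra.
    + by apply: cvg_at_left_filter; apply: cf; lra.
  - move=> t; rewrite in_itv/= => ht.
    have D : is_derive t (1 : R) f (df t) by apply: fdf; lra.
    by rewrite derive1E derive_val.
apply/measurable_EFinP; apply: (@measurable_funS _ _ _ _ `[l, h]) => //.
  exact: subset_itv_oo_cc.
by apply: subspace_continuous_measurable_fun.
Qed.

Lemma is_derive_line_at {V : normedModType R} (f : V -> R) (y v : V) (t d : R) :
  is_derive (t *: v + y) v f d -> is_derive t 1 (fun h : R => f (h *: v + y)) d.
Proof.
move=> /is_derive_line D; apply/is_derive_line.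
have -> : (fun h : R => f ((h *: (1 : R^o) + t) *: v + y)) = (fun h => f (h *: v + (t *: v + y))).
  by apply/funext => h; rewrite /= [h *: _]mulr1 scalerDl addrA.
exact: D.
Qed.

End interval_integrals.

Section patched.
Context {R : realType} {n : nat}.

Lemma tame_patch (b K : R) (D : set 'rV[R]_n) (g : 'rV[R]_n -> R) : open D ->
  D `<=` box b -> (forall y, D y -> {for y, continuous g}) ->
  (forall y, D y -> `|g y| <= K) -> 0 <= K -> tame b K (g \_ D).
Proof.
move=> oD Db cg gK K0; split.
- apply/(measurable_restrictT g (measurable_open_rV oD)).
  exact: measurable_fun_open_rV.
- move=> y; rewrite patchE; case: ifPn => [/set_mem/gK //|_].
  by rewrite normr0.
- move=> y yb; rewrite patchE; case: ifPn => // /set_mem /Db.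
  by move=> /yb.
Qed.

Lemma eball_box (x : 'rV[R]_n) s : eball x s `<=` box (enorm x + s).
Proof.
move=> y /= ys i; apply: le_trans (coord_le_enorm y i) _.
by rewrite -[y in enorm y](subrK x) (le_trans (enormD _ _))// addrC lerD2l ltW.
Qed.

Lemma norm_le_enorm (y : 'rV[R]_n) : `|y| <= enorm y.
Proof.
change (mx_norm y <= enorm y); have [->|/mx_norm_neq0[[i j] ->]] := eqVneq (mx_norm y) 0.
  exact: enorm_ge0.
by rewrite (ord1 i); exact: coord_le_enorm.
Qed.

Lemma compact_closed_eball (x : 'rV[R]_n) s : compact [set y | enorm (y - x) <= s].
Proof.
apply: bounded_closed_compact.
- exists (enorm x + s); split; first exact: num_real.
  move=> M hM y /= ys; apply: le_trans (ltW hM); apply: le_trans (norm_le_enorm y) _.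
  by rewrite -[y in enorm y](subrK x) (le_trans (enormD _ _))// addrC lerD2l.
- rewrite (_ : [set _ | _] = (fun y => enorm (y - x)) @^-1` [set t | t <= s])//.
  apply: closed_comp; last exact: closed_le.
  by move=> y _; exact: continuous_enorm.
Qed.

Lemma bounded_on_closed_eball (x : 'rV[R]_n) (s : R) (g : 'rV[R]_n -> R) : 0 <= s ->
  (forall y, enorm (y - x) <= s -> {for y, continuous g}) ->
  exists2 K, 0 <= K & forall y, enorm (y - x) <= s -> `|g y| <= K.
Proof.
move=> s0 cg; have A0 : [set y | enorm (y - x) <= s] !=set0.
  by exists x; rewrite /= subrr enorm0.
have cA : {within [set y | enorm (y - x) <= s], continuous (fun y => `|g y|)}.
  apply: continuous_in_subspaceT => y; rewrite inE/= => ys.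
  by apply: (@continuous_comp _ _ _ g (fun t : R => `|t|)); [exact: cg|exact: norm_continuous].
have [c _ cmax] := EVT_max_rV A0 (@compact_closed_eball x s) cA.
exists `|g c| => // y ys; apply: cmax; exact/mem_set.
Qed.
End patched.

Lemma continuous_sum_at {R : realType} {T : topologicalType} n (f : 'I_n -> T -> R) (z : T) :
  (forall i, {for z, continuous (f i)}) ->
  {for z, continuous (fun y => \sum_i f i y)}.
Proof.
move=> cf; elim: (index_enum _) => [|i r IH].
  rewrite (_ : (fun y => _) = cst 0); first exact: cst_continuous.
  by apply/funext => y; rewrite big_nil.
rewrite (_ : (fun y => _) = f i \+ (fun y => \sum_(j <- r) f j y)).
  exact: (continuousD (cf i) IH).
by apply/funext => y; rewrite big_cons.
Qed.

Lemma integral_le0 d (T : measurableType d) (R : realType) (mu : {measure set T -> \bar R})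
  (f : T -> \bar R) : (forall t, f t <= 0)%E -> (\int[mu]_t f t <= 0)%E.
Proof.
move=> f0; rewrite integralE integral0_eq => [|t _].
  by rewrite sub0e oppe_le0 integral_ge0.
by rewrite funeposE; apply/max_idPr.
Qed.

(** * The mean of a superharmonic function over a ball *)

Section ball_mean.
Context {R : realType} {n : nat}.
Local Notation leb := (@lebesgue_measure R).
Local Notation mu := (@lebesgue_rV R n).
Local Notation ei i := (delta_mx 0 i : 'rV[R]_n).
Variables (x : 'rV[R]_n) (s : R) (u : 'rV[R]_n -> R)
  (d1 : 'rV[R]_n -> 'rV[R]_n -> R) (d2 : 'rV[R]_n -> 'I_n -> R).
Hypothesis s_gt0 : 0 < s.
Implicit Types (t r : R) (y v : 'rV[R]_n) (i : 'I_n).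
Local Notation B := (eball x s).
Hypothesis d1P : forall y v, B y -> is_derive y v u (d1 y v).
Hypothesis d1_lin : forall y v, d1 y v = \sum_i v 0 i * d1 y (ei i).
Hypothesis d2P : forall y i, B y -> is_derive y (ei i) (d1 ^~ (ei i)) (d2 y i).
Hypothesis d1_cont : forall y i, B y -> {for y, continuous (d1 ^~ (ei i))}.
Hypothesis d2_cont : forall y i, B y -> {for y, continuous (d2 ^~ i)}.
Hypothesis d2_le0 : forall y, B y -> \sum_i d2 y i <= 0.

Let seg (t : R) (y : 'rV[R]_n) : 'rV[R]_n := x + t *: (y - x).

Let enorm_seg t y : 0 <= t -> enorm (seg t y - x) = t * enorm (y - x).
Proof. by move=> t0; rewrite /seg addrAC subrr add0r enormZ ger0_norm. Qed.

Let seg_B t y : 0 <= t < 1 -> enorm (y - x) <= s -> B (seg t y).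
Proof.
move=> /andP[t0 t1] ys; rewrite /eball/= enorm_seg//.
have s0 := s_gt0; have := ler_wpM2l t0 ys; nra.
Qed.

Let continuous_seg t : continuous (seg t).
Proof.
move=> y; have h : {for y, continuous (fun y : 'rV[R]_n => y - x)}.
  by apply: (@continuousB _ _ _ id (cst x)); [exact: cvg_id|exact: cst_continuous].
have h2 : {for y, continuous (fun y : 'rV[R]_n => t *: (y - x))}.
  apply: (@continuous_comp _ _ _ (fun y : 'rV[R]_n => y - x) (fun z => t *: z)).
    exact: h.
  exact: scaler_continuous.
have hx : {for y, continuous (fun y : 'rV[R]_n => x)} by exact: cst_continuous.
exact: (continuousD hx h2).
Qed.

(** The derivative in [y_i] of [(|y - x|^2 - s^2) / 2 * d1 (seg t y) (ei i)]. *)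
Let phi t i (y : 'rV[R]_n) : R :=
  (y - x) 0 i * d1 (seg t y) (ei i) +
  (enorm (y - x) ^+ 2 - s ^+ 2) / 2 * (t * d2 (seg t y) i).

(** Nothing is assumed of the derivatives near the sphere; for [t < 1] the image of the ball under
    [seg t] stays in a compact part of it. *)
Let bounds t : 0 <= t < 1 -> exists2 K : R, 0 <= K &
  forall z i, enorm (z - x) <= t * s -> `|d1 z (ei i)| <= K /\ `|d2 z i| <= K.
Proof.
move=> t01; have /andP[t0 t1] := t01; have s0 := s_gt0.
have bnd (g : 'I_n -> 'rV[R]_n -> R) : (forall i y, B y -> {for y, continuous (g i)}) ->
    exists2 K : R, 0 <= K & forall y i, enorm (y - x) <= t * s -> `|g i y| <= K.
  move=> cg; have /choice[K hK] (i : 'I_n) : exists K : R, 0 <= K /\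
      forall y, enorm (y - x) <= t * s -> `|g i y| <= K.
    have [||K K0 hK] := @bounded_on_closed_eball R n x (t * s) (g i).
    - by rewrite mulr_ge0// ltW.
    - by move=> y ys; apply: cg; rewrite /eball/=; nra.
    - by exists K.
  exists (\sum_i K i) => [|y i ys]; first by apply: sumr_ge0 => i _; have [] := hK i.
  have [_ h] := hK i; apply: le_trans (h y ys) _.
  by rewrite (bigD1 i)//= lerDl sumr_ge0// => j _; have [] := hK j.
have [|K1 K10 h1] := bnd (fun i y => d1 y (ei i)); first by move=> i y; exact: d1_cont.
have [|K2 K20 h2] := bnd (fun i y => d2 y i); first by move=> i y; exact: d2_cont.
exists (K1 + K2) => [|y i ys]; first by rewrite addr_ge0.
by split; [rewrite (le_trans (h1 _ _ ys))// lerDl|rewrite (le_trans (h2 _ _ ys))// lerDr].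
Qed.

Let continuous_phi t i y : 0 <= t < 1 -> enorm (y - x) <= s -> {for y, continuous (phi t i)}.
Proof.
move=> t01 By; have cs := @continuous_seg t y.
have Bs : B (seg t y) by exact: seg_B.
apply: continuousD; apply: continuousM.
- exact: continuous_subcoord.
- by apply: (@continuous_comp _ _ _ (seg t) (d1 ^~ (ei i))) => //; exact: d1_cont.
- apply: continuousM; last exact: cst_continuous.
  apply: continuousB; last exact: cst_continuous.
  apply: (@continuous_comp _ _ _ (fun y : 'rV[R]_n => enorm (y - x)) (fun r : R => r ^+ 2)).
    exact: continuous_enorm.
  exact: exprn_continuous.
- apply: continuousM; first exact: cst_continuous.
  by apply: (@continuous_comp _ _ _ (seg t) (d2 ^~ i)) => //; exact: d2_cont.
Qed.

Let tame_phi t i : 0 <= t < 1 -> exists b K : R, tame b K (phi t i \_ B).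
Proof.
move=> t01; have [K K0 hK] := bounds t01; exists (enorm x + s), (s * K + s ^+ 2 * K).
apply: tame_patch.
- exact: open_eball.
- exact: eball_box.
- by move=> y By; apply: continuous_phi => //; exact: ltW.
- move=> y By; have s0 := s_gt0; have /andP[t0 t1] := t01.
  have [h1 h2] := hK (seg t y) i ltac:(by rewrite enorm_seg// ler_wpM2l// ltW).
  have ys : `|(y - x) 0 i| <= s by apply: le_trans (coord_le_enorm _ _) (ltW By).
  apply: le_trans (ler_normD _ _) _; apply: lerD.
    by rewrite normrM ler_pM.
  rewrite normrM ler_pM//.
    have : enorm (y - x) ^+ 2 <= s ^+ 2.
      by rewrite ler_sqr ?nnegrE ?enorm_ge0 ?(ltW s0)//; exact: ltW.
    by have := sqr_ge0 (enorm (y - x)); rewrite ler_norml; lra.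
  by rewrite normrM (ger0_norm t0); have := ler_pM t0 (normr_ge0 _) (ltW t1) h2; rewrite mul1r.
- by have s0 := s_gt0; rewrite addr_ge0 ?mulr_ge0 ?sqr_ge0// ltW.
Qed.

Let setcE (y : 'rV[R]_n) i r : setc y i r = (r - y 0 i) *: ei i + y.
Proof.
apply/rowP => j; rewrite !mxE eqxx/=; have [->|_] := eqVneq j i.
  by rewrite mulr1 subrK.
by rewrite mulr0 add0r.
Qed.

Let dist_setc (y : 'rV[R]_n) i r : enorm (setc y i r - x) ^+ 2 =
  (r - x 0 i) ^+ 2 + (enorm (y - x) ^+ 2 - (y - x) 0 i ^+ 2).
Proof.
rewrite setcE -addrA !sqr_enorm.
have -> : r - x 0 i = (r - y 0 i) + (y - x) 0 i by rewrite !mxE addrA subrK.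
move: (y - x) => w; rewrite !(dotDl, dotDr, dotZl, dotZr) (dotC (ei i) w) !dot_delta.
by rewrite !mxE !eqxx /=; ring.
Qed.

(** The line either misses the ball or meets it in a chord []l, h[], at whose ends, on the sphere,
    the primitive [Phi] vanishes. *)
Let phi_line t i y : 0 <= t < 1 ->
  (\int[leb]_r ((phi t i \_ B) (setc y i r))%:E = 0)%E.
Proof.
move=> t01; set d := enorm (y - x) ^+ 2 - (y - x) 0 i ^+ 2.
have s0 := s_gt0; have d0 : 0 <= d.
  rewrite subr_ge0 -[X in X <= _]real_normK ?num_real// ler_sqr ?nnegrE ?enorm_ge0//.
  exact: coord_le_enorm.
have BP r : B (setc y i r) <-> (r - x 0 i) ^+ 2 + d < s ^+ 2.
  by rewrite -dist_setc ltr_sqr// ?nnegrE ?enorm_ge0// ltW.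
have [ds|sd] := leP (s ^+ 2) d.
  apply: integral0_eq => r _; rewrite patchE; case: ifPn => // /set_mem /BP.
  by move=> /(le_lt_trans _) -/(_ d); rewrite lerDr sqr_ge0 ltNge ds => /(_ isT).
pose L := Num.sqrt (s ^+ 2 - d).
have L0 : 0 < L by rewrite sqrtr_gt0 subr_gt0.
have L2 : L ^+ 2 = s ^+ 2 - d by rewrite sqr_sqrtr// ltW// subr_gt0.
pose l := x 0 i - L; pose h := x 0 i + L.
have lh : l < h by rewrite /l /h; lra.
have lhP r : l < r < h <-> B (setc y i r).
  rewrite BP; split=> [hr|hr].
    have : (r - x 0 i) ^+ 2 < L ^+ 2 by rewrite /l /h in hr; nra.
    lra.
  have : `|r - x 0 i| < L by rewrite -ltr_sqr ?nnegrE ?(ltW L0)// real_normK ?num_real//; lra.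
  by rewrite ltr_norml /l /h; lra.
have lhC r : l <= r <= h -> enorm (setc y i r - x) <= s.
  move=> hr; rewrite -ler_sqr ?nnegrE ?enorm_ge0 ?(ltW s0)// dist_setc -/d.
  by rewrite /l /h in hr; nra.
pose y0 := seg t y.
have segE r : seg t (setc y i r) = (t * (r - y 0 i)) *: ei i + y0.
  by rewrite setcE /y0 /seg -[_ + y - x]addrA scalerDr scalerA addrCA.
pose Phi r := ((r - x 0 i) ^+ 2 + d - s ^+ 2) / 2 * d1 (seg t (setc y i r)) (ei i).
have DPhi r : l <= r <= h -> is_derive r (1 : R) Phi (phi t i (setc y i r)).
  move=> hr; have Bz := seg_B t01 (lhC r hr).
  have D : is_derive _ (ei i) _ _ := @d2P _ i Bz; rewrite segE in D.
  have Da : is_derive r (1 : R) (fun r => t * (r - y 0 i)) t.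
    by apply: is_derive_eq; rewrite /GRing.scale/=; ring.
  have D1 := @is_derive1_comp _ _ (fun r => t * (r - y 0 i)) _ _ _ (is_derive_line_at D) Da.
  have D2 : is_derive r (1 : R) (fun r => d1 (seg t (setc y i r)) (ei i))
     (d2 (seg t (setc y i r)) i * t).
    rewrite segE; apply: is_derive_eq; last reflexivity.
    rewrite (_ : (fun r => d1 _ _) = (fun r => d1 ((t * (r - y 0 i)) *: ei i + y0) (ei i)))//.
    by apply/funext => r'; rewrite segE.
  rewrite /Phi; apply: is_derive_eq; rewrite /phi dist_setc -/d /GRing.scale/=.
  rewrite !mxE eqxx; by field.
have Cphi : forall p : R, l <= p <= h -> {for p, continuous (fun t' => phi t i (setc y i t'))}.
  move=> r hr; have Bz := seg_B t01 (lhC r hr).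
  have cset : {for r, continuous (fun t' => setc y i t')}.
    rewrite (_ : (fun r => _) = (fun r => (r - y 0 i) *: ei i + y)); last first.
      by apply/funext => r'; rewrite setcE.
    have h1 : {for r, continuous (fun t' : R => (t' - y 0 i) *: ei i)}.
      apply: (@continuous_comp _ _ _ (fun r : R => r - y 0 i) (fun r : R => r *: ei i)).
        by apply: (@continuousB _ _ _ id (cst (y 0 i))); [exact: cvg_id|exact: cst_continuous].
      exact: scalel_continuous.
    have h2 : {for r, continuous (fun t' : R => y)} by exact: cst_continuous.
    exact: (continuousD h1 h2).
  apply: (@continuous_comp _ _ _ (fun r => setc y i r) (phi t i)) => //.
  by apply: continuous_phi => //; exact: lhC.
transitivity (\int[leb]_(r in `]l, h[) (phi t i (setc y i r))%:E)%E.
  rewrite [RHS]integral_mkcond; apply: eq_integral => r _.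
  rewrite !patchE; case: ifPn => [/set_mem Br|/negP nB].
    by rewrite ifT// inE/= in_itv/=; apply/lhP.
  rewrite ifF//; apply/negbTE/negP => /set_mem; rewrite /= in_itv/= => /lhP hr.
  by apply: nB; apply/mem_set.
rewrite (integral_is_derive lh DPhi Cphi) /Phi.
have hL : h - x 0 i = L by rewrite /h addrAC subrr add0r.
have lL : l - x 0 i = - L by rewrite /l addrAC subrr add0r.
have L0' : L ^+ 2 + d - s ^+ 2 = 0 by rewrite L2; ring.
by rewrite hL lL sqrrN L0' !mul0r subrr.
Qed.

(** The derivative of [u (seg t y)] in [t]. *)
Let dd t y : R := \sum_i (y - x) 0 i * d1 (seg t y) (ei i).

Let tailr_continuous : continuous (@tailr R n).
Proof.
move=> v A /nbhs_ballP[e /= e0 eA]; apply/nbhs_ballP; exists e => //= w.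
by move=> [_ vw]; apply: eA; split=> // i j; rewrite !mxE; exact: vw.
Qed.

Let dd_bound t1 : 0 <= t1 < 1 -> exists2 K : R, 0 <= K &
  forall t y, 0 <= t <= t1 -> enorm (y - x) <= s -> `|dd t y| <= K.
Proof.
move=> t01; have [K K0 hK] := bounds t01; have s0 := s_gt0.
exists (\sum_(i < n) s * K) => [|t y /andP[t0 tt1] ys].
  by apply: sumr_ge0 => i _; rewrite mulr_ge0// ltW.
apply: le_trans (ler_norm_sum _ _ _) _; apply: ler_sum => i _.
rewrite normrM ler_pM// ?(le_trans (coord_le_enorm _ _))//.
apply: (hK _ i _).1; rewrite enorm_seg//.
by rewrite ler_pM ?enorm_ge0.
Qed.

Let continuous_d1seg i (z : 'rV[R]_n.+1) : 0 <= z 0 ord0 < 1 -> B (tailr z) ->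
  {for z, continuous (fun z : 'rV[R]_n.+1 => d1 (seg (z 0 ord0) (tailr z)) (ei i))}.
Proof.
move=> z01 Bz.
have h1 : {for z, continuous (fun z : 'rV[R]_n.+1 => tailr z - x)}.
  apply: (@continuous_comp _ _ _ (@tailr R n) (fun y : 'rV[R]_n => y - x)).
    exact: tailr_continuous.
  by apply: (@continuousB _ _ _ id (cst x)); [exact: cvg_id|exact: cst_continuous].
have h0 : {for z, continuous (fun z : 'rV[R]_n.+1 => z 0 ord0)} by exact: coord_continuous.
have h2 : {for z, continuous (fun z : 'rV[R]_n.+1 => z 0 ord0 *: (tailr z - x))}.
  exact: (continuousZ h0 h1).
have hx : {for z, continuous (fun z : 'rV[R]_n.+1 => x)} by exact: cst_continuous.
apply: (@continuous_comp _ _ _ (fun z : 'rV[R]_n.+1 => seg (z 0 ord0) (tailr z)) (d1 ^~ (ei i))).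
  exact: (continuousD hx h2).
by apply: d1_cont; apply: seg_B => //; exact: ltW.
Qed.

(** The parameter [t] is stored as the first coordinate of a longer vector, so that [integral_consr]
    also exchanges the integrals in [t] and [y]. *)
Let D t1 : set 'rV[R]_n.+1 := [set z : 'rV[R]_n.+1 | 0 < z 0 ord0 < t1 /\ B (tailr z)].
Let T (z : 'rV[R]_n.+1) := dd (z 0 ord0) (tailr z).

Let tame_T t1 : 0 <= t1 < 1 -> exists b K : R, tame b K (T \_ (D t1)).
Proof.
move=> t01; have /andP[t0 tlt1] := t01; have [K K0 hK] := dd_bound t01.
have s0 := s_gt0; exists (1 + (enorm x + s)), K; apply: tame_patch => //.
- rewrite (_ : D t1 = ((fun z : 'rV[R]_n.+1 => z 0 ord0) @^-1` `]0, t1[) `&` (@tailr R n @^-1` B)).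
    apply: openI; apply: open_comp.
    + by move=> z _; exact: coord_continuous.
    + exact: itv_open.
    + by move=> z _; exact: tailr_continuous.
    + exact: open_eball.
  by apply/seteqP; split=> z; rewrite /= in_itv.
- move=> z [zt Bz]; have -> : z = consr (z 0 ord0, tailr z).
    apply/rowP => j; rewrite mxE; case: unliftP => [j'|] -> //.
    by rewrite /= mxE.
  apply/box_consr; split.
    by have := enorm_ge0 x; rewrite gtr0_norm; lra.
  by move=> i; have := eball_box Bz i; lra.
- move=> z [zt Bz]; rewrite /T /dd.
  apply: continuous_sum_at => i; apply: continuousM; last by apply: continuous_d1seg => //; lra.
  apply: (@continuous_comp _ _ _ (@tailr R n) (fun y : 'rV[R]_n => (y - x) 0 i)).
    exact: tailr_continuous.
  exact: continuous_subcoord.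
- by move=> z [zt Bz]; apply: hK; [lra|exact: ltW].
Qed.

Let tame_dd t : 0 <= t < 1 -> exists b K : R, tame b K (dd t \_ B).
Proof.
move=> t01; have /andP[t0 t1] := t01; have [K K0 hK] := dd_bound t01.
exists (enorm x + s), K; apply: tame_patch => //.
- exact: open_eball.
- exact: eball_box.
- move=> y By; apply: continuous_sum_at => i; apply: continuousM.
    exact: continuous_subcoord.
  apply: (@continuous_comp _ _ _ (seg t) (d1 ^~ (ei i))); first exact: continuous_seg.
  by apply: d1_cont; apply: seg_B => //; exact: ltW.
- by move=> y By; apply: hK; [rewrite t0 lexx|exact: ltW].
Qed.

(** The sum of the [phi t i] exceeds [dd t] by a product of two nonpositive factors, the weight
    [(|y - x|^2 - s^2) / 2] and [t] times the Laplacian at [seg t y]; and each [phi t i] has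
    integral zero. *)
Let integral_dd_le0 t : 0 <= t < 1 -> (\int[mu]_y ((dd t \_ B) y)%:E <= 0)%E.
Proof.
move=> t01; have /andP[t0 t1] := t01; have [b [K tdd]] := tame_dd t01.
have iphi i : mu.-integrable setT (EFin \o (phi t i \_ B)).
  by have [b' [K' tphi]] := tame_phi i t01; exact: tame_integrable tphi.
have phi0 i : (\int[mu]_y ((phi t i \_ B) y)%:E = 0)%E.
  have [b' [K' tphi]] := tame_phi i t01.
  by apply: (tame_integral_eq0 (i := i) tphi) => y; exact: phi_line.
have -> : (0 = \int[mu]_y (\sum_i ((phi t i \_ B) y)%:E) :> \bar R)%E.
  by rewrite integral_sum// big1// => i _; exact: phi0.
apply: le_integral => //.
- exact: tame_integrable tdd.
- by apply: integrable_sum => // i _; exact: iphi.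
- move=> y _; rewrite sumEFin lee_fin patchE; case: ifPn => By; last first.
    by rewrite big1// => i _; rewrite patchE (negbTE By).
  have By' := set_mem By.
  under eq_bigr do rewrite patchE By.
  rewrite /phi big_split/= lerDl -mulr_sumr -mulr_sumr.
  have s0 := s_gt0; apply: mulr_le0.
    rewrite pmulr_lle0// subr_le0 ler_sqr ?nnegrE ?enorm_ge0 ?(ltW s0)//.
    exact: ltW.
  by apply: mulr_ge0_le0 => //; apply: d2_le0; apply: seg_B => //; exact: ltW.
Qed.

Lemma integral_segment_le0 t1 : 0 < t1 < 1 ->
  (\int[mu]_(y in B) (u (seg t1 y) - u x)%:E <= 0)%E.
Proof.
move=> t01; have [b [K tT]] := tame_T (ltac:(lra) : 0 <= t1 < 1).
have [E1 E2] := integral_consr tT.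
have Tc (t : R) y : (T \_ (D t1)) (consr (t, y)) = if 0 < t < t1 then (dd t \_ B) y else 0.
  rewrite !patchE /T consr_head consrK; case: ifPn => [/set_mem[]|/negP nD].
    by rewrite consr_head consrK /= => -> By; rewrite ifT//; exact/mem_set.
  case: ifP => // tt; case: ifPn => // /set_mem By; exfalso; apply: nD; apply/mem_set.
  by rewrite /D /= consr_head consrK.
have -> : (\int[mu]_(y in B) (u (seg t1 y) - u x)%:E =
    \int[mu]_y \int[leb]_t ((T \_ (D t1)) (consr (t, y)))%:E)%E.
  rewrite [LHS]integral_mkcond; apply: eq_integral => y _.
  transitivity (\int[leb]_(t in `]0%R, t1[) ((dd t \_ B) y)%:E)%E; last first.
    rewrite [LHS]integral_mkcond; apply: eq_integral => t _.
    by rewrite patchE Tc mem_setE /= in_itv /=; case: ifP.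
  rewrite patchE; case: ifPn => By; last first.
    by rewrite integral0_eq// => t _; rewrite patchE (negbTE By).
  have By' := set_mem By.
  transitivity (\int[leb]_(t in `]0%R, t1[) (dd t y)%:E)%E; last first.
    by apply: eq_integral => t _; rewrite patchE By.
  suff -> : (\int[leb]_(t in `]0%R, t1[) (dd t y)%:E = (u (seg t1 y) - u (seg 0 y))%:E)%E.
    by rewrite [seg 0 y]/seg scale0r addr0.
  apply: (@integral_is_derive _ (fun t => u (seg t y)) (dd ^~ y)).
  - by lra.
  - move=> t ht; have Bs : B (seg t y) by apply: seg_B; [lra|exact: ltW].
    have Du := d1P (y - x) Bs; rewrite {1}/seg addrC in Du.
    have := is_derive_line_at Du; rewrite d1_lin -/(dd t y).
    by rewrite (_ : (fun t => u (seg t y)) = (fun h => u (h *: (y - x) + x)))//; apply/funext => h; rewrite /seg addrC.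
  - move=> t ht.
    have By1 : enorm (y - x) <= s by exact: ltW.
    apply: continuous_sum_at => i; apply: continuousM; first exact: cst_continuous.
    have hs : {for t, continuous (fun t' : R => seg t' y)}.
      have h1 : {for t, continuous (fun t' : R => t' *: (y - x))} by exact: scalel_continuous.
      have hx : {for t, continuous (fun t' : R => x)} by exact: cst_continuous.
      exact: (continuousD hx h1).
    apply: (@continuous_comp _ _ _ (fun t' : R => seg t' y) (d1 ^~ (ei i))) => //.
    by apply: d1_cont; apply: seg_B => //; lra.
rewrite -E2 E1.
apply: integral_le0 => t; have [ht|ht] := boolP (0 < t < t1); last first.
  by rewrite integral0_eq// => y _; rewrite Tc (negbTE ht).
rewrite (eq_integral (fun y => ((dd t \_ B) y)%:E)) => [|y _]; last by rewrite Tc ht.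
by apply: integral_dd_le0; move: ht => /andP[h1 h2]; rewrite ltW//= (lt_trans h2)//; lra.
Qed.

Hypothesis u_cont : forall y, B y -> {for y, continuous u}.
(** The limit [t -> 1] is taken in [w], bounded and continuous on the whole space, because [u] is
    not controlled at the sphere. Lying below [u] with equality at [x] is enough to inherit the
    inequality. *)
Variables (w : 'rV[R]_n -> R) (M : R).
Hypothesis w_cont : continuous w.
Hypothesis w_itv : forall y, 0 <= w y <= M.
Hypothesis w_le : forall y, B y -> w y <= u y.
Hypothesis w_x : w x = u x.

Let mB : measurable B. Proof. by apply: measurable_open_rV; exact: open_eball. Qed.

Let mu_B : (mu B < +oo)%E.
Proof.
apply: le_lt_trans (lebesgue_box n (enorm x + s)).
by apply: le_measure; rewrite ?inE//; [exact: measurable_box|exact: eball_box].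
Qed.

Let integrable_B (f : 'rV[R]_n -> R) K : (forall y, B y -> {for y, continuous f}) ->
  (forall y, B y -> `|f y| <= K) -> mu.-integrable B (EFin \o f).
Proof.
move=> cf fK; apply: measurable_bounded_integrable => //.
  by apply: measurable_fun_open_rV => //; exact: open_eball.
by exists K; split; [exact: num_real|move=> L KL y By; exact: le_trans (fK _ By) (ltW KL)].
Qed.

Let w_seg_cont t y : {for y, continuous (fun y => w (seg t y) - w x)}.
Proof.
apply: continuousB; last exact: cst_continuous.
apply: (@continuous_comp _ _ _ (seg t) w); first exact: continuous_seg.
exact: w_cont.
Qed.

Let w_diff y z : `|w y - w z| <= M.
Proof. by have := w_itv y; have := w_itv z; rewrite ler_norml; lra. Qed.

Let integral_w_seg_le0 t : 0 < t < 1 ->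
  (\int[mu]_(y in B) (w (seg t y) - w x)%:E <= 0)%E.
Proof.
move=> t01; have /andP[t0 t1] := t01; have s0 := s_gt0.
apply: le_trans (integral_segment_le0 t01).
have cu y : enorm (y - x) <= s -> {for y, continuous (fun y => u (seg t y) - u x)}.
  move=> ys; apply: continuousB; last exact: cst_continuous.
  apply: (@continuous_comp _ _ _ (seg t) u); first exact: continuous_seg.
  by apply: u_cont; apply: seg_B => //; lra.
have [K K0 hK] := bounded_on_closed_eball (ltW s0) cu.
apply: le_integral => //.
- by apply: (@integrable_B _ M) => y _; [exact: w_seg_cont|exact: w_diff].
- by apply: (@integrable_B _ K) => y By; [apply: cu|apply: hK]; exact: ltW.
- move=> y /set_mem By; rewrite lee_fin w_x lerD2r w_le//.
  by apply: seg_B; [lra|exact: ltW].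
Qed.

Let integral_w_le0 : (\int[mu]_(y in B) (w y - w x)%:E <= 0)%E.
Proof.
(* The shift by [2] keeps [t 0] positive. *)
pose t k : R := 1 - k.+2%:R^-1.
have t01 k : 0 < t k < 1.
  rewrite /t gtrBl invr_gt0 ltr0n andbT subr_gt0 invf_lt1 ?ltr0n//.
  by rewrite ltr1n.
have tcvg : t k @[k --> \oo] --> (1 : R).
  rewrite -[X in _ --> X]subr0; apply: cvgB; first exact: cvg_cst.
  have h := @cvg_harmonic R; rewrite -cvg_shiftS in h.
  exact: h.
have cvg : (\int[mu]_(y in B) (w (seg (t k) y) - w x)%:E @[k --> \oo] -->
    \int[mu]_(y in B) (w y - w x)%:E)%E.
  apply: (@dominated_cvg _ _ _ mu B mB (fun k y => (w (seg (t k) y) - w x)%:E)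
    (fun y => (w y - w x)%:E) (cst M%:E)).
  - move=> k; apply/measurable_EFinP; apply: measurable_fun_open_rV.
      exact: open_eball.
    by move=> y _; exact: w_seg_cont.
  - move=> y By; apply: cvg_EFin; first exact: nearW.
    apply: cvgB; last exact: cvg_cst.
    have hw : {for (1 : R), continuous (fun r : R => w (seg r y))}.
      have hs : {for (1 : R), continuous (fun r : R => seg r y)}.
        have h1 : {for (1 : R), continuous (fun r : R => r *: (y - x))} by exact: scalel_continuous.
        have hx : {for (1 : R), continuous (fun r : R => x)} by exact: cst_continuous.
        exact: (continuousD hx h1).
      by apply: (@continuous_comp _ _ _ (fun r : R => seg r y) w) => //; exact: w_cont.
    have E : seg 1 y = y by rewrite /seg scale1r addrC subrK.
    by have := cvg_comp _ _ tcvg hw; rewrite E.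
  - by [].
  - by apply: (@integrable_B (cst M) `|M|) => y _; [exact: cst_continuous|].
  - by move=> k y By; rewrite lee_fin; exact: w_diff.
apply: (cvge_to_le cvg); apply: nearW => k.
exact: integral_w_seg_le0.
Qed.

Theorem ball_mean_le : ball_mean w x s <= w x.
Proof.
have iw : mu.-integrable B (EFin \o w).
  apply: (@integrable_B _ M) => y _; first exact: w_cont.
  by have := w_itv y; rewrite ler_norml; lra.
have ic : mu.-integrable B (EFin \o cst (w x)).
  apply: (@integrable_B _ M) => y _; first exact: cst_continuous.
  by have := w_itv x; rewrite ler_norml /=; lra.
have : \int[mu]_(y in B) (w y - w x) <= 0.
  by rewrite /Rintegral fine_le0.
rewrite RintegralB// Rintegral_cst// subr_le0 /ball_mean => I.
have m0 : 0 <= fine (mu B) by rewrite fine_ge0.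
(* For a ball of measure [0] the mean would be [0] by [invr0], and [w] is nonnegative. *)
move: m0; rewrite le_eqVlt => /orP[/eqP <-|m0].
  by rewrite invr0 mul0r; have /andP[] := w_itv x.
by rewrite ler_pdivrMl// mulrC.
Qed.

End ball_mean.

(** * Touching from below *)

Section chain_rule.
Context {R : realType}.

Lemma mean_value0 (g dg : R -> R) (b : R) :
  (forall t : R, `|t| <= `|b| -> is_derive t 1 g (dg t)) ->
  exists2 c, `|c| <= `|b| & g b - g 0 = dg c * b.
Proof.
move=> D; have [b0|b0] := leP 0 b.
  have [t|c hc E] := @mean_value R g dg 0 b b0.
    by move=> ht; apply: D; rewrite ger0_norm ?ger0_norm//; lra.
  by exists c; [rewrite ger0_norm ?ger0_norm//; lra|rewrite E subr0].
have [t|c hc E] := @mean_value R g dg b 0 (ltW b0).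
  by move=> ht; apply: D; rewrite ler0_norm ?ltr0_norm//; lra.
exists c; first by rewrite ler0_norm ?ltr0_norm//; lra.
by rewrite -opprB E sub0r mulrN opprK.
Qed.

Lemma is_derive_sumE {V : normedModType R} m (f : 'I_m -> V -> R) (d : 'I_m -> R) (y v : V) :
  (forall i, is_derive y v (f i) (d i)) ->
  is_derive y v (fun z => \sum_i f i z) (\sum_i d i).
Proof.
move=> D; rewrite (_ : (fun z => _) = \sum_i f i); first exact: is_derive_sum.
by apply/funext => z; rewrite fct_sumE.
Qed.

(** The step [h (v + c e)] is made as [h v] followed by [h c e]; by the mean value theorem the
    second part contributes [h c] times a value of [g] near [y]. *)
Lemma is_deriveD_dir {V : normedModType R} (f g : V -> R) (y v e : V) (c d : R) :
  (\forall z \near y, is_derive z e f (g z)) -> {for y, continuous g} ->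
  is_derive y v f d -> is_derive y (v + c *: e) f (d + c * g y).
Proof.
move=> Df cg Dv.
have cv : (fun h => h^-1 *: ((f \o shift y) (h *: (v + c *: e)) - f y)) @ 0^' --> d + c * g y.
  have cv : (fun h => h^-1 *: ((f \o shift y) (h *: v) - f y)) @ 0^' --> d.
    by have [dv <-] := Dv.
  apply/cvgrPdist_le => eps eps0.
  have e2 : 0 < eps / 2 by rewrite divr_gt0.
  move/cvgrPdist_le : cv => /(_ _ e2) cv.
  have e3 : 0 < eps / 2 / (1 + `|c|).
    by rewrite divr_gt0// ltr_pwDl.
  have cg' : \forall z \near y, `|g y - g z| <= eps / 2 / (1 + `|c|).
    by move/cvgrPdist_le : cg; apply.
  have : \forall z \near y, is_derive z e f (g z) /\ `|g y - g z| <= eps / 2 / (1 + `|c|).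
    by apply: filterS2 Df cg' => z.
  move=> /nbhs_ballP[r /= r0 rP].
  pose K := `|v| + `|c| * `|e| + 1.
  have K0 : 0 < K by rewrite ltr_wpDl// addr_ge0// mulr_ge0.
  near=> h.
  have h0 : h != 0 by near: h; exact: nbhs_dnbhs_neq.
  have hr : `|h| < r / K.
    near: h; apply: dnbhs0_lt; exact: divr_gt0.
  have hcv : `|d - h^-1 *: ((f \o shift y) (h *: v) - f y)| <= eps / 2 by near: h.
  have inball (t : R) : `|t| <= `|h * c| -> ball y r (t *: e + (h *: v + y)).
    move=> tc; rewrite -ball_normE /=.
    have -> : y - (t *: e + (h *: v + y)) = - (t *: e + h *: v).
      by rewrite addrA opprD addrCA subrr addr0.
    rewrite normrN.
    apply: le_lt_trans (ler_normD _ _) _; rewrite !normrZ.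
    have : `|h| * K < r by rewrite -ltr_pdivlMr.
    apply: le_lt_trans; rewrite normrM in tc.
    have := ler_wpM2r (normr_ge0 e) tc; have := normr_ge0 h; rewrite /K; lra.
  have [t tb|t tb E] := @mean_value0 (fun t => f (t *: e + (h *: v + y)))
     (fun t => g (t *: e + (h *: v + y))) (h * c).
    by apply: is_derive_line_at; have [] := rP _ (inball _ tb).
  have [_ gt] := rP _ (inball _ tb).
  have -> : h^-1 *: ((f \o shift y) (h *: (v + c *: e)) - f y) =
      h^-1 *: ((f \o shift y) (h *: v) - f y) + c * g (t *: e + (h *: v + y)).
    have Ef : f (h *: (v + c *: e) + y) =
        f (h *: v + y) + g (t *: e + (h *: v + y)) * (h * c).
      move: E; rewrite scale0r add0r => <-.
      have -> : h *: (v + c *: e) + y = (h * c) *: e + (h *: v + y).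
        by rewrite scalerDr scalerA addrAC addrC.
      by rewrite [RHS]addrC subrK.
    by rewrite /= Ef /GRing.scale/=; field.
  rewrite opprD addrACA -mulrBr (le_trans (ler_normD _ _))// [leRHS]splitr lerD//.
  rewrite normrM; apply: (@le_trans _ _ (`|c| * (eps / 2 / (1 + `|c|)))).
    by rewrite ler_wpM2l.
  rewrite mulrCA ger_pMr// ler_pdivrMr ?mul1r ?lerDr// ltr_pwDl//.
by apply: DeriveDef; [apply/cvg_ex; exists (d + c * g y)|apply: cvg_lim].
Unshelve. all: by end_near. Qed.

(** [C1_on] speaks of coordinate directions only; they are added to the direction one at a time. *)
Lemma is_derive_C1 n (Omega : set 'rV[R]_n) phi (y v : 'rV[R]_n) : open Omega -> Omega y ->
  C1_on Omega phi -> is_derive y v phi (\sum_i v 0 i * partial i phi y).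
Proof.
move=> oO Oy C1.
have Dn i : \forall z \near y, is_derive z (delta_mx 0 i) phi (partial i phi z).
  apply: filterS (open_nbhs_nbhs (conj oO Oy)) => z Oz.
  by apply: derivableP; have [] := C1 i z Oz.
have E (r : seq 'I_n) : is_derive y (\sum_(i <- r) v 0 i *: (delta_mx 0 i : 'rV[R]_n)) phi
    (\sum_(i <- r) v 0 i * partial i phi y).
  elim: r => [|i r IH]; first by rewrite !big_nil; exact: is_derive0.
  rewrite !big_cons addrC [X in is_derive _ _ _ X]addrC.
  apply: is_deriveD_dir => //; have [] := C1 i y Oy => //.
have vE : v = \sum_i v 0 i *: (delta_mx 0 i : 'rV[R]_n) by exact: row_sum_delta.
rewrite [X in is_derive _ X _ _]vE; exact: E.
Qed.

End chain_rule.

Lemma combination_le0 (R : realDomainType) (a c s1 s2 : R) :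
  0 <= a -> 0 <= c -> s1 <= 0 -> s2 <= 0 -> a * s1 + c * s2 <= 0.
Proof.
by move=> a0 c0 h1 h2; rewrite -[leRHS]addr0 lerD// mulr_ge0_le0.
Qed.

(** * Comparison of derivatives at a touching point *)

Section touching.
Context {R : realType} {n : nat}.
Variables (Omega : set 'rV[R]_n) (phi u : 'rV[R]_n -> R) (x : 'rV[R]_n).
Variables (d1 : 'rV[R]_n -> 'rV[R]_n -> R) (d2 : 'rV[R]_n -> R).
Hypothesis oO : open Omega.
Hypothesis Ox : Omega x.
Hypothesis C2 : C2_on Omega phi.
Hypothesis phi_u : \forall y \near x, phi y <= u y.
Hypothesis phi_x : phi x = u x.
Hypothesis d1P : forall v, \forall y \near x, is_derive y v u (d1 y v).
Hypothesis d2P : forall v, is_derive x v (d1 ^~ v) (d2 v).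

(** On each line through [x] the difference [u - phi] has a local minimum at [x]. *)
Lemma touching_second_order (v : 'rV[R]_n) : \sum_i v 0 i * partial i phi x = d1 x v /\
  \sum_i \sum_j v 0 i * v 0 j * partial j (partial i phi) x <= d2 v.
Proof.
have [C1 C1'] := C2.
have nO : \forall y \near x, Omega y by exact: open_nbhs_nbhs.
have : \forall y \near x, [/\ Omega y, phi y <= u y & is_derive y v u (d1 y v)].
  by apply: filterS3 nO phi_u (d1P v) => y.
move=> /nbhs_ballP[r /= r0 rP].
pose e := r / (`|v| + 1).
have v1 : 0 < `|v| + 1 by rewrite ltr_wpDl.
have e0 : 0 < e by rewrite divr_gt0.
have inb (t : R) : `|t - 0| < e -> ball x r (t *: v + x).
  rewrite subr0 /e ltr_pdivlMr// => ht; rewrite -ball_normE /= opprD addrCA subrr addr0 normrN normrZ.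
  by apply: le_lt_trans ht; rewrite ler_wpM2l// lerDl.
pose f (t : R) := u (t *: v + x) - phi (t *: v + x).
pose df (t : R) := d1 (t *: v + x) v - \sum_i v 0 i * partial i phi (t *: v + x).
have Df (t : R) : `|t - 0| < e -> is_derive t 1 f (df t).
  move=> /inb/rP[Oy _ Du]; have Dp := is_derive_C1 v oO Oy C1.
  exact: is_deriveB (is_derive_line_at Du) (is_derive_line_at Dp).
have Ddf : is_derive (0 : R) 1 df (d2 v - \sum_i v 0 i * \sum_j v 0 j * partial j (partial i phi) x).
  apply: is_deriveB; first exact: ((@is_derive_line _ _ (d1 ^~ v) x v (d2 v)).1 (d2P v)).
  apply: (@is_derive_line _ _ (fun z => \sum_i v 0 i * partial i phi z) x v _).1.
  apply: is_derive_sumE => i; have D := is_derive_C1 v oO Ox (C1' i).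
  by apply: is_derive_eq.
have fmin (t : R) : `|t - 0| < e -> f 0 <= f t.
  by move=> /inb/rP[_ h _]; rewrite /f scale0r add0r phi_x subrr subr_ge0.
have [h1 h2] := second_derivative_min e0 Df Ddf fmin.
split; first by move: h1; rewrite /df scale0r add0r => /eqP; rewrite subr_eq0 => /eqP.
move: h2; rewrite subr_ge0; apply: le_trans; rewrite le_eqVlt; apply/orP; left; apply/eqP.
by apply: eq_bigr => i _; rewrite mulr_sumr; apply: eq_bigr => j _; rewrite mulrA.
Qed.

(** For finite [p] the operator is [|grad phi|^(p-2)] times the Laplacian plus
    [(p - 2) |grad phi|^(p-4)] times the infinity-Laplacian. For [p >= 2] both factors are
    nonnegative, so two signs serve every [p]. *)
Lemma p_laplace_touching (p : \bar R) : (2%:E <= p)%E -> grad phi x != 0 ->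
  \sum_i d2 (delta_mx 0 i) <= 0 ->
  (forall v : 'rV[R]_n, (forall i, v 0 i = d1 x (delta_mx 0 i)) -> d2 v <= 0) ->
  p_laplace p phi x <= 0.
Proof.
move=> p2 g0 lap inf; set v := grad phi x.
have vE i : v 0 i = partial i phi x by rewrite mxE.
have delta_sum (f : 'I_n -> R) i : \sum_j (delta_mx 0 i : 'rV[R]_n) 0 j * f j = f i.
  rewrite (bigD1 i)//= mxE !eqxx mul1r big1 ?addr0// => j ji.
  by rewrite mxE eqxx (negbTE ji) mul0r.
have dE i : partial i phi x = d1 x (delta_mx 0 i).
  by have [<- _] := touching_second_order (delta_mx 0 i); rewrite delta_sum.
have Q : \sum_i \sum_j partial i phi x * partial j phi x * partial j (partial i phi) x <= 0.
  have [_ h] := touching_second_order v.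
  under eq_bigr do under eq_bigr do rewrite -2!vE.
  by apply: le_trans h _; apply: inf => i; rewrite vE dE.
have L : \sum_i partial i (partial i phi) x <= 0.
  apply: le_trans lap; apply: ler_sum => i _.
  have [_] := touching_second_order (delta_mx 0 i); apply: le_trans.
  rewrite (eq_bigr (fun i' => (delta_mx 0 i : 'rV[R]_n) 0 i' *
      \sum_j (delta_mx 0 i : 'rV[R]_n) 0 j * partial j (partial i' phi) x)).
    by rewrite !delta_sum.
  by move=> i' _; rewrite mulr_sumr; apply: eq_bigr => j _; rewrite mulrA.
case: p p2 => [q||] //=; rewrite ?lee_fin => p2.
have [C1 C1'] := C2; have q2 : 0 <= q - 2 by rewrite subr_ge0.
pose N := enorm v.
have N0 : 0 < N by rewrite /N enorm_gt0.
have D i : partial i (fun y => enorm (grad phi y) `^ (q - 2) * partial i phi y) x =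
  N `^ (q - 2) * partial i (partial i phi) x + (q - 2) * N `^ (q - 2) / N ^+ 2 *
   \sum_j partial i phi x * partial j phi x * partial i (partial j phi) x.
  pose S := \sum_j partial j phi x * partial i (partial j phi) x.
  have -> : \sum_j partial i phi x * partial j phi x * partial i (partial j phi) x =
      partial i phi x * S.
    by rewrite mulr_sumr; apply: eq_bigr => j _; rewrite mulrA.
  have DS : is_derive x (delta_mx 0 i) (fun y => dot (grad phi y) (grad phi y))
     (2 * S).
    rewrite /dot /S mulr_sumr; apply: is_derive_sumE => j.
    have Dj : is_derive x (delta_mx 0 i : 'rV[R]_n) (partial j phi) (partial i (partial j phi) x).
      by apply: derivableP; have [] := C1' j i x Ox.
    rewrite (_ : (fun y => _) = (fun y => partial j phi y * partial j phi y)); last first.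
      by apply/funext => y; rewrite mxE.
    by apply: is_derive_eq; rewrite /GRing.scale/=; ring.
  have S0 : 0 < dot v v by rewrite -sqr_enorm exprn_gt0.
  have DN := is_derive_chain (g := fun y => dot (grad phi y) (grad phi y)) (is_derive1_sqrt S0) DS.
  rewrite -enormE -/N in DN.
  have DP := is_derive_chain (g := Num.sqrt \o (fun y => dot (grad phi y) (grad phi y)))
     (f := fun t => t `^ (q - 2)) _ DN.
  rewrite /= -enormE -/N in DP; have {}DP := DP _ (is_derive1_powR (q - 2) N0).
  have Di : is_derive x (delta_mx 0 i : 'rV[R]_n) (partial i phi) (partial i (partial i phi) x).
    by apply: derivableP; have [] := C1' i i x Ox.
  have DM := is_deriveM DP Di.
  have [_ DE] := DM.
  transitivity ('D_(delta_mx 0 i) (((fun t => t `^ (q - 2)) \o (Num.sqrt \o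
      (fun y => dot (grad phi y) (grad phi y)))) * partial i phi) x).
    congr ('D_ _ _ _); apply/funext => y; rewrite /= enormE//.
  rewrite DE /GRing.scale/= -enormE -/N.
  have -> : N `^ (q - 2 - 1) = N `^ (q - 2) / N.
    rewrite (@powRD _ N (q - 2)); last by apply/implyP => _; rewrite gt_eqF.
    by rewrite powR_inv1// ltW.
  have key (A B T c d : R) : B != 0 -> A * d + c * ((q - 2) * (A / B) * ((2 * B)^-1 * (2 * T))) =
      A * d + (q - 2) * A / B ^+ 2 * (c * T) by move=> B0; field.
  exact: key (lt0r_neq0 N0).
have E0 : \sum_i partial i (fun y => enorm (grad phi y) `^ (q - 2) * partial i phi y) x =
  N `^ (q - 2) * (\sum_i partial i (partial i phi) x) + (q - 2) * N `^ (q - 2) / N ^+ 2 *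
   (\sum_i \sum_j partial i phi x * partial j phi x * partial i (partial j phi) x).
  have lin (A C : R) (f g : 'I_n -> R) :
      \sum_i (A * f i + C * g i) = A * (\sum_i f i) + C * (\sum_i g i).
    by rewrite big_split/= -!mulr_sumr.
  rewrite -lin; apply: eq_bigr => i _; exact: D.
suff : N `^ (q - 2) * (\sum_i partial i (partial i phi) x) + (q - 2) * N `^ (q - 2) / N ^+ 2 *
   (\sum_i \sum_j partial i phi x * partial j phi x * partial i (partial j phi) x) <= 0.
  by rewrite -E0.
(* The coefficient is symmetric, so renaming the indices replaces the symmetry of second
   derivatives. *)
have E : \sum_i \sum_j partial i phi x * partial j phi x * partial i (partial j phi) x =
  \sum_i \sum_j partial i phi x * partial j phi x * partial j (partial i phi) x.
  have swap (a : 'I_n -> R) (f : 'I_n -> 'I_n -> R) :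
      \sum_i \sum_j a i * a j * f j i = \sum_i \sum_j a i * a j * f i j.
    by rewrite exchange_big; do 2!(apply: eq_bigr => ? _); congr (_ * _); exact: mulrC.
  exact: (swap (fun i => partial i phi x) (fun i j => partial j (partial i phi) x)).
have Nq := powR_ge0 N (q - 2); have N2 : 0 <= (N ^+ 2)^-1 by rewrite invr_ge0 sqr_ge0.
exact: combination_le0 Nq (mulr_ge0 (mulr_ge0 q2 Nq) N2) L (eq_ind_r (fun t => t <= 0) Q E).
Qed.
End touching.

(** * Domains and exterior cones *)

Section domains.
Context {R : realType}.

Lemma open_boundary n (Omega : set 'rV[R]_n) x : open Omega -> boundary Omega x ->
  closure Omega x /\ ~ Omega x.
Proof. by move=> oO [cx nx]; split=> // Ox; apply: nx; exact: open_nbhs_nbhs. Qed.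

Lemma coord_le_norm n (y : 'rV[R]_n) i : `|y 0 i| <= `|y|.
Proof.
change (`|y 0 i| <= mx_norm y); rewrite mx_normrE.
exact: (le_bigmax _ (fun ij => `|y ij.1 ij.2|) (0, i)).
Qed.

Lemma open_eball_subset n (Omega : set 'rV[R]_n) x : open Omega -> Omega x ->
  exists2 s, 0 < s & eball x s `<=` Omega.
Proof.
move=> oO Ox; have /nbhs_ballP[s /= s0 sO] : nbhs x Omega by exact: open_nbhs_nbhs.
exists s => // y ys; apply: sO; rewrite -ball_normE /=.
by apply: le_lt_trans ys; rewrite distrC; exact: norm_le_enorm.
Qed.

Lemma eball_nbhs n (x : 'rV[R]_n) s : 0 < s -> nbhs x (eball x s).
Proof.
move=> s0; apply: open_nbhs_nbhs; split; first exact: open_eball.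
by rewrite /eball/= subrr enorm0.
Qed.

(** If [y] were outside, the first exit point of the segment from [x] to [y] would be a boundary
    point no farther from [x] than [y]. *)
Lemma eball_edistance n (Omega : set 'rV[R]_n) x s : open Omega -> Omega x ->
  s <= edistance x (boundary Omega) -> eball x s `<=` Omega.
Proof.
move=> oO Ox sd y ys; apply: contrapT => Oy.
pose g (t : R) : 'rV[R]_n := t *: (y - x) + x.
have cg : continuous g.
  move=> t; have h1 : {for t, continuous (fun t : R => t *: (y - x))} by exact: scalel_continuous.
  have h2 : {for t, continuous (fun t : R => x)} by exact: cst_continuous.
  exact: (continuousD h1 h2).
pose S := [set t : R | 0 <= t /\ ~ Omega (g t)].
have S1 : S 1 by split => //; rewrite /g scale1r subrK.
have lS : has_lbound S by exists 0 => t [].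
have hS : has_inf S by split => //; exists 1.
pose t0 := inf S.
have t0ge : 0 <= t0 by apply: lb_le_inf; [exists 1|move=> t []].
have t01 : t0 <= 1 := ge_inf lS S1.
have below t : 0 <= t < t0 -> Omega (g t).
  move=> /andP[h1 h2]; apply: contrapT => nO.
  by have : t0 <= t := ge_inf lS (conj h1 nO); rewrite leNgt h2.
have nO0 : ~ Omega (g t0).
  move=> O0; have : nbhs t0 (g @^-1` Omega) by apply: cg; exact: open_nbhs_nbhs.
  move=> /nbhs_ballP[e /= e0 eO].
  have [t St te] := inf_adherent e0 hS; have [_ nt] := St.
  apply: nt; apply: eO; rewrite -ball_normE /= distrC.
  have h : t0 <= t := ge_inf lS St.
  by rewrite ger0_norm ?subr_ge0// ltrBlDl.
have t0gt : 0 < t0.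
  rewrite lt_neqAle t0ge andbT; apply/eqP => E; apply: nO0.
  by rewrite -E /g scale0r add0r.
have bd : boundary Omega (g t0).
  split; last by move=> /nbhs_singleton/nO0.
  move=> A /cg /nbhs_ballP[e /= e0 eA].
  pose t := Num.max 0 (t0 - e / 2).
  have tt : 0 <= t < t0 by rewrite /t le_max lexx gt_max t0gt/=; lra.
  exists (g t); split; first exact: below.
  apply: eA; rewrite -ball_normE /= ger0_norm ?subr_ge0; last by lra.
  by have : t0 - e / 2 <= t by [rewrite /t le_max lexx orbT]; lra.
have : edistance x (boundary Omega) <= enorm (x - g t0).
  by apply: ge_inf; [exists 0 => _ [z _ <-]; exact: enorm_ge0|exists (g t0)].
rewrite enormB /g addrK enormZ ger0_norm// => h.
have := ler_wpM2r (enorm_ge0 (y - x)) t01; rewrite mul1r.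
by move: ys; rewrite /eball/=; lra.
Qed.

Lemma rotation_dot n (Q : 'M[R]_n) (u v : 'rV[R]_n) : rotation Q ->
  dot (u *m Q^T) (v *m Q^T) = dot u v.
Proof.
move=> [QQ _]; have QtQ : Q^T *m Q = 1%:M by exact: mulmx1C.
have E (a b : 'rV[R]_n) : dot a b = (a *m b^T) 0 0.
  by rewrite mxE; apply: eq_bigr => i _; rewrite mxE.
by rewrite !E trmx_mul trmxK mulmxA -(mulmxA u) QtQ mulmx1.
Qed.

(* [row 0 Q] is the direction opposite to the axis of the cone at [xi]. *)
Lemma exterior_cone_axis n (Omega : set 'rV[R]_n.+1) alpha r xi (Q : 'M[R]_n.+1) :
  rotation Q -> [set xi + y *m Q | y in cone alpha r] `<=` ~` Omega ->
  dot (row 0 Q) (row 0 Q) = 1 /\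
  forall y, y != xi -> enorm (y - xi) <= r -> cosang xi (row 0 Q) y <= - cos alpha -> ~ Omega y.
Proof.
move=> rQ cQ; have [QQ _] := rQ; have QtQ : Q^T *m Q = 1%:M by exact: mulmx1C.
split.
  have := congr1 (fun M : 'M[R]_n.+1 => M 0 0) QQ; rewrite !mxE eqxx/= => E; rewrite -[RHS]E.
  by apply: eq_bigr => i _; rewrite !mxE.
move=> y yxi yr cy; have q0 : 0 < enorm (y - xi) by rewrite enorm_gt0 subr_eq0.
pose z := (y - xi) *m Q^T.
have -> : y = xi + z *m Q by rewrite /z -mulmxA QtQ mulmx1 addrC subrK.
apply: cQ; exists z => //.
have zn : enorm z = enorm (y - xi) by rewrite !enormE rotation_dot.
split; last by rewrite zn.
have -> : z 0 ord0 = dot (y - xi) (row 0 Q).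
  by rewrite /z mxE; apply: eq_bigr => i _; rewrite !mxE.
by rewrite zn cosangE// mulrC -mulrN ler_wpM2l// ltW.
Qed.

(** At the supremum of the domain the unrotated cone contains the segment of length [r] to the left,
    which meets the domain. *)
Lemma uniform_exterior_cone_rV1 (Omega : set 'rV[R]_1) alpha r : 0 < r -> domain Omega ->
  bounded_set Omega -> ~ uniform_exterior_cone Omega alpha r.
Proof.
move=> r0 [oO _ [y0 Oy0]] bO cO.
pose S := [set y 0 0 | y in Omega].
have hS : has_sup S.
  split; first by exists (y0 0 0), y0.
  have [M [_ hM]] := bO; exists (M + 1) => _ [y Oy <-].
  have : `|y| <= M + 1 by apply: hM => //; rewrite ltrDl.
  apply: le_trans; exact: le_trans (ler_norm _) (coord_le_norm y 0).
pose p : 'rV[R]_1 := const_mx (sup S).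
have np : ~ Omega p.
  move=> Op; have /nbhs_ballP[e /= e0 eO] : nbhs p Omega by exact: open_nbhs_nbhs.
  have : Omega (const_mx (sup S + e / 2)).
    apply: eO; split => // i j; rewrite !mxE /ball/=.
    by rewrite opprD addrA subrr sub0r normrN ger0_norm; lra.
  move=> h; have : S (sup S + e / 2) by exists (const_mx (sup S + e / 2)) => //; rewrite mxE.
  by move=> /(sup_upper_bound hS); lra.
have bp : boundary Omega p.
  split; last by move=> /nbhs_singleton/np.
  move=> A /nbhs_ballP[e /= e0 eA].
  have [_ [y Oy <-] ye] := sup_adherent e0 hS.
  exists y; split => //; apply: eA; split => // i j; rewrite (ord1 i) (ord1 j) mxE /ball/=.
  have : y 0 0 <= sup S by apply: sup_upper_bound => //; exists y.
  by move=> h; rewrite ger0_norm; lra.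
have [Q [_ dQ] cQ] := cO _ bp.
have [_ [y Oy <-] yr] := sup_adherent r0 hS.
have yS : y 0 0 <= sup S by apply: sup_upper_bound => //; exists y.
have Q1 : Q = 1%:M.
  by apply/matrixP => i j; rewrite (ord1 i) (ord1 j) mxE eqxx -dQ det_mx11.
suff : ~ Omega y by [].
rewrite (_ : y = p + (y - p) *m Q); last by rewrite Q1 mulmx1 addrC subrK.
apply: cQ; exists (y - p) => //.
have E : enorm (y - p) = sup S - y 0 0.
  rewrite /enorm big_ord1 !mxE sqrtr_sqr ler0_norm; lra.
rewrite /cone/= E !mxE; split; last by lra.
have := cos_le1 alpha; nra.
Qed.
End domains.

(** * The barrier *)

(** The nearest-point projection onto a ball is nonexpansive and fixes [v]. *)
Lemma enorm_radial_retract (R : realType) n (u v : 'rV[R]_n) (r : R) :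
  0 < r -> enorm v <= r -> r < enorm u ->
  enorm ((r / enorm u) *: u - v) <= enorm (u - v).
Proof.
move=> r0 vr ru; have Y0 : 0 < enorm u by exact: lt_trans ru.
rewrite -ler_sqr ?nnegrE ?enorm_ge0// !sqr_enorm.
have := cauchy_schwarz u v; have := sqr_enorm u.
move: (enorm u) (enorm v) Y0 vr ru => Y X Y0 Xr rY; set t := r / Y => uE uv.
rewrite !(dotDl, dotDr, dotZl, dotZr, dotNl, dotNr) (dotC v u) -uE.
have tY : t * Y = r by rewrite /t divfK// gt_eqF.
have t1 : 0 < 1 - t by rewrite subr_gt0 /t ltr_pdivrMr// mul1r.
have h1 : (1 - t) * dot u v <= (1 - t) * (Y * r).
  by rewrite ler_wpM2l ?(ltW t1)//; apply: le_trans uv _; rewrite ler_wpM2l// ltW.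
have h2 : (1 - t) * (Y * r * 2) <= (1 - t) * (Y * (Y + r)).
  by rewrite ler_wpM2l ?(ltW t1)// -mulrA ler_wpM2l ?(ltW Y0)//; lra.
have h3 : (1 - t) * (Y * (Y + r)) = Y ^+ 2 - r ^+ 2 by rewrite -tY; ring.
have h4 : t * (t * Y ^+ 2) = r ^+ 2 by rewrite -tY; ring.
have h5 : 0 <= (1 - t) * (Y * (Y - r)) by rewrite mulr_ge0 ?(ltW t1)// mulr_ge0 ?(ltW Y0)//; lra.
lra.
Qed.

Section barrier.
Context {R : realType} (k : nat).
Local Notation V := 'rV[R]_k.+2.
Variables (Omega : set V) (alpha r gamma : R) (xi e : V).
Variables (a m : R) (F F1 F2 : R -> R).
Hypothesis oO : open Omega.
Hypothesis alpha_itv : 0 < alpha < pi / 2.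
Hypothesis r_gt0 : 0 < r.
Hypothesis gamma_itv : 0 < gamma <= 1 / 5.
Hypothesis prof : profile k alpha gamma a m F F1 F2.
Hypothesis e1 : dot e e = 1.
Hypothesis Oxi : ~ Omega xi.
Hypothesis cone_out : forall y, y != xi -> enorm (y - xi) <= r ->
  cosang xi e y <= - cos alpha -> ~ Omega y.
Implicit Types (x y : V).
Local Notation q y := (enorm (y - xi)).
Local Notation c y := (cosang xi e y).
Local Notation U y := (outside_cone alpha xi e y).

(** The value that the lower bound of [Wt] reaches at distance [r], so that [w = M] from there
    on. *)
Let M := alpha ^- k * r `^ gamma.
(** The profile is frozen inside the cone; this extends [W] continuously, with the same bounds, to
    the whole space. *)
Let Ft (t : R) := F (Num.max t (- cos alpha)).
Let Wt y := q y `^ gamma * Ft (c y).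
Definition cone_barrier y := Num.min (Wt y) M.
Local Notation w := cone_barrier.

Let alphak_gt0 : 0 < alpha ^- k.
Proof. by have /andP[a0 _] := alpha_itv; rewrite invr_gt0 exprn_gt0. Qed.

Let M_gt0 : 0 < M.
Proof. by rewrite mulr_gt0// powR_gt0. Qed.

Let m_gt0 : 0 < m.
Proof. exact: lt_le_trans alphak_gt0 (profile_m prof). Qed.

Let max_itv y : - cos alpha <= Num.max (c y) (- cos alpha) <= 1.
Proof.
have := cosang_itv xi e1 y => h.
by rewrite le_max lexx orbT/= ge_max; have := cosN alpha; have := cos_geN1 alpha; lra.
Qed.

Let Ft_itv y : m <= Ft (c y) <= gamma ^- 2.
Proof. by rewrite /Ft; apply: (profile_bound prof); have := max_itv y; lra. Qed.

Let Wt_eq y : U y -> Wt y = W xi e gamma F y.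
Proof. by move=> [_ cy]; rewrite /Wt /W /Ft max_l// ltW. Qed.

Let q_mono y (t : R) : 0 <= t -> t <= q y -> t `^ gamma <= q y `^ gamma.
Proof.
have /andP[g0 _] := gamma_itv.
by move=> t0 ty; apply: ge0_ler_powR; rewrite ?nnegrE ?enorm_ge0// ltW.
Qed.

Let Wt_ge y : alpha ^- k * q y `^ gamma <= Wt y.
Proof.
rewrite /Wt mulrC ler_wpM2l ?powR_ge0//; have /andP[h _] := Ft_itv y.
exact: le_trans (profile_m prof) h.
Qed.

Let Wt_le y : Wt y <= gamma ^- 2 * q y `^ gamma.
Proof. by rewrite /Wt mulrC ler_wpM2r ?powR_ge0//; have /andP[_ h] := Ft_itv y. Qed.

Lemma cone_barrier_itv y : 0 <= w y <= M.
Proof.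
rewrite /w ge_min lexx orbT andbT le_min (ltW M_gt0) andbT.
by apply: le_trans (Wt_ge y); rewrite mulr_ge0 ?powR_ge0// ltW.
Qed.

Lemma cone_barrier_far y : r <= q y -> w y = M.
Proof.
move=> ry; apply/min_idPr; apply: le_trans (Wt_ge y).
by rewrite ler_wpM2l ?(ltW alphak_gt0)// q_mono// ltW.
Qed.

Lemma cone_barrier_bounds y :
  alpha ^- k * Num.min (q y) r `^ gamma <= w y <= gamma ^- 2 * q y `^ gamma.
Proof.
have /andP[g0 _] := gamma_itv; have r0 := r_gt0.
have mn0 : 0 <= Num.min (q y) r by rewrite le_min enorm_ge0 ltW.
apply/andP; split; last by rewrite ge_min Wt_le.
rewrite le_min; apply/andP; split.
  apply: le_trans (Wt_ge y); rewrite ler_wpM2l ?(ltW alphak_gt0)//.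
  by apply: q_mono => //; rewrite ge_min lexx.
rewrite ler_wpM2l ?(ltW alphak_gt0)//.
by apply: ge0_ler_powR; rewrite ?nnegrE ?(ltW g0) ?(ltW r0)// ge_min lexx orbT.
Qed.

Lemma cone_barrier_xi : w xi = 0.
Proof.
have /andP[h1 h2] := cone_barrier_itv xi; have /andP[_ h3] := cone_barrier_bounds xi.
have /andP[g0 _] := gamma_itv.
by apply: le_anti; rewrite h1 (le_trans h3)// subrr enorm0 powR0 ?mulr0// gt_eqF.
Qed.

Lemma cone_barrier_gt0 y : y != xi -> 0 < w y.
Proof.
move=> yxi; have /andP[h _] := cone_barrier_bounds y; apply: lt_le_trans h.
by rewrite mulr_gt0// powR_gt0// lt_min enorm_gt0 subr_eq0 yxi.
Qed.

Lemma cone_barrier_continuous : continuous w.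
Proof.
have /andP[g0 _] := gamma_itv; have /andP[_ aa] := profile_a prof.
suff cWt : continuous Wt.
  move=> y; apply: continuous_min; [exact: cWt|exact: cst_continuous].
move=> y; have [->|yxi] := eqVneq y xi.
  have W0 : Wt xi = 0.
    by rewrite /Wt subrr enorm0 powR0 ?mul0r// gt_eqF.
  apply/(@cvgrPdist_lt _ _ _ (nbhs xi) (nbhs_filter xi)) => eps eps0; rewrite W0.
  (* The solution of [gamma^-2 d^gamma = eps]. *)
  pose d := (eps * gamma ^+ 2) `^ gamma^-1.
  have eg : 0 < eps * gamma ^+ 2 by rewrite mulr_gt0// exprn_gt0.
  have d0 : 0 < d by rewrite powR_gt0.
  apply: (@filterS _ _ (nbhs_filter xi) _ _ _ (eball_nbhs xi d0)) => z zd; rewrite sub0r normrN ger0_norm.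
    apply: le_lt_trans (Wt_le z) _; rewrite mulrC ltr_pdivrMr ?exprn_gt0//.
    have : q z `^ gamma < d `^ gamma.
      by apply: gt0_ltr_powR; rewrite ?nnegrE ?enorm_ge0 ?(ltW d0).
    by rewrite /d -powRrM mulVf ?gt_eqF// powRr1// ltW.
  by apply: le_trans (Wt_ge z); rewrite mulr_ge0 ?powR_ge0// ltW.
have h1 : {for y, continuous (fun z : V => q z `^ gamma)} by exact: continuous_qpow.
suff h2 : {for y, continuous (fun z : V => Ft (c z))} by exact: (continuousM h1 h2).
apply: (@continuous_comp _ _ _ (fun z => c z) Ft); first exact: continuous_cosang.
rewrite /Ft; apply: (@continuous_comp _ _ _ (fun t : R => Num.max t (- cos alpha)) F).
  by apply: continuous_max; [exact: cvg_id|exact: cst_continuous].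
have := max_itv y => h.
by apply: (@is_derive1_continuous _ _ _ (F1 (Num.max (c y) (- cos alpha)))); apply: (profile_F prof); lra.
Qed.

Lemma eball_outside_cone x s : eball x s `<=` Omega -> q x <= r ->
  forall y, enorm (y - x) < s -> U y.
Proof.
move=> sO xr y ys; have Oy : Omega y by exact: sO.
have yxi : y != xi by apply/eqP => E; apply: Oxi; rewrite -E.
split => //; rewrite ltNge; apply/negP => cy.
have [yr|ry] := leP (q y) r; first exact: cone_out cy Oy.
have q0 : 0 < q y by rewrite enorm_gt0 subr_eq0.
pose p : V := xi + (r / q y) *: (y - xi).
have pE : p - xi = (r / q y) *: (y - xi) by rewrite /p addrAC subrr add0r.
have r0 := r_gt0; have rq : 0 < r / q y by rewrite divr_gt0.
have qp : q p = r by rewrite pE enormZ gtr0_norm// divfK// gt_eqF.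
have pxi : p != xi by rewrite -subr_eq0 -enorm_eq0 qp gt_eqF.
have cp : c p = c y.
  rewrite /cosang qp pE dotZl; move/lt0r_neq0: q0 => q0; move/lt0r_neq0: r0 => r0.
  by rewrite mulrC mulrA mulrA mulVf// mul1r mulrC.
apply: (cone_out pxi); rewrite ?qp ?cp//.
apply: sO; rewrite /eball/=; apply: le_lt_trans ys.
have -> : p - x = (r / q y) *: (y - xi) - (x - xi) by rewrite -pE opprB addrA subrK.
have -> : y - x = (y - xi) - (x - xi) by rewrite opprB addrA subrK.
exact: enorm_radial_retract.
Qed.

Let F_at y : U y -> [/\ a < c y < 2, - cos alpha <= c y <= 1 &
  is_derive (c y) 1 F (F1 (c y)) /\ is_derive (c y) 1 F1 (F2 (c y))].
Proof.
move=> [yxi cy]; have := cosang_itv xi e1 y; have /andP[_ aa] := profile_a prof => h.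
have ca : a < c y < 2 by lra.
by split; [|lra|split; [exact: (profile_F prof ca)|exact: (profile_F1 prof ca)]].
Qed.

Let sum_W2_le0 y : U y ->
  \sum_i W2 xi e gamma F F1 F2 y (delta_mx 0 i) <= 0.
Proof.
move=> Uy; have [ca cc _] := F_at Uy; have [yxi _] := Uy.
rewrite sum_W2// mulr_ge0_le0 ?mulr_ge0 ?powR_ge0 ?invr_ge0 ?sqr_ge0//.
have := profile_laplace prof cc.
have -> : k.+2%:R - 1 = k.+1%:R :> R by rewrite -natr1 addrK.
by have -> : gamma + k.+2%:R - 2 = gamma + k%:R :> R by rewrite -addn2 natrD addrA addrK.
Qed.

Lemma cone_barrier_ball x s : 0 < s -> eball x s `<=` Omega ->
  ball_mean w x s <= w x /\ ball_midrange w x s <= w x.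
Proof.
move=> s0 sO; have cw := cone_barrier_continuous; have iw := cone_barrier_itv.
have xx : eball x s x by rewrite /eball/= subrr enorm0.
have midrange : (forall y, eball x s y -> exists2 z, eball x s z & w y + w z <= 2 * w x) ->
    ball_midrange w x s <= w x.
  move=> H; have li : has_lbound (w @` eball x s).
    by exists 0 => _ [y _ <-]; have /andP[] := iw y.
  suff : sup (w @` eball x s) <= 2 * w x - inf (w @` eball x s).
    by rewrite /ball_midrange; lra.
  apply: ge_sup; first by exists (w x), x.
  move=> _ [y ys <-]; have [z zs] := H y ys.
  have : inf (w @` eball x s) <= w z by apply: ge_inf => //; exists z.
  lra.
(* At a maximum of [w] the comparison function is the constant [M]. Elsewhere [cone_barrier_far]
   forces [q x <= r], and it is [W]. *)
have [wM|wM] := eqVneq (w x) M.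
  split.
    apply: (@ball_mean_le _ _ x s (cst (w x)) (fun _ _ => 0) (fun _ _ => 0) s0 _ _ _ _ _ _ _ w M) => //.
    - by move=> y v; rewrite [RHS]big1// => i _; rewrite mulr0.
    - by move=> y i _; exact: is_derive_cst.
    - by move=> y i _; exact: cst_continuous.
    - by move=> y i _; exact: cst_continuous.
    - by move=> y _; rewrite big1.
    - by move=> y _; exact: cst_continuous.
    - by move=> y _; rewrite /= wM; have /andP[] := iw y.
  apply: midrange => y ys; exists x => //.
  by rewrite wM; have /andP[_] := iw y; lra.
have xr : q x <= r.
  by rewrite leNgt; apply/negP => /ltW/cone_barrier_far E; rewrite E eqxx in wM.
have Us := eball_outside_cone sO xr.
have wxE : w x = W xi e gamma F x.
  rewrite -Wt_eq; last exact: Us.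
  by move: wM; rewrite /w /Num.min; case: ifP; rewrite ?eqxx.
have w_le y : eball x s y -> w y <= W xi e gamma F y.
  by move=> ys; rewrite -Wt_eq ?ge_min ?lexx//; exact: Us.
split; last first.
  apply: midrange => y ys.
  have [z zs h] := midrange_pair prof alpha_itv gamma_itv m_gt0 e1 Us ys.
  by exists z => //; have := w_le _ ys; have := w_le _ zs; rewrite wxE; lra.
have W12 y v : eball x s y -> {for y, continuous (W1 xi e gamma F F1 ^~ v)} /\
    {for y, continuous (W2 xi e gamma F F1 F2 ^~ v)}.
  move=> ys; have Uy := Us _ ys; have [ca cc [D1 D2]] := F_at Uy; have [yxi _] := Uy.
  by apply: continuous_W12 => //; exact: (profile_F2 prof ca).
apply: (@ball_mean_le _ _ x s (W xi e gamma F) (W1 xi e gamma F F1)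
  (fun y i => W2 xi e gamma F F1 F2 y (delta_mx 0 i)) s0 _ _ _ _ _ _ _ w M) => //.
- move=> y v ys; have Uy := Us _ ys; have [ca cc [D1 D2]] := F_at Uy; have [yxi _] := Uy.
  exact: is_derive_W.
- move=> y v; rewrite {1}/W1.
  have dE (u : V) : dot u v = \sum_i v 0 i * dot u (delta_mx 0 i).
    by apply: eq_bigr => i _; rewrite dot_delta mulrC.
  rewrite (dotC v) !dE !mulr_sumr -big_split mulr_sumr/=; apply: eq_bigr => i _.
  by rewrite /W1 (dotC (delta_mx 0 i)); ring.
- move=> y i ys; have Uy := Us _ ys; have [ca cc [D1 D2]] := F_at Uy; have [yxi _] := Uy.
  exact: is_derive_W1.
- by move=> y i ys; have [] := W12 y (delta_mx 0 i) ys.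
- by move=> y i ys; have [] := W12 y (delta_mx 0 i) ys.
- by move=> y /Us; exact: sum_W2_le0.
- move=> y ys; have Uy := Us _ ys; have [ca cc [D1 D2]] := F_at Uy; have [yxi _] := Uy.
  have h1 : {for y, continuous (fun z : V => q z `^ gamma)} by exact: continuous_qpow.
  suff h2 : {for y, continuous (fun z : V => F (c z))} by exact: (continuousM h1 h2).
  apply: (@continuous_comp _ _ _ (fun z => c z) F); first exact: continuous_cosang.
  exact: is_derive1_continuous D1.
Qed.

Lemma cone_barrier_p_superharmonic p : (2%:E <= p)%E -> Omega !=set0 ->
  p_superharmonic Omega p (EFin \o w).
Proof.
move=> p2 [x0 Ox0]; have cw := cone_barrier_continuous; have iw := cone_barrier_itv.
split.
- by move=> x _; rewrite ltNyr.
- move=> x b; rewrite /= lte_fin => bw.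
  have cS : {within Omega, continuous w} by exact: continuous_subspaceT.
  have := cS x; move/(_ [set t | b < t]) => h.
  exists (w @^-1` [set t | b < t]).
    by apply: h; exact: open_nbhs_nbhs.
  by move=> y /=; rewrite lte_fin.
- by exists x0.
move=> x phi Ox C2 gphi wphi touch.
have phi_w : phi x = w x by case: wphi.
have phi_le y : Omega y -> phi y <= w y.
  move=> Oy; have [->|yx] := eqVneq y x; first by rewrite phi_w.
  by have := touch y Oy yx; rewrite lte_fin => /ltW.
have nbhsS (P Q : set V) : P `<=` Q -> nbhs x P -> nbhs x Q.
  exact: (@filterS _ _ (nbhs_filter x)).
have nO : nbhs x Omega by exact: open_nbhs_nbhs.
(* Where [w x = M], the function [phi] touches the constant [M] from below, so its gradient
   vanishes, against [gphi]. *)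
have [wM|wM] := eqVneq (w x) M.
  exfalso; move/eqP: gphi; apply; apply/rowP => i; rewrite !mxE.
  have [||v|E _] := @touching_second_order _ _ Omega phi (cst M) x (fun _ _ => 0) (fun=> 0)
    oO Ox C2 _ _ _ _ (delta_mx 0 i).
  + apply: nbhsS nO => y /phi_le h'; apply: le_trans h' _.
    by have /andP[] := iw y.
  + by rewrite phi_w.
  + by apply: nbhsS nO => y _; exact: is_derive_cst.
  + rewrite -[RHS]E (bigD1 i)//= mxE !eqxx mul1r big1 ?addr0// => j ji.
    by rewrite mxE eqxx (negbTE ji) mul0r.
have xr : q x <= r.
  by rewrite leNgt; apply/negP => /ltW/cone_barrier_far E; rewrite E eqxx in wM.
have [s s0 sO] := open_eball_subset oO Ox.
have Us := eball_outside_cone sO xr.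
have nU : nbhs x [set y | Omega y /\ U y].
  by apply: nbhsS (eball_nbhs x s0) => y ys; split; [exact: sO|exact: Us].
have Ux : U x by apply: Us; rewrite subrr enorm0.
have [xxi cx] := Ux; have [ca cc [D1 D2]] := F_at Ux.
have wxE : w x = W xi e gamma F x.
  rewrite -Wt_eq//.
  by move: wM; rewrite /w /Num.min; case: ifP; rewrite ?eqxx.
apply: (@p_laplace_touching _ _ Omega phi (W xi e gamma F) x (W1 xi e gamma F F1)
  (W2 xi e gamma F F1 F2 x)) => //.
- apply: nbhsS nU => y [/phi_le h Uy]; apply: le_trans h _.
  by rewrite -Wt_eq// /w ge_min lexx.
- by rewrite phi_w.
- move=> v; apply: nbhsS nU => y [_ Uy]; have [_ _ [D1' _]] := F_at Uy; have [yxi _] := Uy.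
  exact: is_derive_W.
- by move=> v; exact: is_derive_W1.
- exact: sum_W2_le0.
move=> v vE; rewrite (@W2_grad _ _ xi e gamma F F1 F2 x v xxi e1 vE) mulr_ge0_le0//.
  by rewrite mulr_ge0 ?exprn_ge0 ?powR_ge0// invr_ge0 exprn_ge0 ?enorm_ge0.
have /andP[g0 g5] := gamma_itv.
have F0 : 0 <= F (c x).
  by have /andP[h _] := profile_bound prof cc; exact: le_trans (ltW m_gt0) h.
have D0 : 0 <= (1 - c x ^+ 2) * F1 (c x) ^+ 2.
  by rewrite mulr_ge0 ?sqr_ge0//; have := cosang_itv xi e1 x; nra.
have h1 : gamma ^+ 3 * (gamma - 1) * F (c x) ^+ 3 <= 0.
  rewrite -mulrA mulr_ge0_le0 ?exprn_ge0 ?(ltW g0)//.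
  by rewrite mulr_le0_ge0 ?exprn_ge0//; lra.
have h2 : gamma * (2 * gamma - 1) * F (c x) * ((1 - c x ^+ 2) * F1 (c x) ^+ 2) <= 0.
  rewrite -mulrA -mulrA mulr_ge0_le0 ?(ltW g0)//.
  have h4 : 2 * gamma - 1 <= 0 by lra.
  exact: mulr_le0_ge0 h4 (mulr_ge0 F0 D0).
have h3 := mulr_ge0_le0 D0 (profile_concave prof cc).
lra.
Qed.

End barrier.

(** For finite [p >= 2] the coefficients [(p - 2) / (n + p)] and [(n + 2) / (n + p)] are nonnegative
    with sum [1]. *)
Lemma T_barrier_of_ball (R : realType) n (Omega : set 'rV[R]_n) rho (p : \bar R) xi w :
  open Omega -> (2%:E <= p)%E -> admissible_radius Omega rho ->
  barrier_function Omega xi w ->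
  (forall x s, 0 < s -> eball x s `<=` Omega ->
    ball_mean w x s <= w x /\ ball_midrange w x s <= w x) ->
  T_barrier Omega rho p xi w.
Proof.
move=> oO p2 [_ rhoO _] bw ball; split=> // x Ox.
have /andP[rho0 rhod] := rhoO x Ox.
have [mean mid] := ball x (rho x) rho0 (eball_edistance oO Ox rhod).
have S : Sop Omega rho w x <= w x by rewrite /Sop mem_set.
have T : Mop Omega rho w x <= w x by rewrite /Mop mem_set.
case: p p2 => [q||] //=; rewrite lee_fin => q2.
have nq : 0 < n%:R + q by have := ler0n R n; lra.
have a0 : 0 <= (q - 2) / (n%:R + q) by rewrite divr_ge0 ?(ltW nq)//; lra.
have b0 : 0 <= (n%:R + 2) / (n%:R + q).
  by rewrite divr_ge0 ?(ltW nq)//; have := ler0n R n; lra.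
have ab : (q - 2) / (n%:R + q) + (n%:R + 2) / (n%:R + q) = 1.
  by move/lt0r_neq0: nq => nq; field.
have h1 := ler_wpM2l a0 S; have h2 := ler_wpM2l b0 T.
by apply: le_trans (lerD h1 h2) _; rewrite -mulrDl ab mul1r.
Qed.

Theorem theorem3 (R : realType) (n : nat) (Omega : set 'rV[R]_n.+1)
    (alpha r gamma : R)
    (Omega_domain : domain Omega) (Omega_bounded : bounded_set Omega)
    (alpha_itv : 0 < alpha < pi / 2) (r_gt0 : 0 < r)
    (Omega_cone : uniform_exterior_cone Omega alpha r)
    (gamma_itv : 0 < gamma <
       8 * sin alpha ^ (n.+1%:Z - 2) / (n.+1%:R * (13 * pi ^+ 2 + 4 * pi))) :
  forall xi : 'rV[R]_n.+1, boundary Omega xi ->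
  exists w : 'rV[R]_n.+1 -> R,
    [/\ [/\ {within closure Omega, continuous w},
            w xi = 0 &
            forall x, closure Omega x -> x != xi -> 0 < w x],
        forall (x : 'rV[R]_n.+1) (s : R), 0 < s -> eball x s `<=` Omega ->
          ball_mean w x s <= w x /\ ball_midrange w x s <= w x,
        forall x, closure Omega x ->
          alpha ^ (2 - n.+1%:Z) * Num.min (enorm (x - xi)) r `^ gamma <= w x
            <= gamma ^- 2 * enorm (x - xi) `^ gamma &
        forall p : \bar R, (2%:E <= p)%E ->
          (forall rho : 'rV[R]_n.+1 -> R, admissible_radius Omega rho ->
             T_barrier Omega rho p xi w) /\
          p_barrier Omega p xi w].
Proof.
case: n Omega Omega_domain Omega_bounded Omega_cone gamma_itv => [|k] Omega dO bO cO gammaP xi bxi.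
  by have := uniform_exterior_cone_rV1 r_gt0 dO bO cO.
have [oO _ O0] := dO.
have [_ Oxi] := open_boundary oO bxi.
(* The exponents are integers in the statement because dimension one would give [-1]; from here on
   they are powers by the natural number [k]. *)
have powD : k.+2%:Z - 2 = k%:Z by rewrite -addn2 PoszD addrK.
have powN : 2 - k.+2%:Z = - k%:Z by rewrite -powD opprB.
rewrite powD powN in gammaP *.
have /andP[gamma0 gammaS] := gammaP.
have p0 := @pi_gt0 R.
have gamma_lt : gamma * (k.+2%:R * (13 * pi ^+ 2 + 4 * pi)) < 8 * sin alpha ^+ k.
  by move: gammaS; rewrite ltr_pdivlMr// mulr_gt0// addr_gt0// mulr_gt0// exprn_gt0.
have gamma_le := gamma_small alpha_itv gamma0 gamma_lt.
have gamma5 : 0 < gamma <= 1 / 5 by lra.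
have [a [m [F [F1 [F2 prof]]]]] := profile_exists alpha_itv gamma0 gamma_lt.
have [Q rQ cQ] := cO xi bxi; have [e1 cone_out] := exterior_cone_axis rQ cQ.
pose w := cone_barrier alpha r gamma xi (row 0 Q) F.
have cw : {within closure Omega, continuous w}.
  by apply: continuous_subspaceT; exact: cone_barrier_continuous prof e1.
have wxi : w xi = 0 by exact: cone_barrier_xi prof e1.
have w0 x : closure Omega x -> x != xi -> 0 < w x.
  by move=> _; exact: cone_barrier_gt0 prof e1 _.
have ball := cone_barrier_ball alpha_itv r_gt0 gamma5 prof e1 Oxi cone_out.
exists w; split=> //.
  by move=> x _; rewrite -exprnN; exact: cone_barrier_bounds alpha_itv r_gt0 gamma5 prof e1 x.
move=> p p2; split=> [rho arho|].
  by apply: T_barrier_of_ball => //.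
split=> //.
exact: (cone_barrier_p_superharmonic oO alpha_itv r_gt0 gamma5 prof e1 Oxi cone_out).
Qed.
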